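(* For every $\alpha\in(0,1)$ let $C(\alpha)$ be a real constant such that $\|\tau\|_{C^{2+\alpha}(\overline B)}\le C(\alpha)\|\Delta\tau\|_{C^\alpha(\overline B)}$ for all $\tau\in C^{2+\alpha}(\overline B)$ with $\tau=0$ on $\partial B$ (such a constant exists). Let $X\colon\overline B\to\mathbb R^4$ be a conformally parametrized immersion with area element $W$ and normal bundle of curvature $S_N$. Then there exists a normal Coulomb frame $N=(N_1,N_2)$ of $X$ which minimizes the functional of total torsion and whose torsion coefficients satisfy $$\|T_{\sigma,i}^\vartheta\|_{C^{1+\alpha}(\overline B)}\le C(\alpha)\,\|S_NW\|_{C^\alpha(\overline B)},\qquad i,\sigma,\vartheta=1,2,$$ for all $\alpha\in(0,1)$.
   Context: $B=\{(u,v)\in\mathbb R^2: u^2+v^2<1\}$; $u^1=u$, $u^2=v$. Immersions satisfy $X\in C^{k,\beta}(\overline B,\mathbb R^{4})$ for some integer $k\ge3$ and $\beta\in(0,1)$, with $\mathrm{rank}\,DX=2$ on $\overline B$. Conformally parametrized: $X_u\cdot X_u=X_v\cdot X_v=W$, $X_u\cdot X_v=0$ on $\overline B$. A normal frame is a pair $N=(N_1,N_2)$ of maps in $C^{k-1,\beta}(\overline B,\mathbb R^4)$ with $N_\sigma\cdot N_\vartheta=\delta_{\sigma\vartheta}$, $N_\sigma\cdot X_{u^i}=0$, $\det(X_u,X_v,N_1,N_2)>0$. Torsion coefficients: $T_{\sigma,i}^\vartheta=N_{\sigma,u^i}\cdot N_\vartheta$ (so $T_{\sigma,i}^\vartheta=-T_{\vartheta,i}^\sigma$).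 Curvature of the normal bundle: $S_N=\frac1W\big(\partial_vT_{1,1}^2-\partial_uT_{1,2}^2\big)$, which does not depend on the choice of the normal frame. Total torsion (in conformal parameters): $\mathcal T(N)=2\iint_B\{(T_{1,1}^2)^2+(T_{1,2}^2)^2\}\,du\,dv$; minimizing means among all normal frames of $X$. $N$ is a normal Coulomb frame if it is critical for $\mathcal T$ with respect to variations $\widetilde N_1=\cos\varphi\,N_1+\sin\varphi\,N_2$, $\widetilde N_2=-\sin\varphi\,N_1+\cos\varphi\,N_2$ (i.e. for every smooth $\psi$ on $\overline B$, taking $\varphi=\varepsilon\psi$, the derivative of $\mathcal T(\widetilde N)$ at $\varepsilon=0$ vanishes). *)

(* Defs.v *)
(* MathComp-Analysis; points of the plane are pairs (u, v) : R * R, vectors of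
   R^4 are row vectors. *)
From HB Require Import structures.
From mathcomp Require Import all_boot all_order all_algebra.
From mathcomp Require Import all_classical all_reals all_analysis.

Set Implicit Arguments.
Unset Strict Implicit.
Unset Printing Implicit Defensive.

Import Order.TTheory GRing.Theory Num.Theory.
Import numFieldNormedType.Exports.

Local Open Scope classical_set_scope.
Local Open Scope ring_scope.

Section Disk.
Context {R : realType}.
Implicit Types (p q : R * R) (f : R * R -> R) (i : 'I_2) (m a b : nat).

Definition disk : set (R * R) := [set p | p.1 ^+ 2 + p.2 ^+ 2 < 1].
Definition cdisk : set (R * R) := [set p | p.1 ^+ 2 + p.2 ^+ 2 <= 1].
Definition circle : set (R * R) := [set p | p.1 ^+ 2 + p.2 ^+ 2 = 1].

(* The norm of the product R * R is the sup norm, hence this distance. *)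
Definition edist p q : R :=
  Num.sqrt ((p.1 - q.1) ^+ 2 + (p.2 - q.2) ^+ 2).

(* dir 0 = (1, 0) and dir 1 = (0, 1). *)
Definition dir i : R * R := ((i == 0)%:R, (i == 1)%:R).

(* Partial derivative on the closed disk: the extension to cdisk, by limits from
   inside the open disk, of the partial derivative taken on the open disk.
   Meaningful for functions of class Cdisk 1 (below), for which it is the usual
   partial derivative at the points of disk and its continuous extension at the
   points of circle.  Values of f outside cdisk are irrelevant. *)
Definition pd i f (p : R * R) : R :=
  lim ('D_(dir i) f q @[q --> within disk (nbhs p)]).

(* C^m of the closed disk: all partial derivatives of order at most m exist on
   the open disk and extend continuously to the closed disk. *)
Fixpoint Cdisk m f : Prop :=
  {within cdisk, continuous f} /\
  if m is m'.+1 then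
    forall i,
      [/\ forall p, disk p -> derivable f p (dir i),
          forall p, cdisk p ->
            cvg ('D_(dir i) f q @[q --> within disk (nbhs p)])
        & Cdisk m' (pd i f)]
  else True.

(* d^(a+b) f / du^a dv^b *)
Definition pdn a b f : R * R -> R := iter a (pd 0) (iter b (pd 1) f).

Definition laplacian f (p : R * R) : R := pdn 2 0 f p + pdn 0 2 f p.

Definition sup_norm f : \bar R :=
  ereal_sup [set `|f p|%:E | p in cdisk].

Definition holder_seminorm (alpha : R) f : \bar R :=
  ereal_sup [set x | exists p q,
    [/\ cdisk p, cdisk q, p <> q
      & x = (`|f p - f q| / edist p q `^ alpha)%:E]].

(* Norm of C^(m+alpha) of the closed disk, summed over the multi-indices
   (a, s - a); it is +oo when f is of class Cdisk m but some derivative of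
   order m is not alpha-Hoelder continuous. *)
Definition holder_norm m (alpha : R) f : \bar R :=
  (\sum_(s < m.+1) \sum_(a < s.+1) sup_norm (pdn a (s - a) f) +
   \sum_(a < m.+1) holder_seminorm alpha (pdn a (m - a) f))%E.

Definition holder m (alpha : R) f : Prop :=
  Cdisk m f /\ (holder_norm m alpha f < +oo)%E.

Definition smooth f : Prop := forall m, Cdisk m f.

End Disk.

Section NormalBundle.
Context {R : realType}.
Implicit Types (X : R * R -> 'rV[R]_4) (N : 'I_2 -> R * R -> 'rV[R]_4).
Implicit Types (W phi : R * R -> R) (i s t : 'I_2) (k : nat) (beta : R).

Definition coord4 X (j : 'I_4) (p : R * R) : R := X p 0 j.

Definition vholder k beta X : Prop := forall j, holder k beta (coord4 X j).

Definition vpd i X (p : R * R) : 'rV[R]_4 := \row_j pd i (coord4 X j) p.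

Definition dot (x y : 'rV[R]_4) : R := \sum_j x 0 j * y 0 j.

Definition jacobian X (p : R * R) : 'M[R]_(4, 2) :=
  \matrix_(j, i) vpd i X p 0 j.

Definition immersion k beta X : Prop :=
  vholder k beta X /\ forall p, cdisk p -> \rank (jacobian X p) = 2%N.

Definition conformal X W : Prop :=
  forall p, cdisk p ->
    [/\ dot (vpd 0 X p) (vpd 0 X p) = W p,
        dot (vpd 1 X p) (vpd 1 X p) = W p
      & dot (vpd 0 X p) (vpd 1 X p) = 0].

(* N 0 and N 1 are N_1 and N_2; the index 0 of vpd is u and 1 is v. *)
Definition normal_frame k beta X N : Prop :=
  (forall s, vholder k.-1 beta (N s)) /\
  forall p, cdisk p ->
    [/\ forall s t, dot (N s p) (N t p) = (s == t)%:R,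
        forall s i, dot (N s p) (vpd i X p) = 0
      & 0 < \det (\matrix_(j < 4)
              tnth [tuple vpd 0 X p; vpd 1 X p; N 0 p; N 1 p] j)].

(* torsion N s t i is T_{s,i}^t. *)
Definition torsion N s t i (p : R * R) : R := dot (vpd i (N s) p) (N t p).

(* S_N, computed in the frame N; the value is the same for all normal frames of
   a given immersion. *)
Definition normal_curvature W N (p : R * R) : R :=
  (W p)^-1 * (pd 1 (torsion N 0 1 0) p - pd 0 (torsion N 0 1 1) p).

Definition total_torsion N : R :=
  2 * Rintegral (lebesgue_measure \x lebesgue_measure)%E disk
        (fun p => torsion N 0 1 0 p ^+ 2 + torsion N 0 1 1 p ^+ 2).

Definition rotate phi N s (p : R * R) : 'rV[R]_4 :=
  if s == 0 then cos (phi p) *: N 0 p + sin (phi p) *: N 1 p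
  else - sin (phi p) *: N 0 p + cos (phi p) *: N 1 p.

Definition normal_coulomb_frame k beta X N : Prop :=
  normal_frame k beta X N /\
  forall psi, smooth psi ->
    is_derive (0 : R) (1 : R)
      (fun eps : R => total_torsion (rotate (fun p => eps * psi p) N)) (0 : R).

Definition minimizes_total_torsion k beta X N : Prop :=
  forall M, normal_frame k beta X M -> total_torsion N <= total_torsion M.

End NormalBundle.

(* Main.v *)
(* A conformal immersion of the closed disk has a normal frame N0 of the same
   regularity as its first derivatives: the tangent planes along the dilated disks
   t * B, 0 <= t <= 1, vary uniformly continuously, so a unit normal vector at the
   centre can be transported to B in finitely many steps, projecting on the normal
   planes and normalizing; the second vector is a triple cross product.
   Rotating N0 by an angle phi adds grad phi to its torsion T.  Let tau solve
   Lap tau = d_v T_1 - d_u T_2, tau = 0 on the circle; then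
   (tau_v, - tau_u) - T is curl-free, hence is grad phi for some phi, and the
   rotated frame N has torsion (tau_v, - tau_u).  The torsion of any other
   normal frame is, up to sign, that of N plus a curl-free field F, and
   (tau_v, - tau_u) is L^2-orthogonal to F since tau = 0 on the circle: this gives
   minimality and criticality.  Finally Lap tau = S_N W, so the bound on the
   torsion is part of the Schauder estimate for tau.
   The estimate is only assumed a priori, so that the Dirichlet problem has to be
   solved.  For polynomial right-hand sides this is explicit; Bernstein
   approximation keeps Hoelder seminorms bounded, and the Schauder estimates with
   exponents alpha and alpha / 2 give existence for right-hand sides in C^alpha.
   Higher regularity follows by solving the problems satisfied by the derivatives
   of tau and identifying the solutions weakly. *)
Require Import Defs.
From HB Require Import structures.
From mathcomp Require Import all_boot all_order all_algebra.
From mathcomp Require Import all_classical all_reals all_analysis.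
From mathcomp Require Import ring lra zify measurable_realfun.

Import Order.TTheory GRing.Theory Num.Theory.
Import numFieldNormedType.Exports.

Local Open Scope classical_set_scope.
Local Open Scope ring_scope.

Set Implicit Arguments.
Unset Strict Implicit.
Unset Printing Implicit Defensive.

(* MathComp-Analysis has another [edist]. *)
Local Notation edist := Defs.edist.

(** * The closed disk *)

(** Polynomials are not dense in a Hoelder space, so approximants of the right-hand side converge
    only uniformly, with bounded seminorms of exponent [alpha]. Interpolation makes them Cauchy with
    exponent [alpha / 2]: that estimate yields convergence of the second derivatives, and the one
    with exponent [alpha] bounds the seminorm of the limit. Applied to differences, the estimate
    also gives uniqueness, in place of a maximum principle. Two regularity gaps shape the rest. The
    rotated frame must again be of class k - 1, so tau has to gain two derivatives over its
    right-hand side, up to the circle; but derivatives of tau need not have a Laplacian yet, hence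
    the weak identification. And the final bound is claimed for every alpha while X has only the
    exponent beta: this takes solutions of class C^(2+alpha), uniqueness with the smaller exponent,
    and positivity of C(alpha) when the right-hand side is infinite. Competing frames are compared
    without a continuous angle: if (a, b) are the coordinates of a unit normal in the frame N, the
    form a db - b da replaces the differential of the angle. *)

Section Geometry.
Context {R : realType}.
Implicit Types (p q : R * R) (f g : R * R -> R).

Lemma edist_ge0 p q : 0 <= edist p q.
Proof. exact: sqrtr_ge0. Qed.

Lemma edistC p q : edist p q = edist q p.
Proof. by rewrite /edist -sqrrN opprB -(sqrrN (p.2 - _)) opprB. Qed.

Lemma sqr_edist p q : edist p q ^+ 2 = (p.1 - q.1) ^+ 2 + (p.2 - q.2) ^+ 2.
Proof. by rewrite /edist sqr_sqrtr// addr_ge0// sqr_ge0. Qed.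

Lemma edist1 p q : `|p.1 - q.1| <= edist p q.
Proof.
rewrite -ler_sqr ?nnegrE ?edist_ge0// sqr_edist real_normK ?num_real//.
by rewrite lerDl sqr_ge0.
Qed.

Lemma edist2 p q : `|p.2 - q.2| <= edist p q.
Proof.
rewrite -ler_sqr ?nnegrE ?edist_ge0// sqr_edist real_normK ?num_real//.
by rewrite lerDr sqr_ge0.
Qed.

Lemma edist_le_sum p q : edist p q <= `|p.1 - q.1| + `|p.2 - q.2|.
Proof.
rewrite -ler_sqr ?nnegrE ?edist_ge0 ?addr_ge0// sqr_edist.
move: (p.1 - q.1) (p.2 - q.2) => a b; rewrite sqrrD.
by rewrite !real_normK ?num_real// [leRHS]addrAC lerDl mulrn_wge0// mulr_ge0.
Qed.

Lemma edist_eq0 p q : edist p q = 0 -> p = q.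
Proof.
move=> e0; case: p q e0 => [a b] [c d] e0.
have := edist1 (a, b) (c, d); have := edist2 (a, b) (c, d).
rewrite e0 !normr_le0 !subr_eq0 /= => /eqP -> /eqP -> //.
Qed.

Lemma edist_triangle p q r : edist p r <= edist p q + edist q r.
Proof.
rewrite -ler_sqr ?nnegrE ?addr_ge0 ?edist_ge0// sqrrD !sqr_edist.
set a := p.1 - q.1; set b := p.2 - q.2; set c := q.1 - r.1; set d := q.2 - r.2.
have -> : p.1 - r.1 = a + c by rewrite /a /c; ring.
have -> : p.2 - r.2 = b + d by rewrite /b /d; ring.
have : a * c + b * d <= edist p q * edist q r.
  apply: le_trans (ler_norm _) _.
  rewrite -ler_sqr ?nnegrE ?mulr_ge0 ?edist_ge0// exprMn !sqr_edist -/a -/b -/c -/d.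
  rewrite real_normK ?num_real// -subr_ge0.
  have -> : (a ^+ 2 + b ^+ 2) * (c ^+ 2 + d ^+ 2) - (a * c + b * d) ^+ 2 =
            (a * d - b * c) ^+ 2 by ring.
  exact: sqr_ge0.
by move: (edist p q * edist q r) => x; rewrite mulr2n; lra.
Qed.

Lemma edist_gt0 p q : p <> q -> 0 < edist p q.
Proof.
move=> pq; rewrite lt_neqAle edist_ge0 andbT eq_sym.
by apply/eqP => /edist_eq0.
Qed.

Lemma disk_cdisk p : disk p -> cdisk p.
Proof. exact: ltW. Qed.

Lemma circle_cdisk p : circle p -> cdisk p.
Proof. by move=> h; rewrite /cdisk/= h. Qed.

Lemma cdisk0 : cdisk (0 : R * R).
Proof. by rewrite /cdisk/= !expr0n addr0 ler01. Qed.

Lemma edist_cdisk_le2 p q : cdisk p -> cdisk q -> edist p q <= 2.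
Proof.
rewrite /cdisk/= => hp hq.
rewrite -ler_sqr ?nnegrE ?edist_ge0// sqr_edist.
by move: hp hq (sqr_ge0 (p.1 + q.1)) (sqr_ge0 (p.2 + q.2)); nra.
Qed.

Lemma cdisk_edist0 p : cdisk p <-> edist p 0 <= 1.
Proof.
rewrite -ler_sqr ?nnegrE ?edist_ge0// sqr_edist /= !subr0 expr1n //.
Qed.

Lemma disk_edist0 p : disk p <-> edist p 0 < 1.
Proof.
rewrite -ltr_sqr ?nnegrE ?edist_ge0// sqr_edist /= !subr0 expr1n //.
Qed.

Lemma dot_dir (i : 'I_2) : (dir i).1 ^+ 2 + (dir i).2 ^+ 2 = 1 :> R.
Proof.
by case: i => [[|[|//]] ?] /=; rewrite ?expr1n expr0n/= ?addr0 ?add0r.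
Qed.

Lemma edist_line (t s : R) i p : edist (t *: dir i + p) (s *: dir i + p) = `|t - s|.
Proof.
rewrite /edist /= -sqrtr_sqr; congr (Num.sqrt _).
transitivity ((t - s) ^+ 2 * ((dir i).1 ^+ 2 + (dir i).2 ^+ 2) : R); last first.
  by rewrite dot_dir mulr1.
rewrite /= /GRing.scale /=; ring.
Qed.

End Geometry.

(** * Uniform continuity and compactness of the closed disk *)

Section Continuity.
Context {R : realType}.
Implicit Types (p q : R * R) (f g : R * R -> R).

(** The topology of [R * R] comes from the sup norm, the Hoelder norms from the Euclidean distance.
    The two distances are comparable, so the proofs below can quantify with [edist] alone. *)
Lemma nbhs_edist p (A : set (R * R)) :
  nbhs p A <-> exists2 d : R, 0 < d & forall q, edist p q < d -> A q.
Proof.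
split.
- move=> /nbhs_ballP[d /= d0 dA]; exists d => // q pq; apply: dA; split.
  + exact: le_lt_trans (edist1 _ _) pq.
  + exact: le_lt_trans (edist2 _ _) pq.
- move=> [d d0 dA]; apply/nbhs_ballP; exists (d / 2) => /=; first by rewrite divr_gt0.
  move=> q [/= b1 b2]; apply: dA; apply: le_lt_trans (edist_le_sum _ _) _.
  by move: b1 b2; rewrite /ball /=; lra.
Qed.

Lemma within_continuousP f :
  {within cdisk, continuous f} <->
  forall p, cdisk p -> forall e : R, 0 < e ->
    exists2 d : R, 0 < d & forall q, cdisk q -> edist p q < d -> `|f p - f q| < e.
Proof.
split=> [/subspace_continuousP cf p dp e e0|cf].
- have /cvgrPdist_lt/(_ _ e0) := cf p dp.
  rewrite /prop_near1 /within /= => /nbhs_edist[d d0 H]; exists d => // q dq pq.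
  exact: H pq dq.
- apply/subspace_continuousP => p dp; apply/cvgrPdist_lt => e e0.
  have [d d0 H] := cf p dp e e0; apply/nbhs_edist; exists d => // q pq dq.
  exact: H.
Qed.

Lemma compact_cdisk : compact (@cdisk R).
Proof.
have c1 : compact (`[-1, 1] `*` `[-1, 1] : set (R * R)).
  by apply: compact_setX; exact: segment_compact.
apply: (subclosed_compact _ c1); last first.
  move=> p /=; rewrite /cdisk/= !in_itv/= => h.
  by split; apply/andP; split; nra.
suff -> : @cdisk R = (fun p => p.1 ^+ 2 + p.2 ^+ 2) @^-1` [set x | x <= 1].
  apply: closed_comp; last exact: closed_le.
  move=> p _.
  apply: (@continuousD _ _ _ (fun p : R * R => p.1 ^+ 2 : R^o) (fun p => p.2 ^+ 2)).
    apply: (@continuous_comp _ _ _ fst (fun x : R => x ^+ 2)); last exact: exprn_continuous.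
    exact: cvg_fst.
  apply: (@continuous_comp _ _ _ snd (fun x : R => x ^+ 2)); last exact: exprn_continuous.
  exact: cvg_snd.
by [].
Qed.

Definition ucont f := forall e : R, 0 < e -> exists2 d : R, 0 < d &
  forall p q, cdisk p -> cdisk q -> edist p q < d -> `|f p - f q| <= e.

(** Heine-Cantor theorem. The near-covering form of compactness, applied to the filter of positive d
    tending to 0, turns the local moduli into a common one. *)
Lemma ucont_within f : ucont f <-> {within cdisk, continuous f}.
Proof.
split.
  move=> cf; apply/within_continuousP => p dp e e0.
  have [|d d0 H] := cf (e / 2); first by rewrite divr_gt0.
  exists d => // q dq pq; apply: le_lt_trans (H _ _ dp dq pq) _; lra.
move=> /within_continuousP cf e e0.
have /compact_near_coveringP/near_covering_withinP cc := compact_cdisk.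
have [x dx|] := cc R (0^'+) (fun d p => forall q, cdisk q -> edist p q < d -> `|f p - f q| <= e) _.
  have [|d d0 H] := cf x dx (e / 2); first by rewrite divr_gt0.
  exists ([set p | edist x p < d / 2], [set r | r < d / 2]) => /=.
    split => /=.
      by apply/nbhs_edist; exists (d / 2); rewrite ?divr_gt0.
    by near=> r => /=; near: r; apply: nbhs_right_lt; rewrite divr_gt0.
  move=> [p r] /= [xp rd] dp q dq pq.
  have h1 := H p dp ltac:(lra).
  have h2 : `|f x - f q| < e / 2.
    apply: H => //; apply: le_lt_trans (edist_triangle _ p _) _; lra.
  by rewrite distrC in h1; have := ler_distD (f x) (f p) (f q); lra.
move=> d /= d0 H; exists (d / 2); first by rewrite divr_gt0.
move=> p q dp dq pq; apply: (H (d / 2)) => //=.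
  by rewrite sub0r normrN gtr0_norm; lra.
by rewrite divr_gt0.
Unshelve. all: by end_near. Qed.

Lemma cdisk_bounded f : {within cdisk, continuous f} ->
  exists2 M : R, 0 <= M & forall p, cdisk p -> `|f p| <= M.
Proof.
move=> cf.
have n0 : @cdisk R !=set0 by exists 0; exact: cdisk0.
have [c _ hc] := compact_EVT_max n0 compact_cdisk cf.
have [c' _ hc'] := compact_EVT_min n0 compact_cdisk cf.
exists (`|f c| + `|f c'|); first by rewrite addr_ge0.
move=> p dp.
have := hc p (mem_set dp); have := hc' p (mem_set dp).
have := ler_norm (f c); have := ler_norm (- f c'); rewrite normrN.
by move=> *; rewrite ler_norml; apply/andP; split; [have := normr_ge0 (f c)|have := normr_ge0 (f c')]; lra.
Qed.

Lemma cdisk_pos f : {within cdisk, continuous f} ->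
  (forall p, cdisk p -> 0 < f p) -> exists2 m : R, 0 < m & forall p, cdisk p -> m <= f p.
Proof.
move=> cf f0.
have n0 : @cdisk R !=set0 by exists 0; exact: cdisk0.
have [c /set_mem dc hc'] := compact_EVT_min n0 compact_cdisk cf.
by exists (f c); [exact: f0|move=> p dp; exact: hc' (mem_set dp)].
Qed.

End Continuity.

(** * Derivatives along coordinate lines and mean value estimates up to the circle *)

Section Derivatives.
Context {R : realType}.
Implicit Types (p q : R * R) (f g : R * R -> R) (i : 'I_2).

Lemma is_derive_line f (p v : R * R) (t d : R) :
  is_derive (t *: v + p) v f d <-> is_derive t 1 (fun s => f (s *: v + p)) d.
Proof.
have E : (fun h : R => h^-1 *: ((f \o shift (t *: v + p)) (h *: v) - f (t *: v + p))) =
  (fun h : R => h^-1 *: (((fun s => f (s *: v + p)) \o shift t) (h *: 1) - f (t *: v + p))).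
  by apply/funext => h /=; have -> : h%:A = h :> R by [exact: mulr1]; rewrite scalerDl addrA.
by split=> -[c e]; split; rewrite /derivable /derive E in c e *.
Qed.

Lemma is_derive_line0 f (p v : R * R) (d : R) :
  is_derive p v f d <-> is_derive (0 : R) 1 (fun s => f (s *: v + p)) d.
Proof. by rewrite -is_derive_line scale0r add0r. Qed.

Definition pderiv i f g := forall p, disk p -> is_derive p (dir i) f (g p).

Lemma disk_open p : disk p -> \forall q \near p, disk q.
Proof.
move=> /disk_edist0 dp; apply/nbhs_edist; exists (1 - edist p 0); first by rewrite subr_gt0.
move=> q pq; apply/disk_edist0; apply: le_lt_trans (edist_triangle _ p _) _.
by rewrite (edistC q); lra.
Qed.

Lemma is_derive_near (f f' : R * R -> R) p v d :
  (\forall q \near p, f q = f' q) -> is_derive p v f d -> is_derive p v f' d.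
Proof.
have [->|v0] := eqVneq v 0.
  move=> _ [_ <-]; rewrite derive0; exact: is_derive0.
move=> nf; apply/near_eq_is_derive => //.
Qed.

Lemma pderiv_ext i f f' g g' : (forall p, disk p -> f p = f' p) ->
  (forall p, disk p -> g p = g' p) -> pderiv i f g -> pderiv i f' g'.
Proof.
move=> ff' gg' fg p dp; rewrite -gg'//; apply: is_derive_near (fg p dp).
by apply: filterS (disk_open dp) => q /ff'.
Qed.

(** Strict convexity of the disk: for |x|^2 - 1 as a function of the parameter, h times its value at
    t is the combination of its end values with weights t and h - t, minus h t (h - t). So even a
    segment with ends on the circle has its inner points where derivatives exist. *)
Lemma line_disk i p (h t : R) : cdisk p -> cdisk (h *: dir i + p) -> 0 < t < h ->
  disk (t *: dir i + p).
Proof.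
rewrite /cdisk /disk /= => hp hq /andP[t0 th].
have := dot_dir i; rewrite /dir /=; move: hq; rewrite /GRing.scale/=.
set a := (i == 0)%:R; set b := (i == 1)%:R => hq e.
have h0 : 0 < h by lra.
rewrite -subr_lt0 -(pmulr_rlt0 _ h0).
have -> : h * ((t * a + p.1) ^+ 2 + (t * b + p.2) ^+ 2 - 1) =
  t * ((h * a + p.1) ^+ 2 + (h * b + p.2) ^+ 2 - 1) + (h - t) * (p.1 ^+ 2 + p.2 ^+ 2 - 1)
  + h * t * (t - h) * (a ^+ 2 + b ^+ 2) by ring.
rewrite e mulr1.
have : t * ((h * a + p.1) ^+ 2 + (h * b + p.2) ^+ 2 - 1) <= 0.
  by rewrite pmulr_rle0// subr_le0.
have : (h - t) * (p.1 ^+ 2 + p.2 ^+ 2 - 1) <= 0.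
  by rewrite pmulr_rle0 ?subr_gt0// subr_le0.
have : h * t * (t - h) < 0 by rewrite pmulr_rlt0 ?subr_lt0// mulr_gt0.
lra.
Qed.

Lemma line_cdisk i p (h t : R) : cdisk p -> cdisk (h *: dir i + p) -> 0 <= t <= h ->
  cdisk (t *: dir i + p).
Proof.
move=> dp dq /andP[]; rewrite le_eqVlt => /orP[/eqP <-|t0].
  by rewrite scale0r add0r.
rewrite le_eqVlt => /orP[/eqP ->//|th].
by apply/disk_cdisk/(@line_disk _ _ h) => //; rewrite t0.
Qed.

Lemma line0E (h x y : R) : h *: dir 0 + (x, y) = (h + x, y) :> R * R.
Proof. by transitivity ((h * 1 + x, h * 0 + y) : R * R); rewrite // mulr1 mulr0 add0r. Qed.

Lemma line1E (h x y : R) : h *: dir 1 + (x, y) = (x, h + y) :> R * R.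
Proof. by transitivity ((h * 0 + x, h * 1 + y) : R * R); rewrite // mulr1 mulr0 add0r. Qed.

Lemma line_MVT i f g p (h : R) : ucont f -> pderiv i f g -> 0 < h ->
  cdisk p -> cdisk (h *: dir i + p) ->
  exists t : R, [/\ 0 < t < h, disk (t *: dir i + p)
    & f (h *: dir i + p) - f p = g (t *: dir i + p) * h].
Proof.
move=> cf fg h0 dp dq.
have := @MVT R (fun t => f (t *: dir i + p)) (fun t => g (t *: dir i + p)) 0 h h0.
case.
- move=> t; rewrite in_itv /= => th; apply: (proj1 (is_derive_line _ _ _ _ _)).
  by apply: fg; exact: line_disk dp dq th.
- apply/subspace_continuousP => t; rewrite /= in_itv /= => th.
  apply/cvgrPdist_le => e e0; have [d d0 H] := cf e e0.
  apply/nbhs_ballP; exists d => //= s ts; rewrite in_itv/= => sh.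
  by apply: H; [exact: line_cdisk dp dq th|exact: line_cdisk dp dq sh|rewrite edist_line].
move=> t; rewrite in_itv /= => th; rewrite subr0 scale0r add0r => E.
by exists t; split => //; exact: line_disk dp dq th.
Qed.

Lemma line_lip i f g p (h M : R) : ucont f -> pderiv i f g ->
  (forall q, disk q -> `|g q| <= M) ->
  cdisk p -> cdisk (h *: dir i + p) -> `|f (h *: dir i + p) - f p| <= M * `|h|.
Proof.
move=> cf fg gM.
suff H (k : R) q : 0 < k -> cdisk q -> cdisk (k *: dir i + q) -> `|f (k *: dir i + q) - f q| <= M * `|k|.
  have [h0|h0|->] := ltgtP h 0; [|exact: H|].
  - move=> dp dq; have := H (- h) (h *: dir i + p).
    rewrite addrA -scalerDl addNr scale0r add0r distrC normrN; apply => //; lra.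
  - by move=> _ _; rewrite scale0r add0r subrr normr0 mulr0.
move=> k0 dp dq; have [t [_ dt ->]] := line_MVT cf fg k0 dp dq.
by rewrite normrM ler_wpM2r// gM.
Qed.

(** The points (a, b) and (c, d) are joined by an axis-parallel path. One of its possible corners
    (a, d) and (c, b) is in the closed disk, because their squared norms add up to at most 2. The
    factor 2 compares the length of the path with the Euclidean distance. *)
Lemma grad_lip f (g : 'I_2 -> R * R -> R) (M : R) : 0 <= M -> ucont f -> (forall i, pderiv i f (g i)) ->
  (forall i p, disk p -> `|g i p| <= M) ->
  forall p q, cdisk p -> cdisk q -> `|f p - f q| <= M * 2 * edist p q.
Proof.
move=> M0 cf fg gM.
have H (a b c d : R) : cdisk (a, b) -> cdisk (c, d) -> cdisk (a, d) ->
    `|f (a, b) - f (c, d)| <= M * (`|a - c| + `|b - d|).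
  move=> ab cd ad.
  have E1 : (b - d) *: dir 1 + (a, d) = (a, b) :> R * R.
    by rewrite line1E subrK.
  have E2 : (a - c) *: dir 0 + (c, d) = (a, d) :> R * R.
    by rewrite line0E subrK.
  have := @line_lip 1 f (g 1) (a, d) (b - d) M cf (fg 1) (gM 1) ad; rewrite E1 => /(_ ab).
  have := @line_lip 0 f (g 0) (c, d) (a - c) M cf (fg 0) (gM 0) cd; rewrite E2 => /(_ ad).
  by have := ler_distD (f (a, d)) (f (a, b)) (f (c, d)); rewrite mulrDr; lra.
move=> [a b] [c d] ab cd.
apply: (@le_trans _ _ (M * (`|a - c| + `|b - d|))); last first.
  by rewrite -mulrA ler_wpM2l//; have := edist1 (a, b) (c, d); have := edist2 (a, b) (c, d); rewrite /=; lra.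
have [ad|nad] := lerP (a ^+ 2 + d ^+ 2) 1; first exact: H.
rewrite distrC (distrC a) (distrC b); apply: H => //.
by move: ab cd nad; rewrite /cdisk /=; lra.
Qed.

End Derivatives.

(** * Classes of differentiable functions *)

Section Regularity.
Context {R : realType}.
Implicit Types (p q : R * R) (f g : R * R -> R) (i : 'I_2) (P : (R * R -> R) -> Prop).

Definition grad f (g : 'I_2 -> R * R -> R) :=
  [/\ ucont f, forall i, ucont (g i) & forall i, pderiv i f (g i)].

(* [reg P m f] below says that the derivatives of order m of f satisfy P; the
   conditions in [base P] hold for uniform continuity and for Hoelder continuity
   and suffice for closure properties of [reg P m]. *)
Record base P : Prop := Base {
  base_ucont : forall f, P f -> ucont f;
  base_dom : forall f1 f2 g (L : R), P f1 -> P f2 ->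
    (forall p q, cdisk p -> cdisk q ->
      `|g p - g q| <= L * (`|f1 p - f1 q| + `|f2 p - f2 q|)) -> P g;
  base_lip : forall f (L : R),
    (forall p q, cdisk p -> cdisk q -> `|f p - f q| <= L * edist p q) -> P f;
  base_dil : forall f (s : R), 0 <= s <= 1 -> P f -> P (fun p => f (s *: p)) }.

Definition hol (alpha : R) f := exists M : R,
  forall p q, cdisk p -> cdisk q -> `|f p - f q| <= M * edist p q `^ alpha.

Lemma cdisk_dil (s : R) p : 0 <= s <= 1 -> cdisk p -> cdisk (s *: p).
Proof.
case: p => [a b] /andP[s0 s1]; rewrite /cdisk /= /GRing.scale /= => dp.
rewrite !exprMn -mulrDr; apply: le_trans (_ : s ^+ 2 * 1 <= _).
  by rewrite ler_wpM2l ?sqr_ge0.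
by rewrite mulr1 exprn_ile1.
Qed.

Lemma disk_dil (s : R) p : 0 <= s <= 1 -> disk p -> disk (s *: p).
Proof.
case: p => [a b] /andP[s0 s1]; rewrite /disk /= /GRing.scale /= => dp.
rewrite !exprMn -mulrDr; apply: le_lt_trans dp.
by rewrite ler_piMl ?addr_ge0 ?sqr_ge0// exprn_ile1.
Qed.

Lemma edist_dil (s : R) p q : 0 <= s -> edist (s *: p) (s *: q) = s * edist p q.
Proof.
case: p q => [a b] [c d] s0; rewrite /edist /= /GRing.scale /=.
by rewrite -!mulrBr !exprMn -mulrDr sqrtrM ?sqr_ge0// sqrtr_sqr ger0_norm.
Qed.

Lemma base_ucontP : base ucont.
Proof.
split=> //.
- move=> f1 f2 g L c1 c2 H e e0.
  have L0 : 0 < `|L| + 1 by rewrite ltr_wpDl.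
  have e1 : 0 < e / (`|L| + 1) / 2 by rewrite !divr_gt0.
  have [d1 d10 h1] := c1 _ e1; have [d2 d20 h2] := c2 _ e1.
  exists (Num.min d1 d2); first by rewrite lt_min d10 d20.
  move=> p q dp dq; rewrite lt_min => /andP[pq1 pq2].
  apply: le_trans (H _ _ dp dq) _.
  apply: le_trans (_ : (`|L| + 1) * (`|f1 p - f1 q| + `|f2 p - f2 q|) <= _).
    by rewrite ler_wpM2r ?addr_ge0//; have := ler_norm L; lra.
  rewrite mulrC -ler_pdivlMr//.
  by have := h1 _ _ dp dq pq1; have := h2 _ _ dp dq pq2; lra.
- move=> f L H e e0.
  have L0 : 0 < `|L| + 1 by rewrite ltr_wpDl.
  exists (e / (`|L| + 1)); first by rewrite divr_gt0.
  move=> p q dp dq; rewrite ltr_pdivlMr// => pq.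
  apply: le_trans (H _ _ dp dq) _.
  have := edist_ge0 p q; have := ler_norm L; nra.
- move=> f s s01 cf e e0; have [d d0 H] := cf e e0; exists d => // p q dp dq pq.
  apply: H; [exact: cdisk_dil|exact: cdisk_dil|].
  case/andP: s01 => s0 s1; rewrite edist_dil//.
  by apply: le_lt_trans pq; rewrite ler_piMl// edist_ge0.
Qed.

Lemma powR_mono (a x y : R) : 0 <= a -> 0 <= x -> x <= y -> x `^ a <= y `^ a.
Proof. by move=> a0 x0 xy; rewrite ge0_ler_powR// nnegrE// (le_trans x0). Qed.

(** Distances in the closed disk are at most 2, so this makes Lipschitz functions Hoelder
    continuous. *)
Lemma powR_lip (alpha d : R) : 0 < alpha < 1 -> 0 <= d <= 2 -> d <= 2 * d `^ alpha.
Proof.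
move=> /andP[a0 a1] /andP[d0 d2]; have [d1|d1] := leP d 1.
  have [->|dn0] := eqVneq d 0; first by rewrite mulr_ge0// powR_ge0.
  have : d `^ 1 <= d `^ alpha by apply: ger_powR; [rewrite d1 andbT lt_neqAle eq_sym dn0|exact: ltW].
  by rewrite powRr1//; have := powR_ge0 d alpha; lra.
have : 1 `^ alpha <= d `^ alpha by apply: powR_mono; lra.
by rewrite powR1; lra.
Qed.

Lemma base_hol (alpha : R) : 0 < alpha < 1 -> base (hol alpha).
Proof.
move=> a01; split.
- move=> f [M H] e e0; case/andP: a01 => a0 a1.
  have M0 : 0 < `|M| + 1 by rewrite ltr_wpDl.
  exists ((e / (`|M| + 1)) `^ alpha^-1); first by rewrite powR_gt0// divr_gt0.
  move=> p q dp dq pq; apply: le_trans (H _ _ dp dq) _.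
  have : edist p q `^ alpha <= e / (`|M| + 1).
    have -> : e / (`|M| + 1) = ((e / (`|M| + 1)) `^ alpha^-1) `^ alpha.
      by rewrite -powRrM mulVf ?gt_eqF// powRr1// divr_ge0// ltW.
    by rewrite powR_mono ?edist_ge0// ltW.
  rewrite ler_pdivlMr//; have := powR_ge0 (edist p q) alpha; have := ler_norm M; nra.
- move=> f1 f2 g L [M1 H1] [M2 H2] H; exists (`|L| * (M1 + M2)) => p q dp dq.
  apply: le_trans (H _ _ dp dq) _; rewrite -mulrA; apply: le_trans (_ : `|L| * (`|f1 p - f1 q| + `|f2 p - f2 q|) <= _).
    by rewrite ler_wpM2r ?ler_norm// addr_ge0.
  by rewrite ler_wpM2l// mulrDl lerD ?H1 ?H2.
- move=> f L H; exists (`|L| * 2) => p q dp dq; apply: le_trans (H _ _ dp dq) _.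
  rewrite -mulrA; apply: le_trans (_ : `|L| * edist p q <= _).
    by rewrite ler_wpM2r ?ler_norm// edist_ge0.
  by rewrite ler_wpM2l// powR_lip// edist_ge0 edist_cdisk_le2.
- move=> f s s01 [M H]; exists `|M| => p q dp dq.
  apply: le_trans (H _ _ (cdisk_dil s01 dp) (cdisk_dil s01 dq)) _.
  case/andP: s01 a01 => s0 s1 /andP[a0 a1].
  rewrite edist_dil//; apply: le_trans (_ : `|M| * (s * edist p q) `^ alpha <= _).
    by rewrite ler_wpM2r ?ler_norm// powR_ge0.
  rewrite ler_wpM2l// powR_mono ?mulr_ge0 ?edist_ge0//; first exact: ltW.
  by rewrite ler_piMl// edist_ge0.
Qed.

Fixpoint reg P m f : Prop :=
  if m is m'.+1 then exists2 g, grad f g & forall i, reg P m' (g i) else P f.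

Section Closure.
Variables (P : (R * R -> R) -> Prop) (bP : base P).

Lemma ucont_ext f f' : (forall p, cdisk p -> f p = f' p) -> ucont f -> ucont f'.
Proof.
move=> ff' cf e e0; have [d d0 H] := cf e e0; exists d => // p q dp dq pq.
by rewrite -!ff'// H.
Qed.

Lemma base_ext f f' : (forall p, cdisk p -> f p = f' p) -> P f -> P f'.
Proof.
move=> ff' Pf; apply: (base_dom bP (L := 1) Pf Pf) => p q dp dq.
by rewrite -!ff'// mul1r lerDl.
Qed.

Lemma grad_ext f f' (g g' : 'I_2 -> R * R -> R) : (forall p, cdisk p -> f p = f' p) ->
  (forall i p, cdisk p -> g i p = g' i p) -> grad f g -> grad f' g'.
Proof.
move=> ff' gg' [cf cg fg]; split.
- exact: ucont_ext cf.
- by move=> i; apply: ucont_ext (cg i) => p; exact: gg'.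
- by move=> i; apply: pderiv_ext (fg i) => p /disk_cdisk; [exact: ff'|exact: gg'].
Qed.

Lemma reg_ext m f f' : (forall p, cdisk p -> f p = f' p) -> reg P m f -> reg P m f'.
Proof.
case: m => [|m] ff' /=; first exact: base_ext.
by move=> [g fg rg]; exists g => //; exact: grad_ext fg.
Qed.

(** A function with a continuous gradient is Lipschitz on the closed disk, hence satisfies every [P]
    with [base P]. This is the bottom case when the order of [reg] is lowered. *)
Lemma grad_base f (g : 'I_2 -> R * R -> R) : grad f g -> P f.
Proof.
move=> [cf cg fg].
have [M0 M00 H0] := cdisk_bounded (proj1 (ucont_within _) (cg 0)).
have [M1 M10 H1] := cdisk_bounded (proj1 (ucont_within _) (cg 1)).
apply: (base_lip bP) => p q dp dq; apply: (grad_lip (M := M0 + M1)) fg _ _ _ dp dq => //.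
  by rewrite addr_ge0.
move=> [[|[|//]] hi] r /disk_cdisk dr.
  have -> : Ordinal hi = 0 by apply/val_inj.
  by apply: le_trans (H0 _ dr) _; rewrite lerDl.
have -> : Ordinal hi = 1 by apply/val_inj.
by apply: le_trans (H1 _ dr) _; rewrite lerDr.
Qed.

Lemma reg_base m f : reg P m f -> P f.
Proof. by case: m => [//|m [g fg _]]; exact: grad_base fg. Qed.

Lemma reg_ucont m f : reg P m f -> ucont f.
Proof. by move/reg_base/(base_ucont bP). Qed.

Lemma regW m f : reg P m.+1 f -> reg P m f.
Proof.
elim: m f => [|m IH] f [g fg rg]; first exact: grad_base fg.
by exists g => // i; exact: IH (rg i).
Qed.

Lemma reg_le m n f : (n <= m)%N -> reg P m f -> reg P n f.
Proof.
elim: m => [|m IH]; first by rewrite leqn0 => /eqP->.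
by rewrite leq_eqVlt => /orP[/eqP->//|/IH H /regW].
Qed.

Lemma grad_cst (c : R) : grad (fun=> c) (fun _ _ => 0).
Proof.
split.
- by move=> e e0; exists 1 => // *; rewrite subrr normr0 ltW.
- by move=> _ e e0; exists 1 => // *; rewrite subrr normr0 ltW.
- move=> i p _; exact: is_derive_cst.
Qed.

Lemma reg_cst m (c : R) : reg P m (fun=> c).
Proof.
elim: m c => [|m IH] c; first by exact: grad_base (grad_cst c).
by exists (fun _ _ => 0) => //; exact: grad_cst.
Qed.

Lemma ucontD f g : ucont f -> ucont g -> ucont (fun p => f p + g p).
Proof.
move=> cf cg; apply: (base_dom base_ucontP (L := 1) cf cg) => p q _ _.
by rewrite mul1r opprD addrACA ler_normD.
Qed.

Lemma baseM f g : P f -> P g -> P (fun p => f p * g p).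
Proof.
move=> Pf Pg.
have [M M0 H] := cdisk_bounded (proj1 (ucont_within _) (base_ucont bP Pf)).
have [N N0 K] := cdisk_bounded (proj1 (ucont_within _) (base_ucont bP Pg)).
apply: (base_dom bP (L := M + N) Pf Pg) => p q dp dq.
have -> : f p * g p - f q * g q = f p * (g p - g q) + (f p - f q) * g q by ring.
apply: le_trans (ler_normD _ _) _; rewrite !normrM.
have := H _ dp; have := K _ dq.
have := normr_ge0 (f p - f q); have := normr_ge0 (g p - g q).
by have := normr_ge0 (f p); have := normr_ge0 (g q); nra.
Qed.

End Closure.

Lemma ucontM f g : ucont f -> ucont g -> ucont (fun p => f p * g p).
Proof. exact: baseM base_ucontP _ _. Qed.

Lemma gradD f g (f' g' : 'I_2 -> R * R -> R) : grad f f' -> grad g g' ->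
  grad (fun p => f p + g p) (fun i p => f' i p + g' i p).
Proof.
move=> [cf cf' df] [cg cg' dg]; split.
- exact: ucontD.
- by move=> i; exact: ucontD.
- by move=> i p dp; have := is_deriveD (df i p dp) (dg i p dp).
Qed.

Lemma gradM f g (f' g' : 'I_2 -> R * R -> R) : grad f f' -> grad g g' ->
  grad (fun p => f p * g p) (fun i p => f p * g' i p + g p * f' i p).
Proof.
move=> [cf cf' df] [cg cg' dg]; split.
- exact: ucontM.
- by move=> i; apply: ucontD; exact: ucontM.
- by move=> i p dp; have := is_deriveM (df i p dp) (dg i p dp).
Qed.

Section SumProduct.
Variables (P : (R * R -> R) -> Prop) (bP : base P).

Lemma regD m f g : reg P m f -> reg P m g -> reg P m (fun p => f p + g p).
Proof.
elim: m f g => [|m IH] f g /=.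
  move=> Pf Pg; apply: (base_dom bP (L := 1) Pf Pg) => p q _ _.
  by rewrite mul1r opprD addrACA ler_normD.
move=> [f' ff' rf] [g' gg' rg]; exists (fun i p => f' i p + g' i p); first exact: gradD.
by move=> i; exact: IH.
Qed.

Lemma regM m f g : reg P m f -> reg P m g -> reg P m (fun p => f p * g p).
Proof.
elim: m f g => [|m IH] f g; first exact: baseM.
move=> rf rg; have rf1 := regW bP rf; have rg1 := regW bP rg.
case: rf rg => [f' ff' rf] [g' gg' rg].
exists (fun i p => f p * g' i p + g p * f' i p); first exact: gradM.
by move=> i; apply: regD; [exact: IH rf1 (rg i)|exact: IH rg1 (rf i)].
Qed.

Lemma regZ m (c : R) f : reg P m f -> reg P m (fun p => c * f p).
Proof. exact/regM/reg_cst. Qed.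

Lemma regN m f : reg P m f -> reg P m (fun p => - f p).
Proof. by move/(regZ (-1)); apply: reg_ext => // p _; rewrite mulN1r. Qed.

Lemma regB m f g : reg P m f -> reg P m g -> reg P m (fun p => f p - g p).
Proof. by move=> rf rg; apply: regD => //; exact: regN. Qed.

Lemma reg_sum m (I : Type) (r : seq I) (F : I -> R * R -> R) :
  (forall j, reg P m (F j)) -> reg P m (fun p => \sum_(j <- r) F j p).
Proof.
move=> H; elim: r => [|j r IH].
  by apply: (reg_ext bP (f := fun=> 0)); [move=> p _; rewrite big_nil|exact: reg_cst].
apply: (reg_ext bP (f := fun p => F j p + \sum_(j <- r) F j p)).
  by move=> p _; rewrite big_cons.
exact: regD.
Qed.

End SumProduct.

Lemma grad_u : grad (fun p => p.1) (fun i _ => (i == 0)%:R).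
Proof.
split.
- apply: (base_lip base_ucontP (L := 1)) => p q _ _; rewrite mul1r; exact: edist1.
- by move=> i; case: (grad_cst (i == 0)%:R).
- move=> i p _; apply: (proj2 (is_derive_line0 _ _ _ _)).
  have := is_deriveD (is_deriveZ (i == 0)%:R (is_derive_id (0 : R) (1 : R))) (is_derive_cst p.1 (0 : R) (1 : R)).
  by rewrite addr0; congr is_derive; [apply/funext => s; rewrite /= /GRing.scale /= mulrC|exact: mulr1].
Qed.

Lemma grad_v : grad (fun p => p.2) (fun i _ => (i == 1)%:R).
Proof.
split.
- apply: (base_lip base_ucontP (L := 1)) => p q _ _; rewrite mul1r; exact: edist2.
- by move=> i; case: (grad_cst (i == 1)%:R).
- move=> i p _; apply: (proj2 (is_derive_line0 _ _ _ _)).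
  have := is_deriveD (is_deriveZ (i == 1)%:R (is_derive_id (0 : R) (1 : R))) (is_derive_cst p.2 (0 : R) (1 : R)).
  by rewrite addr0; congr is_derive; [apply/funext => s; rewrite /= /GRing.scale /= mulrC|exact: mulr1].
Qed.

Lemma reg_u P m : base P -> reg P m (fun p => p.1).
Proof.
move=> bP; case: m => [|m]; first by have := grad_base bP grad_u.
by exists (fun i _ => (i == 0)%:R); [exact: grad_u|move=> i; exact: reg_cst].
Qed.

Lemma reg_v P m : base P -> reg P m (fun p => p.2).
Proof.
move=> bP; case: m => [|m]; first by have := grad_base bP grad_v.
by exists (fun i _ => (i == 1)%:R); [exact: grad_v|move=> i; exact: reg_cst].
Qed.

Lemma grad_dil (s : R) f (g : 'I_2 -> R * R -> R) : 0 <= s <= 1 -> grad f g ->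
  grad (fun p => f (s *: p)) (fun i p => s * g i (s *: p)).
Proof.
move=> s01 [cf cg fg]; have dil h := base_dil base_ucontP (f := h) s01.
split; first exact: dil.
  by move=> i; apply: ucontM (dil _ (cg i)); case: (grad_cst s).
move=> i p dp; apply: (proj2 (is_derive_line0 _ _ _ _)).
have h1 := fg i _ (disk_dil s01 dp).
have := is_deriveZ s (is_derive_id (0 : R) (1 : R)).
move=> /(@is_derive1_comp _ (fun t => f (t *: dir i + s *: p))).
have -> : (s \*: (id : R -> R)) 0 = 0 by exact: mulr0.
move=> /(_ (g i (s *: p))) => H.
have := H (proj1 (is_derive_line0 _ _ _ _) h1).
congr is_derive; last by rewrite /GRing.scale /= mulr1 mulrC.
by apply/funext => t /=; rewrite scalerDr scalerA.
Qed.

Lemma reg_dil P m (s : R) f : base P -> 0 <= s <= 1 -> reg P m f ->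
  reg P m (fun p => f (s *: p)).
Proof.
move=> bP s01; elim: m f => [|m IH] f; first exact: base_dil.
move=> [g fg rg]; exists (fun i p => s * g i (s *: p)); first exact: grad_dil.
by move=> i; apply: regZ => //; exact: IH (rg i).
Qed.

Lemma is_derive_bounded (phi dphi : R -> R) (a b : R) :
  (forall x, a <= x <= b -> is_derive x 1 phi (dphi x)) ->
  exists M : R, forall x, a <= x <= b -> `|phi x| <= M.
Proof.
move=> H; have [ab|ab] := leP a b; last by exists 0 => x; lra.
have cphi : {within `[a, b], continuous phi}.
  apply/subspace_continuousP => x; rewrite /= in_itv/= => hx.
  apply: cvg_within_filter; apply: differentiable_continuous.
  by apply/derivable1_diffP; case: (H x hx).
have [c _ hc] := EVT_max ab cphi; have [c' _ hc'] := EVT_min ab cphi.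
exists (`|phi c| + `|phi c'|) => x hx.
have hxI : x \in `[a, b] by rewrite in_itv.
have := hc x hxI; have := hc' x hxI.
have := ler_norm (phi c); have := ler_norm (- phi c'); rewrite normrN.
by move=> *; rewrite ler_norml; apply/andP; split; [have := normr_ge0 (phi c)|have := normr_ge0 (phi c')]; lra.
Qed.

Lemma is_derive_lip (phi dphi : R -> R) (a b M : R) :
  (forall x, a <= x <= b -> is_derive x 1 phi (dphi x)) ->
  (forall x, a <= x <= b -> `|dphi x| <= M) ->
  forall x y, a <= x <= b -> a <= y <= b -> `|phi x - phi y| <= M * `|x - y|.
Proof.
move=> dp HM.
suff H x y : a <= x <= b -> a <= y <= b -> x < y -> `|phi x - phi y| <= M * `|x - y|.
  move=> x y hx hy; have [xy|yx|->] := ltgtP x y; [exact: H|by rewrite distrC (distrC x) H|].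
  by rewrite !subrr normr0 mulr0.
move=> hx hy xy.
have [| |c] := MVT xy (df := dphi) (f := phi).
- by move=> z; rewrite in_itv/= => hz; apply: dp; lra.
- apply/subspace_continuousP => z; rewrite /= in_itv/= => hz.
  apply: cvg_within_filter; apply: differentiable_continuous.
  by apply/derivable1_diffP; have [] : is_derive z 1 phi (dphi z) by apply: dp; lra.
rewrite in_itv/= => hc E; rewrite distrC E normrM (distrC x).
by rewrite ler_wpM2r// HM//; lra.
Qed.

Lemma grad_comp f (g : 'I_2 -> R * R -> R) (phi dphi : R -> R) : grad f g ->
  ucont (fun p => phi (f p)) -> ucont (fun p => dphi (f p)) ->
  (forall p, disk p -> is_derive (f p) 1 phi (dphi (f p))) ->
  grad (fun p => phi (f p)) (fun i p => dphi (f p) * g i p).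
Proof.
move=> [cf cg fg] cp cdp H; split=> // [i|i p dp]; first exact: ucontM.
apply: (proj2 (is_derive_line0 _ _ _ _)).
have h1 := proj1 (is_derive_line0 _ _ _ _) (fg i p dp); have h2 := H _ dp.
have E : (fun t : R => f (t *: dir i + p)) 0 = f p by rewrite scale0r add0r.
by rewrite -{1}E in h2; have := is_derive1_comp h2 h1.
Qed.

(** [Phi] lists the successive derivatives of the outer function. By the chain rule, order m.+1 for
    [Phi n] reduces to order m for [Phi n.+1], so the induction on m keeps n general. Lipschitz
    bounds on [a, b] come from the next derivative. *)
Lemma reg_comp P m f (Phi : nat -> R -> R) (a b : R) : base P ->
  (forall p, cdisk p -> a <= f p <= b) ->
  (forall n x, a <= x <= b -> is_derive x 1 (Phi n) (Phi n.+1 x)) ->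
  forall n, reg P m f -> reg P m (fun p => Phi n (f p)).
Proof.
move=> bP fab dPhi.
have base_comp Q k : base Q -> Q f -> Q (fun p => Phi k (f p)).
  move=> bQ Qf; have [M HM] := is_derive_bounded (dPhi k.+1).
  have L := is_derive_lip (dPhi k) HM.
  apply: (base_dom bQ (L := `|M|) Qf Qf) => p q dp dq.
  apply: le_trans (L _ _ (fab _ dp) (fab _ dq)) _.
  have := ler_norm M; have := normr_ge0 (f p - f q); have := normr_ge0 M; nra.
elim: m => [|m IH] n; first exact: base_comp.
move=> rf; have rf1 := regW bP rf; case: rf => g fg rg.
exists (fun i p => Phi n.+1 (f p) * g i p); last first.
  by move=> i; apply: regM => //; [exact: IH|exact: rg].
have [cf _ _] := fg; apply: grad_comp fg _ _ _; try exact: (base_comp _ _ base_ucontP).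
by move=> p dp; apply: dPhi; exact: fab (disk_cdisk dp).
Qed.

Lemma reg_powR P m f (s : R) : base P -> (forall p, cdisk p -> 0 < f p) ->
  reg P m f -> reg P m (fun p => f p `^ s).
Proof.
move=> bP f0 rf; have /ucont_within cf := reg_ucont bP rf.
have [a a0 ha] := cdisk_pos cf f0; have [b b0 hb] := cdisk_bounded cf.
(* The n-th derivative of the power: the falling factorial of [s] times the power with exponent
   [s - n]. *)
pose Phi n x := \prod_(j < n) (s - j%:R) * x `^ (s - n%:R).
apply: (reg_ext bP (f := fun p => Phi 0 (f p))).
  by move=> p _; rewrite /Phi big_ord0 mul1r subr0.
apply: (reg_comp (a := a) (b := b)) rf => // [p dp|n x /andP[ax xb]].
  by rewrite ha//= (le_trans (ler_norm _))// hb.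
have x0 : 0 < x by exact: lt_le_trans ax.
have := is_deriveZ (\prod_(j < n) (s - j%:R)) (is_derive1_powR (s - n%:R) x0).
congr is_derive.
by rewrite /Phi big_ord_recr /= /GRing.scale /= mulrA -addrA -opprD natr1.
Qed.

Lemma reg_sin_cos P m f : base P -> reg P m f ->
  reg P m (fun p => sin (f p)) /\ reg P m (fun p => cos (f p)).
Proof.
move=> bP rf; have /ucont_within cf := reg_ucont bP rf.
have [b b0 hb] := cdisk_bounded cf.
(* The derivatives of sine in order: sin, cos, - sin, - cos. Cosine is the entry n = 1. *)
pose Phi n x := (-1) ^+ n./2 * (if odd n then cos x else sin x) : R.
have H n : reg P m (fun p => Phi n (f p)).
  apply: (reg_comp (a := - b) (b := b)) rf => // [p dp|k x _].
    by rewrite -ler_norml hb.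
  rewrite /Phi /= uphalf_half; case: (odd k) => /=.
    have := is_deriveZ ((-1) ^+ k./2) (is_derive_cos x).
    by congr is_derive; rewrite /GRing.scale /= add1n exprS; ring.
  have := is_deriveZ ((-1) ^+ k./2) (is_derive_sin x).
  by congr is_derive.
split; [apply: reg_ext (H 0%N) => // p _|apply: reg_ext (H 1%N) => // p _];
  by rewrite /Phi /= expr0 mul1r.
Qed.

End Regularity.

(** * The partial derivatives [pd] and their symmetry *)

Section PartialDerivatives.
Context {R : realType}.
Implicit Types (p q : R * R) (f g : R * R -> R) (i j : 'I_2).

Lemma disk_scale p (s : R) : cdisk p -> 0 <= s < 1 -> disk (s *: p).
Proof.
case: p => [a b] + /andP[s0 s1]; rewrite /disk /cdisk /= /GRing.scale /= => dp.
rewrite !exprMn -mulrDr; apply: le_lt_trans (_ : s ^+ 2 < _).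
  by rewrite ler_piMr ?sqr_ge0.
by rewrite exprn_ilt1.
Qed.

Lemma near_disk p (d : R) : cdisk p -> 0 < d -> exists2 q, disk q & edist p q < d.
Proof.
move=> dp d0; pose e := Num.min (d / 2) 2^-1.
have e0 : 0 < e by rewrite lt_min; apply/andP; split; lra.
have ed : e <= d / 2 by rewrite ge_min lexx.
have e2 : e <= 2^-1 by rewrite ge_min lexx orbT.
exists ((1 - e) *: p).
  by apply: disk_scale => //; apply/andP; split; lra.
have -> : edist p ((1 - e) *: p) = e * edist p 0.
  have -> : edist p ((1 - e) *: p) = edist (e *: p) (e *: (0 : R * R)).
    rewrite /edist; congr (Num.sqrt (_ ^+ 2 + _ ^+ 2)); case: p {dp} => a b;
    rewrite /= /GRing.scale/=; ring.
  by rewrite edist_dil// ltW.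
by move: dp => /cdisk_edist0; nra.
Qed.

Lemma closure_disk p : cdisk p -> closure disk p.
Proof.
move=> dp A /nbhs_edist[d d0 H]; have [q dq pq] := near_disk dp d0.
by exists q; split => //; exact: H.
Qed.

Lemma ucont_eq_disk f g : ucont f -> ucont g -> (forall p, disk p -> f p = g p) ->
  forall p, cdisk p -> f p = g p.
Proof.
move=> cf cg fg p dp; apply/eqP; rewrite -subr_eq0 -normr_le0.
apply/ler_addgt0Pr => e e0; rewrite add0r.
have e1 : 0 < e / 2 by rewrite divr_gt0.
have [d1 d10 h1] := cf _ e1; have [d2 d20 h2] := cg _ e1.
have [q dq] := near_disk dp (d := Num.min d1 d2) ltac:(by rewrite lt_min d10).
rewrite lt_min => /andP[pq1 pq2].
have := h1 p q dp (disk_cdisk dq) pq1; have := h2 p q dp (disk_cdisk dq) pq2.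
have := ler_distD (f q) (f p) (g p); rewrite {2}(fg q dq) (distrC (g q)); lra.
Qed.

Lemma cvg_pd i f g p : ucont g -> (forall q, disk q -> 'D_(dir i) f q = g q) ->
  cdisk p -> 'D_(dir i) f q @[q --> within disk (nbhs p)] --> g p.
Proof.
move=> cg fg dp; apply/cvgrPdist_le => e e0; have [d d0 H] := cg e e0.
rewrite /prop_near1 /within /=; apply/nbhs_edist; exists d => // q pq dq.
by rewrite fg// H//; exact: disk_cdisk.
Qed.

Lemma pd_lim i f g p : ucont g -> (forall q, disk q -> 'D_(dir i) f q = g q) ->
  cdisk p -> pd i f p = g p.
Proof.
move=> cg fg dp; rewrite /pd; apply: cvg_lim; first exact: norm_hausdorff.
  exact: (within_nbhs_proper (closure_disk dp)).
exact: cvg_pd.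
Qed.

Lemma pdE i f (g : 'I_2 -> R * R -> R) p : grad f g -> cdisk p -> pd i f p = g i p.
Proof. by case=> cf cg fg; apply: pd_lim => // q dq; case: (fg i q dq). Qed.

Lemma reg_grad P m f : base P -> reg P m.+1 f -> grad f (fun i => pd i f).
Proof.
by move=> bP [g fg _]; apply: (grad_ext _ _ fg) => // i p dp; rewrite (pdE i fg).
Qed.

Lemma reg_pd P m f i : base P -> reg P m.+1 f -> reg P m (pd i f).
Proof.
by move=> bP [g fg rg]; apply: reg_ext (rg i) => // p dp; rewrite (pdE i fg).
Qed.

(** At a point of the open disk the filter restricted to the disk is the full neighbourhood filter,
    which sees the point itself. A limit of the derivative along it, known to exist, must then be
    the value of the derivative there; so [pd] is a genuine derivative inside. *)
Lemma Cdisk_reg m f : Cdisk m f <-> reg ucont m f.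
Proof.
split.
  elim: m f => [|m IH] f; first by case=> /ucont_within.
  move=> [/ucont_within cf H]; exists (fun i => pd i f); last by move=> i; apply: IH; case: (H i).
  split => // i.
    by apply/ucont_within; case: (H i) => _ _; case: m {IH H} => [|m] [].
  move=> p dp; have [Df Dc _] := H i; apply: DeriveDef; first exact: Df.
  symmetry; rewrite /pd; apply: cvg_lim; first exact: norm_hausdorff.
    exact: (within_nbhs_proper (closure_disk (disk_cdisk dp))).
  move: (Dc p (disk_cdisk dp)).
  have -> : within disk (nbhs p) = nbhs p.
    apply/seteqP; split => A; rewrite /within /=.
      by move=> h; apply: filterS2 h (disk_open dp) => q; apply.
    by apply: filterS.
  move=> /cvg_ex [l hl].
  suff <- : l = 'D_(dir i) f p by [].
  apply/eqP; rewrite -subr_eq0 -normr_le0; apply/ler_addgt0Pr => e e0.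
  by move/cvgrPdist_le : hl => /(_ e e0) /nbhs_singleton; rewrite add0r.
elim: m f => [|m IH] f; first by move=> cf; split => //; exact/ucont_within.
move=> rf; have [cf cg fg] := reg_grad base_ucontP rf; split; first exact/ucont_within.
move=> i; split.
- by move=> p /(fg i) [].
- move=> p dp; apply/cvg_ex; exists (pd i f p); apply: cvg_pd => // q /(fg i).
  by case.
- by apply: IH; exact: (reg_pd i base_ucontP rf).
Qed.

Lemma is_derive_diff (f g : R -> R) (x a b : R) :
  is_derive x 1 f a -> is_derive x 1 g b -> is_derive x 1 (fun t => f t - g t) (a - b).
Proof. by move=> da db; have := is_deriveB da db. Qed.

Lemma MVT_open (f df : R -> R) (h : R) : 0 < h ->
  (forall t, 0 <= t <= h -> is_derive t 1 f (df t)) ->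
  exists2 t, 0 <= t <= h & f h - f 0 = df t * h.
Proof.
move=> h0 H; have [| |t] := MVT h0 (df := df) (f := f).
- by move=> t; rewrite in_itv/= => th; apply: H; lra.
- apply/subspace_continuousP => t; rewrite /= in_itv/= => ht.
  apply: cvg_within_filter; apply: differentiable_continuous.
  by apply/derivable1_diffP; case: (H t ht).
by rewrite in_itv/= subr0 => th E; exists t => //; lra.
Qed.

Lemma second_difference i j f (g : R * R -> R) (k : R * R -> R) p (h : R) :
  pderiv i f g -> pderiv j g k -> 0 < h ->
  (forall s t : R, 0 <= s <= h -> 0 <= t <= h -> disk (s *: dir i + (t *: dir j + p))) ->
  exists s t : R, [/\ 0 <= s <= h, 0 <= t <= h &
    f (h *: dir i + (h *: dir j + p)) - f (h *: dir i + p) - f (h *: dir j + p) + f p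
    = h ^+ 2 * k (s *: dir i + (t *: dir j + p))].
Proof.
move=> fg gk h0 box.
have hh : 0 <= h <= h by rewrite lexx ltW.
have h00 : 0 <= (0 : R) <= h by rewrite lexx ltW.
have box0 s : 0 <= s <= h -> disk (s *: dir i + p).
  by move=> sh; have := box s 0 sh h00; rewrite scale0r add0r.
have [s sh E1] := MVT_open h0 (f := fun s => f (s *: dir i + (h *: dir j + p)) - f (s *: dir i + p))
  (df := fun s => g (s *: dir i + (h *: dir j + p)) - g (s *: dir i + p))
  (fun s sh => is_derive_diff (proj1 (is_derive_line _ _ _ _ _) (fg _ (box s h sh hh)))
     (proj1 (is_derive_line _ _ _ _ _) (fg _ (box0 s sh)))).
have box1 t : 0 <= t <= h -> disk (t *: dir j + (s *: dir i + p)).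
  by move=> th; rewrite addrCA; exact: box.
have [t th E2] := MVT_open h0 (f := fun t => g (t *: dir j + (s *: dir i + p)))
  (fun t th => proj1 (is_derive_line _ _ _ _ _) (gk _ (box1 t th))).
exists s, t; split => //.
move: E1 E2; rewrite !scale0r !add0r (addrCA (s *: dir i) (h *: dir j)) => E1.
rewrite (addrCA (t *: dir j)) => E2; rewrite expr2.
rewrite [RHS]mulrC mulrA -E2 -E1; ring.
Qed.

Lemma edist_line0 i p (t : R) : edist p (t *: dir i + p) = `|t|.
Proof. by have := edist_line 0 t i p; rewrite sub0r normrN scale0r add0r. Qed.

(** The second difference over a small square of side k is symmetric in the two directions. By the
    mean value theorem used twice it is k^2 times a value of either mixed derivative in the square,
    and these are continuous. Density of the open disk extends the equality to the circle. *)
Lemma clairaut f (g : 'I_2 -> R * R -> R) (h : 'I_2 -> 'I_2 -> R * R -> R) :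
  grad f g -> (forall i, grad (g i) (h i)) ->
  forall i j p, cdisk p -> h i j p = h j i p.
Proof.
move=> [_ _ fg] gh i j; apply: ucont_eq_disk; [by case: (gh i)|by case: (gh j)|].
move=> p dp; apply/eqP; rewrite -subr_eq0 -normr_le0; apply/ler_addgt0Pr => e e0.
rewrite add0r; have e1 : 0 < e / 2 by rewrite divr_gt0.
have [d1 d10 h1] : exists2 d : R, 0 < d & forall p q, cdisk p -> cdisk q ->
  edist p q < d -> `|h i j p - h i j q| <= e / 2 by case: (gh i) => _ /(_ j)/(_ _ e1).
have [d2 d20 h2] : exists2 d : R, 0 < d & forall p q, cdisk p -> cdisk q ->
  edist p q < d -> `|h j i p - h j i q| <= e / 2 by case: (gh j) => _ /(_ i)/(_ _ e1).
have /nbhs_edist[d3 d30 h3] := disk_open dp.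
(* Points of the square are at distance less than 4 k from p, so both moduli of continuity apply and
   the square stays in the disk. *)
pose k := Num.min d1 (Num.min d2 d3) / 4.
have k0 : 0 < k by rewrite divr_gt0// !lt_min d10 d20.
have kd1 : 4 * k <= d1 by rewrite mulrC divfK// ge_min lexx.
have kd2 : 4 * k <= d2 by rewrite mulrC divfK// !ge_min lexx orbT.
have kd3 : 4 * k <= d3 by rewrite mulrC divfK// !ge_min lexx !orbT.
have near (i' j' : 'I_2) (s t : R) : 0 <= s <= k -> 0 <= t <= k ->
    edist p (s *: dir i' + (t *: dir j' + p)) < 4 * k.
  move=> sk tk; apply: le_lt_trans (edist_triangle _ (t *: dir j' + p) _) _.
  by rewrite !edist_line0 !ger0_norm; lra.
have box i' j' (s t : R) : 0 <= s <= k -> 0 <= t <= k ->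
    disk (s *: dir i' + (t *: dir j' + p)).
  by move=> sk tk; apply: h3; apply: lt_le_trans (near i' j' s t sk tk) kd3.
have [_ _ ghi] := gh i; have [_ _ ghj] := gh j.
have [s [t [sk tk E1]]] := second_difference (fg i) (ghi j) k0 (box i j).
have [s' [t' [sk' tk' E2]]] := second_difference (fg j) (ghj i) k0 (box j i).
have E : h i j (s *: dir i + (t *: dir j + p)) = h j i (s' *: dir j + (t' *: dir i + p)).
  apply: (@mulfI _ (k ^+ 2)); first by rewrite expf_eq0/= gt_eqF.
  by rewrite -E1 -E2 (addrCA (k *: dir i)); ring.
have := h1 _ _ (disk_cdisk dp) (disk_cdisk (box i j s t sk tk)) (lt_le_trans (near i j s t sk tk) kd1).
have := h2 _ _ (disk_cdisk dp) (disk_cdisk (box j i s' t' sk' tk')) (lt_le_trans (near j i s' t' sk' tk') kd2).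
rewrite E; set z := h j i (_ + _); have := ler_distD z (h i j p) (h j i p).
by rewrite (distrC z); lra.
Qed.

Lemma pdC P m f p : base P -> reg P m.+2 f -> cdisk p -> pd 0 (pd 1 f) p = pd 1 (pd 0 f) p.
Proof.
move=> bP rf dp; have fg := reg_grad bP rf.
by apply: (clairaut fg (h := fun i j => pd j (pd i f)) _ 1 0 dp) => i; apply: (reg_grad bP (m := m)); exact: (reg_pd i bP rf).
Qed.

End PartialDerivatives.

(** * Hoelder norms in the extended reals and the corresponding real bounds *)

Section HolderNorms.
Context {R : realType}.
Implicit Types (p q : R * R) (f g : R * R -> R) (i j : 'I_2) (alpha M : R).

Lemma sup_norm_leP f M : (sup_norm f <= M%:E)%E <-> forall p, cdisk p -> `|f p| <= M.
Proof.
split=> [H p dp|H].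
  rewrite -lee_fin; apply: le_trans H; apply: ereal_sup_ubound.
  by exists p.
by apply: ge_ereal_sup => _ [p dp <-]; rewrite lee_fin H.
Qed.

Lemma sup_norm_ge0 f : (0 <= sup_norm f)%E.
Proof.
apply: (@le_trans _ _ (`|f 0|%:E)%E); first by rewrite lee_fin.
by apply: ereal_sup_ubound; exists 0 => //; exact: cdisk0.
Qed.

Lemma seminorm_leP alpha f M : 0 < alpha -> (holder_seminorm alpha f <= M%:E)%E <->
  forall p q, cdisk p -> cdisk q -> `|f p - f q| <= M * edist p q `^ alpha.
Proof.
move=> a0; split=> [H p q dp dq|H].
  have [->|/eqP pq] := eqVneq p q.
    by rewrite subrr normr0 /edist !subrr expr0n addr0 sqrtr0 powR0 ?mulr0// gt_eqF.
  rewrite -ler_pdivrMr ?powR_gt0 ?edist_gt0// -lee_fin; apply: le_trans H.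
  by apply: ereal_sup_ubound; exists p, q.
apply: ge_ereal_sup => _ [p [q [dp dq pq ->]]].
by rewrite lee_fin ler_pdivrMr ?powR_gt0 ?edist_gt0// H.
Qed.

(** A supremum over the empty set would be -oo; the pair (1, 0), 0 shows that the set of quotients
    is inhabited. *)
Lemma seminorm_ge0 alpha f : (0 <= holder_seminorm alpha f)%E.
Proof.
apply: (@le_trans _ _ ((`|f (1, 0) - f 0| / edist (1, 0) 0 `^ alpha)%:E)%E).
  by rewrite lee_fin divr_ge0 ?powR_ge0.
apply: ereal_sup_ubound; exists (1, 0), 0; split => //.
- by rewrite /cdisk /= expr1n expr0n addr0.
- exact: cdisk0.
- by case=> /eqP; rewrite oner_eq0.
Qed.

Lemma sup_norm_le_holder m alpha f a b : (a + b <= m)%N ->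
  (sup_norm (pdn a b f) <= holder_norm m alpha f)%E.
Proof.
move=> abm; rewrite /holder_norm.
apply: (@le_trans _ _ (\sum_(s < m.+1) \sum_(a < s.+1) sup_norm (pdn a (s - a) f))%E);
  last by rewrite leeDl// sume_ge0// => *; exact: seminorm_ge0.
have hs : (a + b < m.+1)%N by rewrite ltnS.
rewrite (bigD1 (Ordinal hs))//=.
have ha : (a < (a + b).+1)%N by rewrite ltnS leq_addr.
rewrite (bigD1 (Ordinal ha))//= addKn -addeA leeDl//.
apply: adde_ge0; first by apply: sume_ge0 => *; exact: sup_norm_ge0.
by apply: sume_ge0 => *; apply: sume_ge0 => *; exact: sup_norm_ge0.
Qed.

Lemma seminorm_le_holder m alpha f a b : (a + b = m)%N ->
  (holder_seminorm alpha (pdn a b f) <= holder_norm m alpha f)%E.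
Proof.
move=> abm; rewrite /holder_norm.
apply: (@le_trans _ _ (\sum_(a < m.+1) holder_seminorm alpha (pdn a (m - a) f))%E);
  last by rewrite leeDr// sume_ge0// => *; apply: sume_ge0 => *; exact: sup_norm_ge0.
have ha : (a < m.+1)%N by rewrite -abm ltnS leq_addr.
rewrite (bigD1 (Ordinal ha))//=; have -> : (m - a = b)%N by rewrite -abm addKn.
rewrite leeDl//.
by apply: sume_ge0 => *; exact: seminorm_ge0.
Qed.

Lemma holder_norm_ge0 m alpha f : (0 <= holder_norm m alpha f)%E.
Proof.
apply: adde_ge0; apply: sume_ge0 => *; last exact: seminorm_ge0.
by apply: sume_ge0 => *; exact: sup_norm_ge0.
Qed.

Lemma holder_norm0 alpha f :
  (holder_norm 0 alpha f = sup_norm f + holder_seminorm alpha f)%E.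
Proof. by rewrite /holder_norm !big_ord1. Qed.

Lemma reg_mono (P Q : (R * R -> R) -> Prop) m f :
  (forall h, P h -> Q h) -> reg P m f -> reg Q m f.
Proof.
move=> PQ; elim: m f => [|m IH] f; first exact: PQ.
by move=> [g fg rg]; exists g => // i; exact: IH (rg i).
Qed.

Lemma reg_pd0n P m a f : base P -> reg P (a + m) f -> reg P m (iter a (pd 0) f).
Proof.
move=> bP; elim: a m => [//|a IH] m rf; rewrite iterS.
by apply: (reg_pd 0 bP); apply: IH; rewrite addnS.
Qed.

Lemma reg_pd1n P m b f : base P -> reg P (b + m) f -> reg P m (iter b (pd 1) f).
Proof.
move=> bP; elim: b m => [//|b IH] m rf; rewrite iterS.
by apply: (reg_pd 1 bP); apply: IH; rewrite addnS.
Qed.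

Lemma reg_pdn P m a b f : base P -> reg P (a + b + m) f -> reg P m (pdn a b f).
Proof.
by move=> bP rf; apply: reg_pd0n => //; apply: reg_pd1n => //; rewrite addnCA addnA.
Qed.

Lemma pd_ext i f f' : reg ucont 1 f -> (forall p, cdisk p -> f p = f' p) ->
  forall p, cdisk p -> pd i f p = pd i f' p.
Proof.
move=> [g fg _] ff' p dp; rewrite (pdE i fg dp).
have fg' : grad f' g by apply: grad_ext fg.
by rewrite (pdE i fg' dp).
Qed.

Lemma pd0n_ext a f f' : reg ucont a f -> (forall p, cdisk p -> f p = f' p) ->
  forall p, cdisk p -> iter a (pd 0) f p = iter a (pd 0) f' p.
Proof.
elim: a => [|a IH] rf ff' p dp; first exact: ff'.
rewrite !iterS; apply: pd_ext dp.
  by apply: (reg_pd0n base_ucontP); rewrite addn1.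
by apply: IH => //; exact: (regW base_ucontP rf).
Qed.

Lemma pd1n_pd0 b f p : reg ucont b.+1 f -> cdisk p ->
  iter b (pd 1) (pd 0 f) p = pd 0 (iter b (pd 1) f) p.
Proof.
elim: b p => [//|b IH] p rf dp; rewrite !iterS.
transitivity (pd 1 (pd 0 (iter b (pd 1) f)) p); last first.
  symmetry; apply: (@pdC _ ucont 0 _ _ base_ucontP _ dp).
  by apply: (reg_pd1n base_ucontP); rewrite addn2.
apply: pd_ext dp; last by move=> q; apply: IH; exact: (regW base_ucontP rf).
apply: (reg_pd1n base_ucontP); rewrite addn1.
exact: (reg_pd 0 base_ucontP rf).
Qed.

Lemma reg_ucontW P m f : base P -> reg P m f -> reg ucont m f.
Proof. by move=> bP; apply: reg_mono => h; exact: base_ucont. Qed.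

(** The norm only sees derivatives in the normal form [pdn], with all the v-derivatives taken before
    the u-derivatives, whereas [reg] ranges over all orders of differentiation. Symmetry of the
    mixed derivatives brings each of them to normal form. *)
Lemma reg_hol_pdn alpha m f : 0 < alpha < 1 -> reg ucont m f ->
  (forall a b, (a + b = m)%N -> hol alpha (pdn a b f)) -> reg (hol alpha) m f.
Proof.
move=> a01; have bh := base_hol a01; elim: m f => [|m IH] f rf H; first exact: (H 0 0)%N.
exists (fun i => pd i f); first exact: reg_grad base_ucontP rf.
case=> [[|[|//]] hi].
  have -> : Ordinal hi = 0 by exact/val_inj.
  apply: IH; first exact: (reg_pd 0 base_ucontP rf).
  move=> a b abm; apply: (base_ext bh) (H a.+1 b _); last by rewrite addSn abm.
  move=> p dp; rewrite /pdn iterSr; symmetry; apply: pd0n_ext dp.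
    apply: (reg_pd1n base_ucontP); rewrite addnC abm; exact: (reg_pd 0 base_ucontP rf).
  move=> q dq; apply: pd1n_pd0 => //; apply: reg_le rf => //.
    exact: base_ucontP.
  by rewrite ltnS -abm leq_addl.
have -> : Ordinal hi = 1 by exact/val_inj.
apply: IH; first exact: (reg_pd 1 base_ucontP rf).
by move=> a b abm; rewrite /pdn -iterSr; apply: (H a b.+1); rewrite addnS abm.
Qed.

Lemma holP alpha f : 0 < alpha < 1 ->
  hol alpha f <-> (holder_norm 0 alpha f < +oo)%E.
Proof.
move=> a01; have /andP[a0 a1] := a01; rewrite holder_norm0; split=> [hf|].
  have /ucont_within cf := base_ucont (base_hol a01) hf.
  have [N N0 HN] := cdisk_bounded cf; case: hf => M HM.
  apply: (@le_lt_trans _ _ (N%:E + M%:E)%E); last by rewrite -EFinD ltry.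
  by apply: leeD; [exact/sup_norm_leP|exact/seminorm_leP].
move=> H; have : (holder_seminorm alpha f < +oo)%E.
  by apply: le_lt_trans H; rewrite leeDr// sup_norm_ge0.
have := seminorm_ge0 alpha f; case E : (holder_seminorm alpha f) => [M| |]// _ _.
by exists M; apply/seminorm_leP => //; rewrite E.
Qed.

Lemma hol_seminorm alpha f : 0 < alpha < 1 ->
  hol alpha f <-> (holder_seminorm alpha f < +oo)%E.
Proof.
move=> a01; have /andP[a0 a1] := a01; split=> [[M HM]|].
  by apply: (@le_lt_trans _ _ M%:E); rewrite ?ltry//; exact/seminorm_leP.
have := seminorm_ge0 alpha f; case E : (holder_seminorm alpha f) => [M| |]// _ _.
by exists M; apply/seminorm_leP => //; rewrite E.
Qed.

Lemma holderP m alpha f : 0 < alpha < 1 -> holder m alpha f <-> reg (hol alpha) m f.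
Proof.
move=> a01; have bh := base_hol a01; split.
  move=> [/Cdisk_reg cf nf]; apply: reg_hol_pdn => // a b abm.
  apply/hol_seminorm => //; apply: le_lt_trans nf; exact: seminorm_le_holder.
move=> rf; split; first exact/Cdisk_reg/(reg_ucontW bh).
rewrite /holder_norm; apply: lte_add_pinfty.
  apply: lte_sum_pinfty => s _; apply: lte_sum_pinfty => a _.
  have rg : reg (hol alpha) 0 (pdn a (s - a) f).
    apply: reg_pdn => //; apply: reg_le rf => //.
    by rewrite addn0 subnKC -ltnS.
  have /ucont_within cf := base_ucont bh rg.
  have [N N0 HN] := cdisk_bounded cf.
  by apply: (@le_lt_trans _ _ N%:E); rewrite ?ltry//; exact/sup_norm_leP.
apply: lte_sum_pinfty => a _; apply/hol_seminorm => //.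
by apply: (reg_pdn (m := 0) bh); rewrite addn0 subnKC// -ltnS.
Qed.

End HolderNorms.

(** * Differential operators *)

Section PdCalculus.
Context {R : realType}.
Implicit Types (p q : R * R) (f g : R * R -> R) (i : 'I_2) (m n j : nat).

(* [pd] unfolds to a limit, which makes failed unifications extremely slow;
   this sealed copy does not unfold. *)
Fact dd_key : {D : 'I_2 -> (R * R -> R) -> R * R -> R | D = pd}.
Proof. by exists pd. Qed.

Definition dd := sval dd_key.

Lemma ddE : dd = pd. Proof. exact: svalP dd_key. Qed.

Local Notation C := (reg ucont).

Lemma dd_grad i f (g : 'I_2 -> R * R -> R) p : grad f g -> cdisk p -> dd i f p = g i p.
Proof. by rewrite ddE; exact: pdE. Qed.

Lemma reg_dd P m i f : base P -> reg P m.+1 f -> reg P m (dd i f).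
Proof. by rewrite ddE; exact: reg_pd. Qed.

Lemma ddC P m f p : base P -> reg P m.+2 f -> cdisk p -> dd 0 (dd 1 f) p = dd 1 (dd 0 f) p.
Proof. by rewrite ddE; exact: pdC. Qed.

Lemma dd_ext i f f' p : C 1 f -> (forall p, cdisk p -> f p = f' p) ->
  cdisk p -> dd i f p = dd i f' p.
Proof. by rewrite ddE => cf ff'; exact: pd_ext. Qed.

Lemma C_grad f : C 1 f -> grad f (fun i => dd i f).
Proof. by rewrite ddE; exact: reg_grad base_ucontP. Qed.

Lemma C_le m n f : (n <= m)%N -> C m f -> C n f.
Proof. exact: (reg_le base_ucontP). Qed.

Lemma C_dd m i f : C m.+1 f -> C m (dd i f).
Proof. exact: (reg_dd i base_ucontP). Qed.

Lemma ddD i f g p : C 1 f -> C 1 g -> cdisk p ->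
  dd i (fun p => f p + g p) p = dd i f p + dd i g p.
Proof. by move=> /C_grad cf /C_grad cg; move=> dp; exact: (dd_grad i (gradD cf cg) dp). Qed.

Lemma ddM i f g p : C 1 f -> C 1 g -> cdisk p ->
  dd i (fun p => f p * g p) p = f p * dd i g p + g p * dd i f p.
Proof. by move=> /C_grad cf /C_grad cg; move=> dp; exact: (dd_grad i (gradM cf cg) dp). Qed.

Lemma dd_cst i (c : R) p : cdisk p -> dd i (fun=> c) p = 0.
Proof. exact: (dd_grad i (grad_cst c)). Qed.

Lemma ddZ i (c : R) f p : C 1 f -> cdisk p -> dd i (fun p => c * f p) p = c * dd i f p.
Proof.
move=> cf dp; rewrite ddM//; last exact: (reg_cst base_ucontP).
by rewrite dd_cst// mulr0 addr0.
Qed.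

Lemma ddN i f p : C 1 f -> cdisk p -> dd i (fun p => - f p) p = - dd i f p.
Proof.
move=> cf dp; rewrite -mulN1r -(ddZ i (-1) cf dp); apply: dd_ext dp.
  exact: (regN base_ucontP).
by move=> q _; rewrite mulN1r.
Qed.

Lemma ddB i f g p : C 1 f -> C 1 g -> cdisk p ->
  dd i (fun p => f p - g p) p = dd i f p - dd i g p.
Proof. by move=> cf cg dp; rewrite ddD ?ddN//; exact: (regN base_ucontP). Qed.

Lemma dd_u i p : cdisk p -> dd i (fun p => p.1) p = (i == 0)%:R.
Proof. exact: (dd_grad i grad_u). Qed.

Lemma dd_v i p : cdisk p -> dd i (fun p => p.2) p = (i == 1)%:R.
Proof. exact: (dd_grad i grad_v). Qed.

Lemma C_u m : C m (fun p => p.1). Proof. exact: reg_u base_ucontP. Qed.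
Lemma C_v m : C m (fun p => p.2). Proof. exact: reg_v base_ucontP. Qed.

(* In polar coordinates, d/dtheta and r d/dr. *)
Definition angular f p := p.1 * dd 1 f p - p.2 * dd 0 f p.
Definition euler f p := p.1 * dd 0 f p + p.2 * dd 1 f p.

Definition lap f p := dd 0 (dd 0 f) p + dd 1 (dd 1 f) p.

Lemma lapE f p : lap f p = dd 0 (dd 0 f) p + dd 1 (dd 1 f) p.
Proof. by []. Qed.

Lemma laplacianE : @laplacian R = lap.
Proof. by rewrite /lap ddE. Qed.

Lemma reg_lap P m f : base P -> reg P m.+2 f -> reg P m (lap f).
Proof.
by move=> bP rf; apply: regD => //; [have := reg_dd 0 bP (reg_dd 0 bP rf)|have := reg_dd 1 bP (reg_dd 1 bP rf)].
Qed.

Lemma reg_angular P m f : base P -> reg P m.+1 f -> reg P m (angular f).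
Proof.
move=> bP rf; apply: regB => //; apply: regM => //; [exact: reg_u|exact: (reg_dd 1 bP rf)|exact: reg_v|exact: (reg_dd 0 bP rf)].
Qed.

Lemma dd_ext2 i (j : 'I_2) f f' p : C 2 f -> (forall p, cdisk p -> f p = f' p) ->
  cdisk p -> dd i (dd j f) p = dd i (dd j f') p.
Proof.
move=> cf ff'; apply: dd_ext; first exact: C_dd.
by move=> q dq; apply: (dd_ext _ _ ff' dq); exact: C_le cf.
Qed.

Lemma lap_ext f f' p : C 2 f -> (forall p, cdisk p -> f p = f' p) ->
  cdisk p -> lap f p = lap f' p.
Proof. by move=> cf ff' dp; rewrite !lapE (dd_ext2 0 0 cf ff' dp) (dd_ext2 1 1 cf ff' dp). Qed.

Lemma lapD f g p : C 2 f -> C 2 g -> cdisk p ->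
  lap (fun p => f p + g p) p = lap f p + lap g p.
Proof.
move=> cf cg dp; have c1f := C_le (leqnSn 1) cf; have c1g := C_le (leqnSn 1) cg.
have H i : dd i (dd i (fun p => f p + g p)) p = dd i (dd i f) p + dd i (dd i g) p.
  rewrite -ddD//; [|exact: C_dd|exact: C_dd].
  apply: dd_ext dp; first by apply: C_dd; exact: (regD base_ucontP).
  by move=> q dq; rewrite ddD.
by rewrite !lapE !H addrACA.
Qed.

Lemma lapZ (c : R) f p : C 2 f -> cdisk p ->
  lap (fun p => c * f p) p = c * lap f p.
Proof.
move=> cf dp; have c1f := C_le (leqnSn 1) cf.
have H i : dd i (dd i (fun p => c * f p)) p = c * dd i (dd i f) p.
  rewrite -ddZ//; last exact: C_dd.
  apply: dd_ext dp; first by apply: C_dd; exact: (regZ base_ucontP).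
  by move=> q dq; rewrite ddZ.
by rewrite !lapE !H mulrDr.
Qed.

Lemma lapB f g p : C 2 f -> C 2 g -> cdisk p ->
  lap (fun p => f p - g p) p = lap f p - lap g p.
Proof.
move=> cf cg dp.
have -> : lap f p - lap g p = lap f p + lap (fun p => -1 * g p) p.
  by rewrite lapZ// mulN1r.
rewrite -lapD//; last exact: (regZ base_ucontP).
apply: lap_ext dp; first exact: (regB base_ucontP).
by move=> q _; rewrite mulN1r.
Qed.

Lemma lapM f g p : C 2 f -> C 2 g -> cdisk p ->
  lap (fun p => f p * g p) p =
  f p * lap g p + g p * lap f p + 2 * (dd 0 f p * dd 0 g p + dd 1 f p * dd 1 g p).
Proof.
move=> cf cg dp; have c1f := C_le (leqnSn 1) cf; have c1g := C_le (leqnSn 1) cg.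
have H i : dd i (dd i (fun p => f p * g p)) p =
    f p * dd i (dd i g) p + dd i g p * dd i f p + (g p * dd i (dd i f) p + dd i f p * dd i g p).
  rewrite -!ddM//; [|exact: C_dd|exact: C_dd].
  rewrite -ddD//; [|apply: (regM base_ucontP) => //; exact: C_dd..].
  apply: dd_ext dp; first by apply: C_dd; exact: (regM base_ucontP).
  by move=> q dq; rewrite ddM.
rewrite !lapE !H; ring.
Qed.

Lemma angularM f g p : C 1 f -> C 1 g -> cdisk p ->
  angular (fun p => f p * g p) p = f p * angular g p + g p * angular f p.
Proof. move=> cf cg dp; rewrite /angular !ddM//; ring. Qed.

Lemma angularD f g p : C 1 f -> C 1 g -> cdisk p ->
  angular (fun p => f p + g p) p = angular f p + angular g p.
Proof. move=> cf cg dp; rewrite /angular !ddD//; ring. Qed.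

Lemma angularZ (c : R) f p : C 1 f -> cdisk p ->
  angular (fun p => c * f p) p = c * angular f p.
Proof. move=> cf dp; rewrite /angular !ddZ//; ring. Qed.

Lemma angular_ext f f' p : C 1 f -> (forall p, cdisk p -> f p = f' p) ->
  cdisk p -> angular f p = angular f' p.
Proof. by move=> cf ff' dp; rewrite /angular !(dd_ext _ cf ff' dp). Qed.

Definition rho2 p := p.1 ^+ 2 + p.2 ^+ 2.

Lemma dd_rho2 i p : cdisk p -> dd i rho2 p = 2 * (if i == 0 then p.1 else p.2).
Proof.
move=> dp; transitivity (dd i (fun p => p.1 * p.1 + p.2 * p.2) p).
  apply: dd_ext dp => [|q _]; last by rewrite /rho2 !expr2.
  apply: (regD base_ucontP); apply: (regM base_ucontP) => //; by [exact: C_u|exact: C_v].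
have cu := C_u 1; have cv := C_v 1.
rewrite ddD//; [|exact: (regM base_ucontP)..].
rewrite !ddM// dd_u// dd_v//.
by case: i => [[|[|//]] ?] /=; ring.
Qed.

Lemma reg_rho2 P m : base P -> reg P m rho2.
Proof.
by move=> bP; apply: regD => //; apply: regM => //; by [exact: reg_u|exact: reg_v].
Qed.

Lemma lap_rho2 p : cdisk p -> lap rho2 p = 4.
Proof.
move=> dp; rewrite lapE.
rewrite (dd_ext _ (f := dd 0 rho2) (f' := fun p => 2 * p.1))//; last 2 first.
  by apply: C_dd; exact: (reg_rho2 _ base_ucontP).
  by move=> q dq; rewrite dd_rho2.
rewrite (dd_ext _ (f := dd 1 rho2) (f' := fun p => 2 * p.2))//; last 2 first.
  by apply: C_dd; exact: (reg_rho2 _ base_ucontP).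
  by move=> q dq; rewrite dd_rho2.
have cu := C_u 1; have cv := C_v 1.
rewrite !ddZ// dd_u// dd_v// /=; ring.
Qed.

Definition sg (s : bool) : R := if s then 1 else -1.

(* [zpow s n] is the real (s = false) or imaginary (s = true) part of (u + iv)^n. *)
Fixpoint zpow (s : bool) n p : R :=
  if n is n'.+1 then p.1 * zpow s n' p + sg s * (p.2 * zpow (~~ s) n' p)
  else (~~ s)%:R.

Lemma reg_zpow P m s n : base P -> reg P m (zpow s n).
Proof.
move=> bP; elim: n s => [|n IH] s /=; first exact: reg_cst.
apply: regD => //; first by apply: regM => //; exact: reg_u.
by apply: regZ => //; apply: regM => //; exact: reg_v.
Qed.

Lemma C_zpow m s n : C m (zpow s n). Proof. exact: reg_zpow base_ucontP. Qed.

(** The real and imaginary parts of |z|^2 z^n = conj(z) z^(n+1). *)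
Lemma rho2_zpow s n p : rho2 p * zpow s n p =
  p.1 * zpow s n.+1 p - sg s * (p.2 * zpow (~~ s) n.+1 p).
Proof.
rewrite /= /rho2 negbK.
by case: s => /=; ring.
Qed.

(** The derivatives of z^n in u and v are n z^(n-1) and i n z^(n-1). Multiplication by i exchanges
    the parts, with the sign [sg s]. *)
Lemma dd_zpow s n p : cdisk p ->
  dd 0 (zpow s n) p = n%:R * zpow s n.-1 p /\
  dd 1 (zpow s n) p = n%:R * (sg s * zpow (~~ s) n.-1 p).
Proof.
elim: n s p => [|n IH] s p dp /=.
  have H i : dd i (zpow s 0) p = 0 by exact: dd_cst.
  by rewrite !H !mul0r.
have cu := C_u 1; have cv := C_v 1; have cz t := C_zpow 1 t n.
have H i : dd i (zpow s n.+1) p = p.1 * dd i (zpow s n) p + zpow s n p * (i == 0)%:R +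
   sg s * (p.2 * dd i (zpow (~~ s) n) p + zpow (~~ s) n p * (i == 1)%:R).
  rewrite /= ddD//; last 2 first.
  - exact: (regM base_ucontP).
  - by apply: (regZ base_ucontP); exact: (regM base_ucontP).
  rewrite ddM// ddZ//; last exact: (regM base_ucontP).
  by rewrite ddM// dd_u// dd_v.
have [IH0 IH1] := IH s p dp; have [IH0' IH1'] := IH (~~ s) p dp.
rewrite !H IH0 IH1 IH0' IH1' negbK /= mulr1 mulr0 -[n.+1%:R]natr1.
case: n {IH H cz IH0 IH1 IH0' IH1'} => [|n]; first by case: s => /=; split; ring.
by case: s => /=; split; ring.
Qed.

Lemma euler_zpow s n p : cdisk p -> euler (zpow s n) p = n%:R * zpow s n p.
Proof.
move=> dp; rewrite /euler; have [-> ->] := dd_zpow s n dp.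
by case: n => [|n] /=; ring.
Qed.

Lemma angular_zpow s n p : cdisk p ->
  angular (zpow s n) p = sg s * n%:R * zpow (~~ s) n p.
Proof.
move=> dp; rewrite /angular; have [-> ->] := dd_zpow s n dp.
case: n => [|n] /=; first by ring.
by rewrite negbK; case: s => /=; ring.
Qed.

Lemma lap_zpow s n p : cdisk p -> lap (zpow s n) p = 0.
Proof.
move=> dp; rewrite lapE.
have c1 i : C 1 (dd i (zpow s n)) by apply: C_dd; exact: C_zpow.
have cz t k := C_zpow 1 t k.
rewrite (dd_ext 0 (f := dd 0 (zpow s n)) (f' := fun p => n%:R * zpow s n.-1 p) (c1 0) _ dp); last first.
  by move=> q dq; case: (dd_zpow s n dq).
rewrite (dd_ext 1 (f := dd 1 (zpow s n)) (f' := fun p => (n%:R * sg s) * zpow (~~ s) n.-1 p) (c1 1) _ dp); last first.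
  by move=> q dq; case: (dd_zpow s n dq) => _ ->; rewrite mulrA.
rewrite !ddZ//; have [-> _] := dd_zpow s n.-1 dp; have [_ ->] := dd_zpow (~~ s) n.-1 dp.
by rewrite negbK /sg; case: (s) => /=; ring.
Qed.

Definition monom (s : bool) (j n : nat) p : R := rho2 p ^+ j * zpow s n p.

Lemma reg_monom P m s j n : base P -> reg P m (monom s j n).
Proof.
move=> bP; apply: regM => //; last exact: reg_zpow.
elim: j => [|j IH]; first by apply: (reg_ext bP (f := fun=> 1)); [move=> p _; rewrite expr0|exact: reg_cst].
apply: (reg_ext bP (f := fun p => rho2 p * rho2 p ^+ j)); first by move=> p _; rewrite exprS.
by apply: regM => //; exact: reg_rho2.
Qed.

Lemma C_monom m s j n : C m (monom s j n). Proof. exact: reg_monom base_ucontP. Qed.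

Lemma monomS s j n p : monom s j.+1 n p = rho2 p * monom s j n p.
Proof. by rewrite /monom exprS mulrA. Qed.

Lemma monom0 s n p : monom s 0 n p = zpow s n p.
Proof. by rewrite /monom expr0 mul1r. Qed.

Lemma C_rho2 m : C m rho2. Proof. exact: reg_rho2 base_ucontP. Qed.

Lemma euler_monom s j n p : cdisk p -> euler (monom s j n) p = (2 * j + n)%:R * monom s j n p.
Proof.
elim: j p => [|j IH] p dp.
  rewrite monom0 muln0 add0n -euler_zpow// /euler.
  by congr (_ * _ + _ * _); apply: dd_ext dp => [|q _]; [exact: C_monom|exact: monom0|exact: C_monom|exact: monom0].
have E i : dd i (monom s j.+1 n) p = rho2 p * dd i (monom s j n) p + monom s j n p * dd i rho2 p.
  rewrite -ddM//; [|exact: C_rho2|exact: C_monom].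
  by apply: dd_ext dp => [|q _]; [exact: C_monom|exact: monomS].
move: (IH p dp); rewrite /euler !E !dd_rho2//= monomS => IH'.
transitivity (rho2 p * (p.1 * dd 0 (monom s j n) p + p.2 * dd 1 (monom s j n) p) + monom s j n p * (2 * rho2 p)).
  by rewrite /rho2; ring.
rewrite IH' !natrD !natrM -[j.+1%:R]natr1; ring.
Qed.

(** Multiplying a homogeneous f of degree d by r^2 gives Lap (r^2 f) = r^2 Lap f + 4 f + 4 d f, by
    Euler's identity for the cross term. Starting from the harmonic z^n, with d = 2 k + n at stage
    k, the terms 4 (2 k + n + 1) for k <= j sum to the stated coefficient. *)
Lemma lap_monom s j n p : cdisk p ->
  lap (monom s j.+1 n) p = 4 * (j.+1 * (j.+1 + n))%:R * monom s j n p.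
Proof.
move=> dp.
have E k : lap (monom s k.+1 n) p = rho2 p * lap (monom s k n) p + monom s k n p * 4 + 4 * ((2 * k + n)%:R * monom s k n p).
  rewrite (lap_ext (f := monom s k.+1 n) (f' := fun p => rho2 p * monom s k n p))//; last 2 first.
  - exact: C_monom.
  - by move=> q _; rewrite monomS.
  rewrite lapM//; [|exact: C_rho2|exact: C_monom].
  rewrite lap_rho2// !dd_rho2//= -euler_monom// /euler; ring.
elim: j => [|j IH].
  rewrite E; rewrite (lap_ext (f := monom s 0 n) (f' := zpow s n))//; last 2 first.
  - exact: C_monom.
  - by move=> q _; rewrite monom0.
  by rewrite lap_zpow// mulr0 add0r muln0 add0n mul1n natrD; ring.
by rewrite E IH monomS !(natrM, natrD) -[j.+2%:R]natr1 -[j.+1%:R]natr1; ring.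
Qed.

Lemma angular_rho2 p : cdisk p -> angular rho2 p = 0.
Proof. by move=> dp; rewrite /angular !dd_rho2//=; ring. Qed.

Lemma angular_monom s j n p : cdisk p ->
  angular (monom s j n) p = sg s * n%:R * monom (~~ s) j n p.
Proof.
elim: j p => [|j IH] p dp.
  rewrite monom0 -angular_zpow//; apply: angular_ext dp => [|q _]; first exact: C_monom.
  exact: monom0.
rewrite (angular_ext (f := monom s j.+1 n) (f' := fun p => rho2 p * monom s j n p))//; last 2 first.
  - exact: C_monom.
  - by move=> q _; rewrite monomS.
rewrite angularM//; [|exact: C_rho2|exact: C_monom].
by rewrite angular_rho2// IH// monomS; ring.
Qed.

(* The span of the rho^2j Re (u+iv)^n and rho^2j Im (u+iv)^n: it contains the
   polynomials, and the Dirichlet problem is explicitly solvable in it. *)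
Inductive harm : (R * R -> R) -> Prop :=
| harm_monom s j n : harm (monom s j n)
| harm_add f g : harm f -> harm g -> harm (fun p => f p + g p)
| harm_scale c f : harm f -> harm (fun p => c * f p).

Lemma harm_eq f g : f =1 g -> harm f -> harm g.
Proof. by move=> /funext ->. Qed.

(** Here u and v are combinations of z and conj(z); multiplication by z raises the exponent of
    z^(n+1), and conj(z) turns z^(n+1) into |z|^2 z^n. This closure is what places all polynomials
    in [harm]. *)
Lemma harm_mul f : harm f -> harm (fun p => p.1 * f p) /\ harm (fun p => p.2 * f p).
Proof.
elim=> {f} [s j [|n]|f g _ [IHf1 IHf2] _ [IHg1 IHg2]|c f _ [IH1 IH2]].
- split.
    apply: harm_eq (harm_scale (~~ s)%:R (harm_monom false j 1)) => p.
    by case: s; rewrite /monom /=; ring.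
  apply: harm_eq (harm_scale (~~ s)%:R (harm_monom true j 1)) => p.
  by case: s; rewrite /monom /=; ring.
- split.
    apply: harm_eq (harm_scale 2^-1 (harm_add (harm_monom s j n.+2) (harm_monom s j.+1 n))) => p.
    rewrite monomS /monom (mulrCA (rho2 p)) rho2_zpow.
    have -> : zpow s n.+2 p = p.1 * zpow s n.+1 p + sg s * (p.2 * zpow (~~ s) n.+1 p) by [].
    by move: (zpow s n.+1 p) (zpow (~~ s) n.+1 p) => a b; field.
  apply: harm_eq (harm_scale (2^-1 * sg (~~ s)) (harm_add (harm_monom (~~ s) j n.+2) (harm_scale (-1) (harm_monom (~~ s) j.+1 n)))) => p.
  rewrite monomS /monom (mulrCA (rho2 p)) rho2_zpow.
  have -> : zpow (~~ s) n.+2 p = p.1 * zpow (~~ s) n.+1 p + sg (~~ s) * (p.2 * zpow (~~ ~~ s) n.+1 p) by [].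
  rewrite negbK; move: (zpow s n.+1 p) (zpow (~~ s) n.+1 p) => a b.
  by case: s; rewrite /=; field.
- split; [apply: harm_eq (harm_add IHf1 IHg1)|apply: harm_eq (harm_add IHf2 IHg2)] => p; ring.
- split; [apply: harm_eq (harm_scale c IH1)|apply: harm_eq (harm_scale c IH2)] => p; ring.
Qed.

Lemma harm_cst (c : R) : harm (fun=> c).
Proof.
apply: harm_eq (harm_scale c (harm_monom false 0 0)) => p.
by rewrite /monom /= expr0 !mulr1.
Qed.

Lemma reg_harm P m f : base P -> harm f -> reg P m f.
Proof.
move=> bP; elim=> {f} [s j n|f g _ rf _ rg|c f _ rf]; first exact: reg_monom.
- exact: regD.
- exact: regZ.
Qed.

(** Since r = 1 on the circle, r^(2j+2) z^n - z^n vanishes there, and its Laplacian is a nonzero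
    multiple of r^(2j) z^n. The angular derivative of the solution is again of this kind; it is
    returned as [psi'], to serve as a test function next to [psi] in the weak formulation. *)
Lemma harm_solve f : harm f -> exists psi psi' : R * R -> R,
  [/\ forall P m, base P -> reg P m psi /\ reg P m psi',
      forall p, circle p -> psi p = 0 /\ psi' p = 0,
      forall p, cdisk p -> lap psi p = f p,
      forall p, cdisk p -> angular psi p = psi' p
    & forall p, cdisk p -> lap psi' p = angular f p].
Proof.
elim=> {f} [s j n|f g hf [a [a' [ra za la ta la']]] hg [b [b' [rb zb lb tb lb']]]|c f hf [a [a' [ra za la ta la']]]].
- pose k : R := (4 * (j.+1 * (j.+1 + n))%:R)^-1.
  pose sol t p := k * (monom t j.+1 n p + -1 * monom t 0 n p).
  have k0 : 4 * (j.+1 * (j.+1 + n))%:R != 0 :> R.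
    by rewrite mulf_neq0// pnatr_eq0 muln_eq0.
  have rs P m t : base P -> reg P m (sol t).
    move=> bP; apply: regZ => //; apply: regD => //; first exact: reg_monom.
    by apply: regZ => //; exact: reg_monom.
  have zs t p : circle p -> sol t p = 0.
    by rewrite /circle /= -/(rho2 p) /sol /monom => ->; rewrite expr1n expr0; ring.
  have ls t p : cdisk p -> lap (sol t) p = monom t j n p.
    move=> dp; have c1 := C_monom 2 t j.+1 n; have c2 := C_monom 2 t 0 n.
    have c3 := regZ base_ucontP (-1) c2; have c4 := regD base_ucontP c1 c3.
    rewrite lapZ// lapD// lapZ// lap_monom//.
    rewrite (lap_ext (f := monom t 0 n) (f' := zpow t n))//; last by move=> q _; rewrite monom0.
    by rewrite lap_zpow// mulr0 addr0 mulrA mulVf// mul1r.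
  pose c : R := sg s * n%:R.
  exists (sol s), (fun p => c * sol (~~ s) p); split.
  - by move=> P m bP; split; [exact: rs|apply: regZ => //; exact: rs].
  - by move=> p cp; rewrite !zs// mulr0.
  - exact: ls.
  - move=> p dp; have c1 := C_monom 1 s j.+1 n; have c2 := C_monom 1 s 0 n.
    have c3 := regZ base_ucontP (-1) c2; have c4 := regD base_ucontP c1 c3.
    rewrite angularZ// angularD// angularZ// !angular_monom// /sol /c; ring.
  - move=> p dp; have c1 := rs _ 2 (~~ s) base_ucontP.
    by rewrite lapZ// ls// angular_monom.
- exists (fun p => a p + b p), (fun p => a' p + b' p); split.
  - move=> P m bP; have [r1 r2] := ra P m bP; have [r3 r4] := rb P m bP.
    by split; exact: regD.
  - by move=> p cp; have [-> ->] := za p cp; have [-> ->] := zb p cp; rewrite !addr0.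
  - move=> p dp; have [r1 _] := ra _ 2 base_ucontP; have [r2 _] := rb _ 2 base_ucontP.
    by rewrite lapD// la// lb.
  - move=> p dp; have [r1 _] := ra _ 1 base_ucontP; have [r2 _] := rb _ 1 base_ucontP.
    by rewrite angularD// ta// tb.
  - move=> p dp; have [_ r1] := ra _ 2 base_ucontP; have [_ r2] := rb _ 2 base_ucontP.
    have r3 := reg_harm 1 base_ucontP hf; have r4 := reg_harm 1 base_ucontP hg.
    by rewrite lapD// angularD// la'// lb'.
- exists (fun p => c * a p), (fun p => c * a' p); split.
  - by move=> P m bP; have [r1 r2] := ra P m bP; split; exact: regZ.
  - by move=> p cp; have [-> ->] := za p cp; rewrite !mulr0.
  - by move=> p dp; have [r1 _] := ra _ 2 base_ucontP; rewrite lapZ// la.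
  - by move=> p dp; have [r1 _] := ra _ 1 base_ucontP; rewrite angularZ// ta.
  - move=> p dp; have [_ r1] := ra _ 2 base_ucontP.
    by have r2 := reg_harm 1 base_ucontP hf; rewrite lapZ// angularZ// la'.
Qed.

End PdCalculus.

(** * Bernstein approximation *)

Section Bernstein.
Context {R : realType}.
Implicit Types (p q : R * R) (f g : R * R -> R) (n : nat).

(* Expectation of G at the n-th step of the random walk started at a that
   moves by h with probability x: a Bernstein polynomial in x. *)
Fixpoint bern n (h x : R) (G : R -> R) (a : R) : R :=
  if n is n'.+1 then x * bern n' h x G (a + h) + (1 - x) * bern n' h x G a else G a.

(* Two walks are coupled so that they move together as often as possible. *)
Lemma bern_coupling n (h x x' A L : R) (G G' : R -> R) :
  0 <= h -> 0 <= L -> 0 <= x <= 1 -> 0 <= x' <= 1 ->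
  (forall a a', `|G a - G' a'| <= A + L * `|a - a'|) ->
  forall a a', `|bern n h x G a - bern n h x' G' a'| <= A + L * (`|a - a'| + n%:R * h * `|x - x'|).
Proof.
move=> h0 L0.
suff H y y' (F F' : R -> R) : 0 <= y <= 1 -> 0 <= y' <= 1 -> y <= y' ->
  (forall a a', `|F a - F' a'| <= A + L * `|a - a'|) ->
  forall a a', `|bern n h y F a - bern n h y' F' a'| <= A + L * (`|a - a'| + n%:R * h * `|y - y'|).
  move=> x01 x01' GG' a a'; have [xx'|/ltW x'x] := leP x x'; first exact: H.
  rewrite distrC (distrC a) (distrC x); apply: H => // b b'.
  by rewrite distrC (distrC b).
elim: n => [|n IH] y01 y01' yy' FF' a a' /=; first by rewrite !mul0r addr0.
set b := bern n h y F; set b' := bern n h y' F'.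
(* The coupled first step: both walks move with probability y, only the second with probability y' -
   y, neither with probability 1 - y'. *)
have -> : y * b (a + h) + (1 - y) * b a - (y' * b' (a' + h) + (1 - y') * b' a') =
  y * (b (a + h) - b' (a' + h)) + (y' - y) * (b a - b' (a' + h)) + (1 - y') * (b a - b' a').
  by ring.
have I1 := IH y01 y01' yy' FF' (a + h) (a' + h).
have I2 := IH y01 y01' yy' FF' a (a' + h).
have I3 := IH y01 y01' yy' FF' a a'.
rewrite -/b -/b' in I1 I2 I3.
have E1 : a + h - (a' + h) = a - a' by ring.
have E2 : `|a - (a' + h)| <= `|a - a'| + h.
  by rewrite opprD addrA (le_trans (ler_normD _ _))// normrN (ger0_norm h0).
rewrite E1 in I1.
apply: le_trans (ler_normD _ _) _; apply: le_trans (lerD (ler_normD _ _) (lexx _)) _.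
rewrite !normrM (ger0_norm (x := y)) ?(ger0_norm (x := y' - y)) ?(ger0_norm (x := 1 - y')); try lra.
have -> : `|y - y'| = y' - y by rewrite distrC ger0_norm; lra.
have {E1}->: n.+1%:R = n%:R + 1 :> R by rewrite natr1.
move: I1 I2 I3; have -> : `|y - y'| = y' - y by rewrite distrC ger0_norm; lra.
set K := A + L * _; move=> I1 I2 I3.
have I2' : `|b a - b' (a' + h)| <= K + L * h.
  apply: le_trans I2 _; rewrite /K -addrA -mulrDr lerD2l ler_wpM2l//.
  by rewrite addrAC lerD2r.
apply: le_trans (_ : y * K + (y' - y) * (K + L * h) + (1 - y') * K <= _).
  by apply: lerD; [apply: lerD|]; apply: ler_wpM2l => //; lra.
by rewrite le_eqVlt; apply/orP; left; apply/eqP; rewrite /K; ring.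
Qed.

(** The bracket is the mean of (S - m)^2 for the endpoint S of the walk: the squared distance of the
    mean of S from m, plus the variance of n independent steps. *)
Lemma bern_variance n (h x e K c m : R) (G : R -> R) :
  0 <= x <= 1 -> 0 <= K -> (forall s, `|G s - c| <= e + K * (s - m) ^+ 2) ->
  forall a, `|bern n h x G a - c| <=
    e + K * ((a + n%:R * h * x - m) ^+ 2 + n%:R * h ^+ 2 * (x * (1 - x))).
Proof.
move=> x01 K0 HG; elim: n => [|n IH] a /=; first by rewrite !mul0r !addr0.
have -> : x * bern n h x G (a + h) + (1 - x) * bern n h x G a - c =
  x * (bern n h x G (a + h) - c) + (1 - x) * (bern n h x G a - c) by ring.
apply: le_trans (ler_normD _ _) _.
rewrite !normrM (ger0_norm (x := x)) ?(ger0_norm (x := 1 - x)); try lra.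
apply: le_trans (lerD (ler_wpM2l _ (IH (a + h))) (ler_wpM2l _ (IH a))) _; rewrite -?[n.+1%:R]natr1; lra.
Qed.

(** From -1, n steps of length 2 / n end in [-1, 1]; with probability (1 + u) / 2 of moving, the
    mean endpoint is u. *)
Definition bern2 n (F : R * R -> R) p : R :=
  bern n (2 / n%:R) ((1 + p.1) / 2)
    (fun s => bern n (2 / n%:R) ((1 + p.2) / 2) (fun t => F (s, t)) (-1)) (-1).

Lemma harm_bern (k : bool) n (h : R) (G : R -> R * R -> R) (a : R) : (forall s, harm (G s)) ->
  harm (fun p => bern n h ((1 + (if k then p.1 else p.2)) / 2) (fun s => G s p) a).
Proof.
move=> hG; elim: n a => [|n IH] a /=; first exact: hG.
have mulh f : harm f -> harm (fun p => (if k then p.1 else p.2) * f p).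
  by move/harm_mul => []; case: (k).
have h1 := IH (a + h); have h2 := IH a.
apply: harm_eq (harm_scale 2^-1 (harm_add (harm_add h1 (mulh _ h1))
  (harm_add h2 (harm_scale (-1) (mulh _ h2))))) => p /=.
by field.
Qed.

Lemma harm_bern2 n F : harm (bern2 n F).
Proof.
apply: (@harm_bern true n (2 / n%:R) (fun s p => bern n (2 / n%:R) ((1 + p.2) / 2) (fun t => F (s, t)) (-1)) (-1)).
move=> s; apply: (@harm_bern false n (2 / n%:R) (fun t _ => F (s, t)) (-1)) => t.
exact: harm_cst.
Qed.

Lemma cdisk_box p : cdisk p -> (0 <= (1 + p.1) / 2 <= 1) /\ (0 <= (1 + p.2) / 2 <= 1).
Proof.
move=> dp; have := edist1 p 0; have := edist2 p 0; move/cdisk_edist0 : dp.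
rewrite /= !subr0 => h0 h1 h2.
have : `|p.1| <= 1 by lra.
have : `|p.2| <= 1 by lra.
rewrite !ler_norml => *; lra.
Qed.

(** By coupling, in each variable in turn, the Bernstein operator preserves an affine modulus of
    continuity with the same constants for every n. Concave moduli are bounded by affine ones, which
    is how Hoelder bounds reach the approximants. *)
Lemma bern2_lip n F (A L : R) : (0 < n)%N -> 0 <= L ->
  (forall p q, `|F p - F q| <= A + L * (`|p.1 - q.1| + `|p.2 - q.2|)) ->
  forall p q, cdisk p -> cdisk q ->
    `|bern2 n F p - bern2 n F q| <= A + L * (`|p.1 - q.1| + `|p.2 - q.2|).
Proof.
move=> n0 L0 HF p q /cdisk_box[bp1 bp2] /cdisk_box[bq1 bq2].
have nn : n%:R != 0 :> R by rewrite pnatr_eq0 -lt0n.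
have h0 : 0 <= 2 / n%:R :> R by rewrite divr_ge0.
have half (x y : R) : n%:R * (2 / n%:R) * `|(1 + x) / 2 - (1 + y) / 2| = `|x - y|.
  have -> : (1 + x) / 2 - (1 + y) / 2 = (x - y) / 2 by field.
  by rewrite normrM (ger0_norm (x := 2^-1))//; field.
rewrite /bern2.
apply: le_trans (bern_coupling (A := A + L * `|p.2 - q.2|) _ h0 L0 bp1 bq1 _ (-1) (-1)) _.
  move=> s s'.
  apply: le_trans (bern_coupling (A := A + L * `|s - s'|) _ h0 L0 bp2 bq2 _ (-1) (-1)) _.
    by move=> t t'; apply: le_trans (HF _ _) _; rewrite /= mulrDr addrA.
  by rewrite subrr normr0 add0r half addrAC.
by rewrite subrr normr0 add0r half; lra.
Qed.

(** The inequality L |z| <= L eta + (L / eta) z^2 replaces the affine modulus by a quadratic one,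
    whose mean is controlled by the variance of the endpoint, at most 1 / n in each variable. *)
Lemma bern2_cvg n F (A L eta : R) : (0 < n)%N -> 0 <= L -> 0 < eta ->
  (forall p q, `|F p - F q| <= A + L * (`|p.1 - q.1| + `|p.2 - q.2|)) ->
  forall p, cdisk p -> `|bern2 n F p - F p| <= A + 2 * L * eta + 2 * (L / eta) / n%:R.
Proof.
move=> n0 L0 eta0 HF p /cdisk_box[b1 b2].
have n1 : 0 < n%:R :> R by rewrite ltr0n.
have h0 : 0 <= 2 / n%:R :> R by rewrite divr_ge0.
have K0 : 0 <= L / eta by rewrite divr_ge0// ltW.
have sq (z : R) : L * `|z| <= L * eta + L / eta * z ^+ 2.
  rewrite -mulrA -mulrDr ler_wpM2l// -(ler_pM2r eta0) mulrDl mulrAC mulVf ?gt_eqF// mul1r.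
  rewrite -[z ^+ 2]real_normK ?num_real//.
  have := sqr_ge0 (`|z| - eta); have : 0 <= `|z| * eta by rewrite mulr_ge0// ltW.
  by rewrite sqrrB !expr2; lra.
have var (y : R) : 0 <= (1 + y) / 2 <= 1 ->
    (-1 + n%:R * (2 / n%:R) * ((1 + y) / 2) - y) ^+ 2 + n%:R * (2 / n%:R) ^+ 2 * ((1 + y) / 2 * (1 - (1 + y) / 2)) <= n%:R^-1.
  move=> by01.
  have -> : -1 + n%:R * (2 / n%:R) * ((1 + y) / 2) - y = 0 by field; rewrite gt_eqF.
  have -> : n%:R * (2 / n%:R) ^+ 2 * ((1 + y) / 2 * (1 - (1 + y) / 2)) = n%:R^-1 * (1 - y ^+ 2).
    by field; rewrite gt_eqF.
  by rewrite expr0n add0r ler_piMr ?invr_ge0 ?ler0n//; have := sqr_ge0 y; lra.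
apply: le_trans (bern_variance _ _ (e := A + 2 * L * eta + (L / eta) / n%:R) (m := p.1) b1 K0 _ _) _.
- move=> s.
  apply: le_trans (bern_variance _ _ (e := A + L * `|s - p.1| + L * eta) (m := p.2) b2 K0 _ _) _.
    move=> t; rewrite [p in F p]surjective_pairing.
    apply: le_trans (HF _ _) _; rewrite /= mulrDr; have := sq (t - p.2); lra.
  have := var p.2 b2; move/(ler_wpM2l K0); have := sq (s - p.1); lra.
by have := var p.1 b1; move/(ler_wpM2l K0); lra.
Qed.

(* The radial projection onto the closed disk, used to extend functions. *)
Definition rho p := (Num.max 1 (edist p 0))^-1 *: p.

Lemma rho_cdisk p : cdisk (rho p).
Proof.
apply/cdisk_edist0; rewrite /rho; set m := Num.max _ _.
have m1 : 1 <= m by rewrite le_max lexx.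
have -> : edist (m^-1 *: p) 0 = m^-1 * edist p 0.
  by rewrite -[in RHS]edist_dil ?scaler0// invr_ge0; lra.
by rewrite mulrC ler_pdivrMr ?mul1r ?le_max ?lexx ?orbT//; lra.
Qed.

Lemma rho_id p : cdisk p -> rho p = p.
Proof.
by move=> /cdisk_edist0 dp; rewrite /rho max_l// invr1 scale1r.
Qed.

(** The intermediate point is q scaled with the factor of p. Each of the two moves costs at most
    [edist p q]: the first because the factor is at most 1, the second because the norms of p and q
    differ by at most that distance. *)
Lemma rho_lip p q : edist (rho p) (rho q) <= 2 * edist p q.
Proof.
rewrite /rho; set m := Num.max 1 (edist p 0); set n := Num.max 1 (edist q 0).
have m1 : 1 <= m by rewrite le_max lexx.
have n1 : 1 <= n by rewrite le_max lexx.
have im : 0 <= m^-1 <= 1 by rewrite invr_ge0 invf_le1; lra.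
have mn : `|n - m| <= edist p q.
  have h1 := edist_triangle p q 0; have h2 := edist_triangle q p 0.
  have e0 := edist_ge0 p q; rewrite (edistC q p) in h2; rewrite /m /n.
  by rewrite ler_norml /Num.max; case: ltP => a1; case: ltP => a2; lra.
apply: le_trans (edist_triangle _ (m^-1 *: q) _) _.
have i0 : 0 <= m^-1 by case/andP: im.
rewrite edist_dil//.
have -> : edist (m^-1 *: q) (n^-1 *: q) = `|m^-1 - n^-1| * edist q 0.
  move: (n) => n'; case: (q) => a b.
  rewrite /edist /= /GRing.scale /= !subr0 -!mulrBl !exprMn -mulrDr sqrtrM ?sqr_ge0//.
  by rewrite sqrtr_sqr.
have : m^-1 * edist p q <= edist p q by rewrite ler_piMl ?edist_ge0//; lra.
have : `|m^-1 - n^-1| * edist q 0 <= edist p q.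
  apply: le_trans (_ : `|m^-1 - n^-1| * n <= _).
    by rewrite ler_wpM2l// le_max lexx orbT.
  have -> : m^-1 - n^-1 = (n - m) / (m * n) by field; rewrite !gt_eqF; lra.
  rewrite normrM [`|(m * n)^-1|]ger0_norm ?invr_ge0 ?mulr_ge0; try lra.
  have -> : `|n - m| / (m * n) * n = m^-1 * `|n - m| by field; rewrite !gt_eqF; lra.
  by apply: le_trans mn; rewrite ler_piMl//; lra.
lra.
Qed.

(** An affine majorant of the concave function t^alpha, chosen to exceed it only by the factor 2 at
    t = d. *)
Lemma powR_affine (alpha t d : R) : 0 < alpha < 1 -> 0 <= t -> 0 < d ->
  t `^ alpha <= d `^ alpha + d `^ (alpha - 1) * t.
Proof.
move=> /andP[a0 a1] t0 d0; have [td|dt] := leP t d.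
  have := powR_mono (ltW a0) t0 td; have := powR_ge0 d (alpha - 1); nra.
have t1 : 0 < t by lra.
have -> : t `^ alpha = t `^ (alpha - 1) * t.
  by rewrite mulrC mulr_powRB1.
rewrite ler_wpDl ?powR_ge0// ler_wpM2r// -opprB !powRN.
rewrite lef_pV2 ?posrE ?powR_gt0//; apply: powR_mono; lra.
Qed.

Lemma polynomial_approx F : (forall A : R, 0 < A -> exists2 L : R, 0 <= L &
    forall p q, `|F p - F q| <= A + L * (`|p.1 - q.1| + `|p.2 - q.2|)) ->
  forall e : R, 0 < e -> exists2 n, (0 < n)%N & forall p, cdisk p -> `|bern2 n F p - F p| <= e.
Proof.
move=> HF e e0; have [L L0 HL] := HF (e / 3) ltac:(by rewrite divr_gt0).
(* The error of [bern2_cvg] has three terms: A is e / 3 by the choice of L, this eta makes 2 L eta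
   at most e / 3, and then n does the same for the last one. *)
pose eta := e / (6 * (L + 1)).
have eta0 : 0 < eta by rewrite divr_gt0// mulr_gt0//; lra.
pose n := (Num.Def.truncn (6 * (L / eta) / e)).+1.
have n0 : 0 < n%:R :> R by rewrite ltr0n.
have h1 : 2 * (L / eta) / n%:R <= e / 3.
  rewrite ler_pdivrMr// [leRHS]mulrC -ler_pdivrMr ?divr_gt0//.
  have -> : 2 * (L / eta) / (e / 3) = 6 * (L / eta) / e by field; rewrite !gt_eqF.
  by apply/ltW/truncnS_gt.
have h2 : 2 * L * eta <= e / 3.
  have -> : 2 * L * eta = (L / (L + 1)) * (e / 3) by rewrite /eta; field; rewrite gt_eqF//; lra.
  by rewrite ler_piMl ?divr_ge0 ?ltW// ltr_pdivrMr; lra.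
exists n => // p dp; apply: le_trans (bern2_cvg (n := n) isT L0 eta0 HL dp) _; lra.
Qed.

Lemma ucont_modulus f : ucont f -> forall A : R, 0 < A -> exists2 L : R, 0 <= L &
  forall p q, `|f (rho p) - f (rho q)| <= A + L * (`|p.1 - q.1| + `|p.2 - q.2|).
Proof.
move=> cf A A0; have [d d0 H] := cf A A0.
have [B B0 HB] := cdisk_bounded (proj1 (ucont_within _) cf).
(* If the projected points are at distance at least d, the points themselves are at distance at
   least d / 2 by [rho_lip], and the oscillation 2 B equals (4 B / d) (d / 2). *)
exists (4 * B / d); first by rewrite divr_ge0 ?mulr_ge0// ltW.
move=> p q; have h1 := rho_lip p q; have h2 := edist_le_sum p q.
have h3 : 0 <= 4 * B / d by rewrite divr_ge0 ?mulr_ge0// ltW.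
have h4 : 0 <= 4 * B / d * (`|p.1 - q.1| + `|p.2 - q.2|) by rewrite mulr_ge0 ?addr_ge0.
have [pq|pq] := ltP (edist (rho p) (rho q)) d.
  by have := H _ _ (rho_cdisk p) (rho_cdisk q) pq; lra.
have : `|f (rho p) - f (rho q)| <= 2 * B.
  apply: le_trans (ler_normB _ _) _.
  by have := HB _ (rho_cdisk p); have := HB _ (rho_cdisk q); lra.
have : 2 * B <= 4 * B / d * (`|p.1 - q.1| + `|p.2 - q.2|).
  have -> : 4 * B / d * (`|p.1 - q.1| + `|p.2 - q.2|) = 2 * B * (2 * (`|p.1 - q.1| + `|p.2 - q.2|) / d).
    by field; rewrite gt_eqF.
  rewrite ler_peMr ?mulr_ge0// ler_pdivlMr//; lra.
lra.
Qed.

Lemma harm_approx f (e : R) : ucont f -> 0 < e ->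
  exists2 g, harm g & forall p, cdisk p -> `|g p - f p| <= e.
Proof.
move=> cf e0; have [n n0 H] := polynomial_approx (ucont_modulus cf) e0.
exists (bern2 n (fun p => f (rho p))); first exact: harm_bern2.
by move=> p dp; have := H p dp; rewrite rho_id.
Qed.

(** For each pair p, q at distance d the affine majorant of the Hoelder modulus at d is preserved by
    the Bernstein operator. Evaluated at this pair it gives (2 + 4) |M| d^alpha, one factor 2 coming
    from [rho_lip] and one from comparing the l^1 and Euclidean distances. The bound is independent
    of the accuracy e. *)
Lemma harm_approx_hol (alpha : R) f : 0 < alpha < 1 -> hol alpha f ->
  exists2 M : R, 0 <= M & forall e : R, 0 < e -> exists2 g, harm g &
    (forall p, cdisk p -> `|g p - f p| <= e) /\
    (forall p q, cdisk p -> cdisk q -> `|g p - g q| <= M * edist p q `^ alpha).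
Proof.
move=> a01 hf; have cf := base_ucont (base_hol a01) hf; have [M HM] := hf.
exists (6 * `|M|); first by rewrite mulr_ge0.
move=> e e0; have [n n0 H] := polynomial_approx (ucont_modulus cf) e0.
exists (bern2 n (fun p => f (rho p))); first exact: harm_bern2.
split; first by move=> p dp; have := H p dp; rewrite rho_id.
move=> p q dp dq; have [->|/eqP pq] := eqVneq p q.
  by rewrite subrr normr0 !mulr_ge0 ?powR_ge0.
have d0 := edist_gt0 pq; set d := edist p q in d0 *.
have pd : d `^ (alpha - 1) * d = d `^ alpha.
  by rewrite mulrC mulr_powRB1 ?ltW//; case/andP: a01.
have L0 : 0 <= 2 * `|M| * d `^ (alpha - 1) by rewrite !mulr_ge0 ?powR_ge0.
apply: le_trans (bern2_lip (A := `|M| * d `^ alpha * 2) n0 L0 _ dp dq) _.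
  move=> a b; apply: le_trans (HM _ _ (rho_cdisk a) (rho_cdisk b)) _.
  have r0 := edist_ge0 (rho a) (rho b).
  have := powR_affine a01 r0 d0; have := rho_lip a b; have := edist_le_sum a b.
  set S := `|_| + `|_|; set t := edist (rho a) (rho b); move=> h1 h2 h3.
  apply: le_trans (_ : `|M| * t `^ alpha <= _).
    by rewrite ler_wpM2r ?powR_ge0// ler_norm.
  apply: le_trans (ler_wpM2l (normr_ge0 M) h3) _.
  have h4 : d `^ (alpha - 1) * t <= d `^ (alpha - 1) * (2 * S).
    by rewrite ler_wpM2l ?powR_ge0//; lra.
  have h5 : 0 <= `|M| * d `^ alpha by rewrite mulr_ge0 ?powR_ge0.
  have := ler_wpM2l (normr_ge0 M) h4; lra.
have h1 := edist1 p q; have h2 := edist2 p q; rewrite -/d in h1 h2.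
have : 2 * `|M| * d `^ (alpha - 1) * (`|p.1 - q.1| + `|p.2 - q.2|) <= 2 * `|M| * d `^ (alpha - 1) * (2 * d).
  by rewrite ler_wpM2l//; lra.
have -> : 2 * `|M| * d `^ (alpha - 1) * (2 * d) = 4 * `|M| * (d `^ (alpha - 1) * d) by ring.
rewrite pd; lra.
Qed.

End Bernstein.

(** * The Dirichlet problem in C^(2+alpha) *)

Section UniformLimits.
Context {R : realType}.
Implicit Types (p q : R * R) (f g : R * R -> R) (i j : 'I_2) (n : nat).

Lemma is_derive_eps f p v (l : R) :
  (forall e : R, 0 < e -> exists2 d : R, 0 < d &
     forall h : R, `|h| < d -> `|f (h *: v + p) - f p - h * l| <= e * `|h|) ->
  is_derive p v f l.
Proof.
move=> H.
have c : h^-1 *: ((f \o shift p) (h *: v) - f p) @[h --> 0^'] --> l.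
  apply/cvgrPdist_le => e e0; have [d d0 Hd] := H e e0.
  rewrite /prop_near1 /dnbhs /within /=; apply/nbhs_ballP; exists d => //= h.
  rewrite /ball /= sub0r normrN => hd h0.
  have -> : l - h^-1 *: (f (h *: v + p) - f p) = - (h^-1 * (f (h *: v + p) - f p - h * l)).
    by rewrite [h^-1 *: _]/(h^-1 * _) [in RHS]mulrBr mulKf// opprB.
  by rewrite normrN normrM normfV mulrC ler_pdivrMr ?normr_gt0// Hd.
split; first by apply/cvg_ex; exists l.
by apply: cvg_lim c; exact: norm_hausdorff.
Qed.

Definition uconv (F : nat -> R * R -> R) f := forall e : R, 0 < e ->
  exists N, forall n p, (N <= n)%N -> cdisk p -> `|F n p - f p| <= e.

Lemma uconv_ucont (F : nat -> R * R -> R) f : (forall n, ucont (F n)) -> uconv F f -> ucont f.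
Proof.
move=> cF Ff e e0; have e3 : 0 < e / 3 by rewrite divr_gt0.
have [N HN] := Ff _ e3; have [d d0 Hd] := cF N _ e3; exists d => // p q dp dq pq.
have h1 := HN N p (leqnn _) dp; have h2 := HN N q (leqnn _) dq; have h3 := Hd p q dp dq pq.
rewrite distrC in h1.
have := ler_distD (F N p) (f p) (f q); have := ler_distD (F N q) (F N p) (f q).
lra.
Qed.

Lemma line_bound i f (g : R * R -> R) (l e : R) p (h : R) : ucont f -> pderiv i f g ->
  disk p -> (forall t : R, `|t| <= `|h| -> disk (t *: dir i + p)) ->
  (forall t : R, `|t| <= `|h| -> `|g (t *: dir i + p) - l| <= e) ->
  `|f (h *: dir i + p) - f p - h * l| <= e * `|h|.
Proof.
move=> cf fg dp box H.
have [h0|h0|->] := ltgtP h 0; last first.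
- by rewrite scale0r add0r subrr mul0r subr0 normr0 mulr0.
- have [t [th dt ->]] := line_MVT cf fg h0 (disk_cdisk dp) (disk_cdisk (box h (lexx _))).
  rewrite mulrC -mulrBr normrM mulrC ler_wpM2r// H// !ger0_norm; lra.
have h1 : 0 < - h by lra.
have E : - h *: dir i + (h *: dir i + p) = p.
  by rewrite addrA -scalerDl addNr scale0r add0r.
have d1 := disk_cdisk (box h (lexx _)).
have [t [th dt]] := line_MVT cf fg h1 d1 (eq_ind_r (@cdisk R) (disk_cdisk dp) E).
rewrite E addrA -scalerDl => E2.
have -> : f (h *: dir i + p) - f p - h * l = h * (g ((t + h) *: dir i + p) - l).
  by rewrite mulrBr -[f (h *: dir i + p) - f p]opprB E2; ring.
by rewrite normrM mulrC ler_wpM2r// H// !ler0_norm; lra.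
Qed.

(** By the mean value theorem the linear approximation of [F n] at p with slope [g i p] has error at
    most e |h|, for h in a range given by the continuity of [g] and valid for all large n. At fixed
    h this passes to the limit. *)
Lemma grad_lim (F : nat -> R * R -> R) (G : nat -> 'I_2 -> R * R -> R) f (g : 'I_2 -> R * R -> R) :
  (forall n, grad (F n) (G n)) -> uconv F f -> (forall i, uconv (fun n => G n i) (g i)) ->
  grad f g.
Proof.
move=> FG Ff Gg.
have cf : ucont f by apply: uconv_ucont Ff => n; case: (FG n).
have cg i : ucont (g i) by apply: uconv_ucont (Gg i) => n; case: (FG n).
split => // i p dp; apply: is_derive_eps => e e0.
have e2 : 0 < e / 2 by rewrite divr_gt0.
have [d1 d10 h1] := cg i _ e2.
have /nbhs_edist[d2 d20 h2] := disk_open dp.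
exists (Num.min d1 d2); first by rewrite lt_min d10.
move=> h; rewrite lt_min => /andP[hd1 hd2].
have box (t : R) : `|t| <= `|h| -> disk (t *: dir i + p).
  by move=> th; apply: h2; rewrite edist_line0; lra.
apply/ler_addgt0Pr => e' e'0.
have e3 : 0 < Num.min (e' / 3) (e / 2) by rewrite lt_min e2 divr_gt0.
have [N HN] := Ff _ e3; have [N' HN'] := Gg i _ e3.
pose n := maxn N N'.
have k1 := HN n p (leq_maxl _ _) (disk_cdisk dp).
have k2 := HN n (h *: dir i + p) (leq_maxl _ _) (disk_cdisk (box h (lexx _))).
have [cF _ dF] := FG n.
have k3 : `|F n (h *: dir i + p) - F n p - h * g i p| <= e * `|h|.
  apply: (line_bound cF (dF i) dp box) => t th. have k3 := HN' n (t *: dir i + p) (leq_maxr _ _) (disk_cdisk (box t th)).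
  have k4 : `|g i (t *: dir i + p) - g i p| <= e / 2.
    rewrite distrC; apply: h1; [exact: disk_cdisk|exact/disk_cdisk/box|].
    by rewrite edist_line0; lra.
  have := ler_distD (g i (t *: dir i + p)) (G n i (t *: dir i + p)) (g i p).
  have : Num.min (e' / 3) (e / 2) <= e / 2 by rewrite ge_min lexx orbT.
  lra.
have m3 : Num.min (e' / 3) (e / 2) <= e' / 3 by rewrite ge_min lexx.
have -> : f (h *: dir i + p) - f p - h * g i p =
  (F n (h *: dir i + p) - F n p - h * g i p) - (F n (h *: dir i + p) - f (h *: dir i + p)) + (F n p - f p) by ring.
by apply: le_trans (ler_normD _ _) _; have := ler_normB (F n (h *: dir i + p) - F n p - h * g i p) (F n (h *: dir i + p) - f (h *: dir i + p)); lra.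
Qed.

Lemma ucauchy_uconv (F : nat -> R * R -> R) : (forall e : R, 0 < e ->
  exists N, forall n m p, (N <= n)%N -> (N <= m)%N -> cdisk p -> `|F n p - F m p| <= e) ->
  exists f, uconv F f.
Proof.
move=> HF; exists (fun p => lim (F n p @[n --> \oo])) => e e0.
have [N HN] := HF _ e0; exists N => n p Nn dp.
have cF : cvg (F n p @[n --> \oo]).
  apply/cauchy_cvgP/cauchy_ballP => e' e'0; rewrite near_map2.
  have [N' HN'] := HF _ (divr_gt0 e'0 (ltr0n _ 2)).
  exists ([set n | (N' <= n)%N], [set n | (N' <= n)%N]) => /=.
    by split; exists N'.
  move=> [a b] /= [Na Nb]; rewrite /ball /=.
  by apply: le_lt_trans (HN' a b p Na Nb dp) _; rewrite ltr_pdivrMr//; lra.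
apply/ler_addgt0Pr => e' e'0.
move/cvgrPdist_le : (cF) => /(_ _ e'0) [N' _ HN'].
have h1 := HN n (maxn N N') p Nn (leq_maxl _ _) dp.
have := HN' (maxn N N') (leq_maxr _ _).
rewrite distrC => h2; have := ler_distD (F (maxn N N') p) (F n p) (lim (F n p @[n --> \oo])).
lra.
Qed.

End UniformLimits.

(** * Uniqueness and existence from the a priori estimate *)

Section Dirichlet.
Context {R : realType}.
Implicit Types (p q : R * R) (f g : R * R -> R) (i j : 'I_2) (n : nat).
Variable C : R -> R.
Hypothesis hC : forall alpha : R, 0 < alpha < 1 ->
  forall tau : R * R -> R, holder 2 alpha tau ->
    (forall p, circle p -> tau p = 0) ->
    (holder_norm 2 alpha tau <= (C alpha)%:E * holder_norm 0 alpha (laplacian tau))%E.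

Local Notation Creg := (reg ucont).

Lemma ord2P (Q : 'I_2 -> Prop) : Q 0 -> Q 1 -> forall i, Q i.
Proof.
move=> q0 q1 [[|[|//]] hi].
  by have -> : Ordinal hi = 0 by exact/val_inj.
by have -> : Ordinal hi = 1 by exact/val_inj.
Qed.

(** The assumed estimate, unpacked into real bounds for the separate derivatives. The absolute value
    is there because the sign of the constant has not been determined at this point. *)
Lemma schauder_bounds (alpha A B : R) tau : 0 < alpha < 1 -> reg (hol alpha) 2 tau ->
  (forall p, circle p -> tau p = 0) ->
  (forall p, cdisk p -> `|lap tau p| <= A) ->
  (forall p q, cdisk p -> cdisk q -> `|lap tau p - lap tau q| <= B * edist p q `^ alpha) ->
  let K := `|C alpha| * (A + B) in
  [/\ forall p, cdisk p -> `|tau p| <= K,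
      forall i p, cdisk p -> `|dd i tau p| <= K,
      forall i j p, cdisk p -> `|dd i (dd j tau) p| <= K
    & forall i j p q, cdisk p -> cdisk q ->
        `|dd i (dd j tau) p - dd i (dd j tau) q| <= K * edist p q `^ alpha].
Proof.
move=> a01 rt zt hA hB K; have /andP[a0 a1] := a01.
have N : (holder_norm 2 alpha tau <= K%:E)%E.
  apply: le_trans (hC a01 (proj2 (holderP _ _ a01) rt) zt) _.
  apply: (@le_trans _ _ (`|C alpha|%:E * holder_norm 0 alpha (laplacian tau))%E).
    by rewrite lee_wpmul2r ?holder_norm_ge0// lee_fin ler_norm.
  rewrite /K EFinM lee_wpmul2l ?lee_fin// holder_norm0 laplacianE EFinD.
  by apply: leeD; [exact/sup_norm_leP|exact/seminorm_leP].
have S a b : (a + b <= 2)%N -> forall p, cdisk p -> `|pdn a b tau p| <= K.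
  by move=> ab; apply/sup_norm_leP/(le_trans _ N)/sup_norm_le_holder.
have T a b : (a + b = 2)%N -> forall p q, cdisk p -> cdisk q ->
    `|pdn a b tau p - pdn a b tau q| <= K * edist p q `^ alpha.
  by move=> ab; apply/(seminorm_leP _ _ a0)/(le_trans _ N)/seminorm_le_holder.
have c10 p : cdisk p -> dd 1 (dd 0 tau) p = dd 0 (dd 1 tau) p.
  by move=> dp; rewrite (ddC (base_hol a01) rt dp).
split.
- exact: (S 0 0)%N.
- by apply: ord2P => p dp; rewrite ddE; [exact: (S 1 0)%N|exact: (S 0 1)%N].
- apply: ord2P; apply: ord2P => p dp; rewrite ?c10// ddE; [exact: (S 2 0)%N|exact: (S 1 1)%N|exact: (S 1 1)%N|exact: (S 0 2)%N].
- apply: ord2P; apply: ord2P => p q dp dq; rewrite ?c10// ddE; [exact: (T 2 0)%N|exact: (T 1 1)%N|exact: (T 1 1)%N|exact: (T 0 2)%N].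
Qed.

(** The difference has zero Laplacian and zero boundary values, so the right-hand side of the
    estimate for it is 0. *)
Lemma dirichlet_unique (alpha : R) tau tau' : 0 < alpha < 1 ->
  reg (hol alpha) 2 tau -> reg (hol alpha) 2 tau' ->
  (forall p, circle p -> tau p = tau' p) ->
  (forall p, cdisk p -> lap tau p = lap tau' p) -> forall p, cdisk p -> tau p = tau' p.
Proof.
move=> a01 rt rt' zt lt p dp; have bh := base_hol a01.
have c2 := reg_ucontW bh rt; have c2' := reg_ucontW bh rt'.
have L q : cdisk q -> lap (fun p => tau p - tau' p) q = 0.
  by move=> dq; rewrite lapB// lt// subrr.
have [||||H _ _ _] := @schauder_bounds alpha 0 0 (fun p => tau p - tau' p) a01.
- exact: regB.
- by move=> q cq; rewrite zt// subrr.
- by move=> q dq; rewrite L// normr0.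
- by move=> q q' dq dq'; rewrite !L// subrr normr0 mul0r.
by have := H p dp; rewrite addr0 mulr0 normr_le0 subr_eq0 => /eqP.
Qed.

(** The square of a difference of values is at most the product of its two bounds 2 s and M d^alpha.
    Hence uniform smallness together with a bounded seminorm gives a small seminorm of half the
    exponent. *)
Lemma holder_interpolation (alpha s M : R) f : 0 < alpha ->
  (forall p, cdisk p -> `|f p| <= s) ->
  (forall p q, cdisk p -> cdisk q -> `|f p - f q| <= M * edist p q `^ alpha) ->
  forall p q, cdisk p -> cdisk q ->
    `|f p - f q| <= Num.sqrt (2 * s * M) * edist p q `^ (alpha / 2).
Proof.
move=> a0 hs hM p q dp dq.
have s0 : 0 <= s by apply: le_trans (hs p dp).
have [M0|M0] := ltP M 0.
  have := hM p q dp dq; have := normr_ge0 (f p - f q); have := powR_ge0 (edist p q) alpha => h1 h2 h3.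
  apply: (@le_trans _ _ 0); last by rewrite mulr_ge0 ?sqrtr_ge0 ?powR_ge0.
  by nra.
rewrite -ler_sqr ?nnegrE ?mulr_ge0 ?sqrtr_ge0 ?powR_ge0//.
rewrite exprMn sqr_sqrtr ?mulr_ge0//.
have -> : (edist p q `^ (alpha / 2)) ^+ 2 = edist p q `^ alpha.
  by rewrite expr2 -powRD -?splitr// gt_eqF.
have h1 := hM p q dp dq.
have h2 : `|f p - f q| <= 2 * s.
  by apply: le_trans (ler_normB _ _) _; have := hs p dp; have := hs q dq; lra.
by rewrite expr2 -(mulrA (2 * s)); apply: ler_pM.
Qed.

(** Only uniform convergence is assumed for the second derivatives; the common Hoelder bound [K]
    passes to their limits pointwise. *)
Lemma reg_uconv2 (alpha K : R) (F : nat -> R * R -> R) : 0 < alpha < 1 ->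
  (forall n, reg (hol alpha) 2 (F n)) ->
  (forall e : R, 0 < e -> exists N, forall n m p, (N <= n)%N -> (N <= m)%N -> cdisk p ->
    [/\ `|F n p - F m p| <= e, forall i, `|dd i (F n) p - dd i (F m) p| <= e
      & forall i j, `|dd i (dd j (F n)) p - dd i (dd j (F m)) p| <= e]) ->
  (forall n i j p q, cdisk p -> cdisk q ->
    `|dd i (dd j (F n)) p - dd i (dd j (F n)) q| <= K * edist p q `^ alpha) ->
  exists2 f, reg (hol alpha) 2 f &
    uconv F f /\ forall i j, uconv (fun n => dd i (dd j (F n))) (dd i (dd j f)).
Proof.
move=> a01 rF cF hK; have bh := base_hol a01.
have [f Ff] : exists f, uconv F f.
  apply: ucauchy_uconv => e e0; have [N HN] := cF e e0; exists N => n m p Nn Nm dp.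
  by case: (HN n m p Nn Nm dp).
have /choice[g Fg] : forall i, exists g, uconv (fun n => dd i (F n)) g.
  move=> i; apply: ucauchy_uconv => e e0; have [N HN] := cF e e0; exists N => n m p Nn Nm dp.
  by case: (HN n m p Nn Nm dp).
have /choice[h Fh] : forall ij, exists h, uconv (fun n => dd ij.1 (dd ij.2 (F n))) h.
  move=> [i j]; apply: ucauchy_uconv => e e0; have [N HN] := cF e e0; exists N => n m p Nn Nm dp.
  by case: (HN n m p Nn Nm dp).
have c2 n := reg_ucontW bh (rF n).
have gf : grad f g.
  by apply: (grad_lim (F := F) (G := fun n i => dd i (F n))) => // n; exact/C_grad/C_le/(c2 n).
have gg j : grad (g j) (fun i => h (i, j)).
  apply: (grad_lim (F := fun n => dd j (F n)) (G := fun n i => dd i (dd j (F n)))) => //.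
    by move=> n; exact/C_grad/C_dd/(c2 n).
  by move=> i; exact: Fh (i, j).
have hh ij : hol alpha (h ij).
  exists K => p q dp dq; apply/ler_addgt0Pr => e e0.
  have [N HN] := Fh ij _ (divr_gt0 e0 (ltr0n _ 2)).
  have h1 := HN N p (leqnn _) dp; have h2 := HN N q (leqnn _) dq.
  have h3 := hK N ij.1 ij.2 p q dp dq; rewrite distrC in h1.
  set a := dd _ _ in h1 h2 h3.
  have := ler_distD (a p) (h ij p) (h ij q); have := ler_distD (a q) (a p) (h ij q).
  lra.
exists f; first by exists g => // j; exists (fun i => h (i, j)) => // i; exact: hh.
split=> // i j e e0; have [N HN] := Fh (i, j) e e0; exists N => n p Nn dp.
have E : dd i (dd j f) p = h (i, j) p.
  rewrite -(dd_grad i (gg j) dp); apply: dd_ext dp; last by move=> q dq; rewrite (dd_grad j gf dq).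
  apply: C_dd; exists g => // k; exists (fun i => h (i, k)) => // l.
  exact: base_ucont bh _ (hh _).
by rewrite E; exact: HN.
Qed.

Lemma dirichlet_hol (alpha : R) f : 0 < alpha < 1 -> hol alpha f -> exists tau,
  [/\ reg (hol alpha) 2 tau, forall p, circle p -> tau p = 0
    & forall p, cdisk p -> lap tau p = f p].
Proof.
move=> a01 hf; have /andP[a0 a1] := a01; have bh := base_hol a01.
have a201 : 0 < alpha / 2 < 1 by lra.
have bh2 := base_hol a201.
have [M M0 HM] := harm_approx_hol a01 hf.
have /choice[q Hq] : forall n, exists q : R * R -> R, harm q /\ (forall p, cdisk p -> `|q p - f p| <= n.+1%:R^-1) /\
    (forall p p', cdisk p -> cdisk p' -> `|q p - q p'| <= M * edist p p' `^ alpha).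
  by move=> n; have [g hg [g1 g2]] := HM n.+1%:R^-1 ltac:(by rewrite invr_gt0 ltr0n); exists g.
have /choice[T HT] : forall n, exists T : R * R -> R, [/\ forall P m, base P -> reg P m T,
    forall p, circle p -> T p = 0 & forall p, cdisk p -> lap T p = q n p].
  move=> n; have [hq _] := Hq n; have [psi [psi' [r z l _ _]]] := harm_solve hq.
  by exists psi; split => // [P m bP|p cp]; [case: (r P m bP)|case: (z p cp)].
have rT n P m : base P -> reg P m (T n) by move=> bP; case: (HT n) => r _ _; exact: r.
have zT n p : circle p -> T n p = 0 by case: (HT n) => _ z _; exact: z.
have lT n p : cdisk p -> lap (T n) p = q n p by case: (HT n) => _ _ l; exact: l.
have qf n p : cdisk p -> `|q n p - f p| <= n.+1%:R^-1 by case: (Hq n) => _ [h _]; exact: h.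
have [B B0 HB] := cdisk_bounded (proj1 (ucont_within _) (base_ucont bh hf)).
(* The approximants are within 1 of f, hence bounded by B + 1, and M is their common seminorm
   bound. *)
pose K := `|C alpha| * ((B + 1) + M).
have hK n i j p p' : cdisk p -> cdisk p' ->
    `|dd i (dd j (T n)) p - dd i (dd j (T n)) p'| <= K * edist p p' `^ alpha.
  have [||_ _ _ H] := @schauder_bounds alpha (B + 1) M (T n) a01 (rT n _ 2 bh) (zT n).
  - move=> r dr; rewrite lT//; have := qf n r dr; have := HB r dr.
    have := ler_distD (f r) (q n r) 0; rewrite !subr0.
    have : n.+1%:R^-1 <= 1 :> R by rewrite invf_le1 ?ltr0n// ler1n.
    move: (n.+1%:R^-1) => x; lra.
  - by move=> r r' dr dr'; rewrite !lT//; case: (Hq n) => _ [_ h]; exact: h.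
  - exact: H.
have cT : forall e : R, 0 < e -> exists N, forall n m p, (N <= n)%N -> (N <= m)%N -> cdisk p ->
    [/\ `|T n p - T m p| <= e, forall i, `|dd i (T n) p - dd i (T m) p| <= e
      & forall i j, `|dd i (dd j (T n)) p - dd i (dd j (T m)) p| <= e].
  move=> e e0; pose L : R := `|C (alpha / 2)| + 1.
  have L0 : 0 < L by rewrite ltr_wpDl.
  (* [s] will bound q n - q m, whose seminorm of exponent alpha is at most 2 M. Both [s] and the
     interpolated seminorm sqrt (4 s M) have to be at most e / (2 L), with L above the absolute
     value of the constant for [alpha / 2]. *)
  pose s := Num.min (e / L / 2) ((e / L / 2) ^+ 2 / (4 * (M + 1))).
  have eL : 0 < e / L / 2 by rewrite !divr_gt0.
  have M1 : 0 < 4 * (M + 1) by rewrite mulr_gt0//; lra.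
  have s0 : 0 < s by rewrite lt_min eL divr_gt0// exprn_gt0.
  have sM : Num.sqrt (2 * s * (2 * M)) <= e / L / 2.
    rewrite -[leRHS](ger0_norm (ltW eL)) -sqrtr_sqr; apply: ler_wsqrtr.
    have : s <= (e / L / 2) ^+ 2 / (4 * (M + 1)) by rewrite ge_min lexx orbT.
    by rewrite ler_pdivlMr//; lra.
  pose N := Num.Def.truncn (2 / s).
  have HN n : (N <= n)%N -> n.+1%:R^-1 <= s / 2.
    move=> Nn; rewrite -[leRHS]invrK lef_pV2 ?posrE ?invr_gt0 ?divr_gt0 ?ltr0n// invf_div.
    by apply/ltW/(lt_le_trans (truncnS_gt _)); rewrite ler_nat ltnS.
  exists N => n m p Nn Nm dp.
  have c2 k : Creg 2 (T k) by exact: rT base_ucontP.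
  have c1 k i : Creg 1 (dd i (T k)) by exact: C_dd.
  have LD r : cdisk r -> lap (fun p => T n p - T m p) r = q n r - q m r.
    by move=> dr; rewrite lapB// !lT.
  have bs r : cdisk r -> `|q n r - q m r| <= s.
    move=> dr; have := qf n r dr; have := qf m r dr; have := HN n Nn; have := HN m Nm.
    have := ler_distD (f r) (q n r) (q m r); rewrite (distrC (f r)).
    by move: (n.+1%:R^-1) (m.+1%:R^-1) => x y; lra.
  have [|||h1 h2 h3 _] := @schauder_bounds (alpha / 2) s (Num.sqrt (2 * s * (2 * M))) (fun p => T n p - T m p) a201 (regB bh2 (rT n _ 2 bh2) (rT m _ 2 bh2)).
  - by move=> r cr; rewrite !zT// subrr.
  - by move=> r dr; rewrite LD// bs.
  - move=> r r' dr dr'; rewrite !LD//.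
    apply: (holder_interpolation (f := fun p => q n p - q m p) a0 bs) => // x y dx dy.
    have -> : q n x - q m x - (q n y - q m y) = (q n x - q n y) - (q m x - q m y) by ring.
    apply: le_trans (ler_normB _ _) _.
    have [_ [_ h1]] := Hq n; have [_ [_ h2]] := Hq m.
    by have := h1 x y dx dy; have := h2 x y dx dy; lra.
  move: h1 h2 h3; set K' := `|C _| * _ => h1 h2 h3.
  have Ke : K' <= e.
    have : K' <= L * (s + Num.sqrt (2 * s * (2 * M))).
      by rewrite /K' ler_wpM2r// ?addr_ge0 ?sqrtr_ge0 ?ltW// /L; lra.
    have : s <= e / L / 2 by rewrite ge_min lexx.
    have eE : L * (e / L / 2 + e / L / 2) = e by field; rewrite gt_eqF.
    by move=> k1 k2; apply: le_trans k2 _; rewrite -[leRHS]eE ler_pM2l//; lra.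
  split.
  - by apply: le_trans Ke; exact: h1.
  - move=> i; apply: le_trans Ke; have := h2 i p dp.
    by rewrite ddB//; exact: C_le (c2 _).
  - move=> i j; apply: le_trans Ke; have := h3 i j p dp.
    rewrite (dd_ext i (f := dd j (fun p => T n p - T m p)) (f' := fun p => dd j (T n) p - dd j (T m) p))//.
    + by rewrite ddB.
    + by apply: C_dd; exact: (regB base_ucontP).
    + by move=> r dr; rewrite ddB//; exact: C_le (c2 _).
have [tau rt [Tt Htt]] := reg_uconv2 a01 (fun n => rT n _ 2 bh) cT hK.
exists tau; split => // p.
- move=> cp; apply/eqP; rewrite -normr_le0; apply/ler_addgt0Pr => e e0; rewrite add0r.
  have [N HN] := Tt e e0; have := HN N p (leqnn _) (circle_cdisk cp).
  by rewrite zT// sub0r normrN.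
- move=> dp; apply/eqP; rewrite -subr_eq0 -normr_le0; apply/ler_addgt0Pr => e e0; rewrite add0r.
  have e3 : 0 < e / 3 by rewrite divr_gt0.
  have [N1 H1] := Htt 0 0 _ e3; have [N2 H2] := Htt 1 1 _ e3.
  pose N3 := Num.Def.truncn (e / 3)^-1.
  pose N := maxn N1 (maxn N2 N3).
  have h1 := H1 N p (leq_maxl _ _) dp.
  have h2 := H2 N p (leq_trans (leq_maxl _ _) (leq_maxr _ _)) dp.
  have h3 := qf N p dp.
  have h4 : N.+1%:R^-1 <= e / 3.
    rewrite -[leRHS]invrK lef_pV2 ?posrE ?invr_gt0 ?ltr0n//.
    apply/ltW/(lt_le_trans (truncnS_gt _)); rewrite ler_nat ltnS.
    exact: leq_trans (leq_maxr _ _) (leq_maxr _ _).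
  have E : lap (T N) p = q N p by exact: lT.
  have -> : lap tau p - f p = (lap (T N) p - f p) - ((dd 0 (dd 0 (T N)) p - dd 0 (dd 0 tau) p) + (dd 1 (dd 1 (T N)) p - dd 1 (dd 1 tau) p)).
    by rewrite !lapE; ring.
  rewrite E; apply: le_trans (ler_normB _ _) _.
  have := ler_normD (dd 0 (dd 0 (T N)) p - dd 0 (dd 0 tau) p) (dd 1 (dd 1 (T N)) p - dd 1 (dd 1 tau) p).
  move: (N.+1%:R^-1) h3 h4 => x h3 h4; lra.
Qed.

End Dirichlet.

(** * Integrals over the disk *)

Section Integration.
Context {R : realType}.
Implicit Types (p q : R * R) (f g : R * R -> R) (i j : 'I_2) (n : nat).

Local Notation mu := (@lebesgue_measure R).
Local Notation mu2 := (mu \x mu)%E.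
Local Notation plane := (measurableTypeR R * measurableTypeR R)%type.
Local Notation C := (reg ucont).

Lemma measurable_harm f : harm f -> measurable_fun [set: plane] (f : plane -> measurableTypeR R).
Proof.
have m1 : measurable_fun [set: plane] ((fun p => p.1) : plane -> measurableTypeR R) by exact: measurable_fst.
have m2 : measurable_fun [set: plane] ((fun p => p.2) : plane -> measurableTypeR R) by exact: measurable_snd.
have mz s n : measurable_fun [set: plane] (zpow s n : plane -> measurableTypeR R).
  elim: n s => [|n IH] s; first exact: measurable_cst.
  apply: measurable_funD; first by apply: measurable_funM m1 (IH s).
  by apply: measurable_funM => //; apply: measurable_funM m2 (IH (~~ s)).
elim=> {f} [s j n|f g _ mf _ mg|c f _ mf].
- have mr : measurable_fun [set: plane] (@rho2 R : plane -> measurableTypeR R).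
    by apply: measurable_funD; [exact: measurable_funX 2 m1|exact: measurable_funX 2 m2].
  by apply: (@measurable_funM _ _ _ _ (fun p => rho2 p ^+ j) (zpow s n)); [exact: measurable_funX j mr|exact: mz].
- exact: measurable_funD.
- exact: measurable_funM.
Qed.

Lemma harm_rho2 : harm (@rho2 R).
Proof.
apply: harm_eq (harm_monom false 1 0) => p.
by rewrite /monom /= expr1 mulr1.
Qed.

Lemma measurable_disk : measurable (@disk R : set plane).
Proof.
have := measurable_harm harm_rho2.
move=> /(_ measurableT `]-oo, 1[%classic (measurable_itv _)); rewrite setTI.
by congr measurable; apply/seteqP; split => p /=; rewrite in_itv.
Qed.

Lemma mu2_disk : (mu2 (@disk R) < +oo)%E.
Proof.
pose I : set (measurableTypeR R) := `[-1, 1]%classic.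
apply: (@le_lt_trans _ _ (mu2 (I `*` I))).
  apply: le_measure; rewrite ?inE; first exact: measurable_disk.
    by apply: measurableX; exact: measurable_itv.
  move=> p /disk_cdisk dp /=; have := edist1 p 0; have := edist2 p 0.
  move/cdisk_edist0 : dp; rewrite /I /= !subr0 !in_itv /= -!ler_norml => h1 h2 h3.
  by split; lra.
rewrite [ltLHS]product_measure1E//; [|exact: measurable_itv..].
have E : mu I = (1 - -1)%:E.
  rewrite /I lebesgue_measure_itv /= lte_fin; case: ifP => // /negbT.
  by rewrite gtrN ?ltr01.
by change (mu I * mu I < +oo)%E; rewrite E -EFinM ltry.
Qed.

(** On the disk f is a pointwise limit of polynomials, by Bernstein approximation; its values
    elsewhere are arbitrary. *)
Lemma measurable_ucont f : ucont f -> measurable_fun (disk : set plane) (f : plane -> measurableTypeR R).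
Proof.
move=> cf.
have /choice[g Hg] : forall n, exists g : R * R -> R, harm g /\ forall p, cdisk p -> `|g p - f p| <= n.+1%:R^-1.
  by move=> n; have [g hg h] := harm_approx (e := n.+1%:R^-1) cf ltac:(by rewrite invr_gt0 ltr0n); exists g.
apply: (@measurable_fun_cvg _ _ _ _ (fun n => g n : plane -> R)).
  by move=> n; apply: measurable_funTS; apply: measurable_harm; case: (Hg n).
move=> p dp; apply/cvgrPdist_le => e e0.
exists (Num.Def.truncn e^-1) => // n /= hn.
have [_ /(_ p (disk_cdisk dp))] := Hg n; rewrite distrC => h; apply: le_trans h _.
rewrite -[leRHS]invrK lef_pV2 ?posrE ?invr_gt0 ?ltr0n//.
by apply/ltW/(lt_le_trans (truncnS_gt _)); rewrite ler_nat ltnS.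
Qed.

Lemma integrable_ucont f : ucont f -> mu2.-integrable disk (EFin \o f).
Proof.
move=> cf; apply: measurable_bounded_integrable.
- exact: measurable_disk.
- exact: mu2_disk.
- exact: measurable_ucont.
- have [B B0 HB] := cdisk_bounded (proj1 (ucont_within _) cf).
  exists B; split; first exact: num_real.
  by move=> x Bx p /disk_cdisk dp; apply: le_trans (HB p dp) (ltW Bx).
Qed.

Definition dint f := Rintegral mu2 disk f.

Lemma dintD f g : ucont f -> ucont g -> dint (fun p => f p + g p) = dint f + dint g.
Proof.
by move=> cf cg; apply: RintegralD; [exact: measurable_disk|exact: integrable_ucont..].
Qed.

Lemma dintZ (c : R) f : ucont f -> dint (fun p => c * f p) = c * dint f.
Proof.
by move=> cf; apply: RintegralZl; [exact: measurable_disk|exact: integrable_ucont].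
Qed.

Lemma dint_ext f g : (forall p, disk p -> f p = g p) -> dint f = dint g.
Proof. by move=> fg; apply: eq_Rintegral => p /set_mem; exact: fg. Qed.

Lemma dintB f g : ucont f -> ucont g -> dint (fun p => f p - g p) = dint f - dint g.
Proof.
by move=> cf cg; apply: RintegralB; [exact: measurable_disk|exact: integrable_ucont..].
Qed.

Lemma dint_ge0 f : (forall p, disk p -> 0 <= f p) -> 0 <= dint f.
Proof. by move=> f0; apply: Rintegral_ge0. Qed.

Lemma dint_abs f (B : R) : ucont f -> (forall p, cdisk p -> `|f p| <= B) ->
  `|dint f| <= B * fine (mu2 disk).
Proof.
move=> cf fB.
have cB : ucont (fun=> B : R) by case: (grad_cst B).
apply: le_trans (le_normr_Rintegral measurable_disk (integrable_ucont cf)) _.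
rewrite -Rintegral_cst; last exact: measurable_disk.
apply: le_Rintegral; [exact: measurable_disk| |exact: integrable_ucont|].
  apply: (integrable_ucont (f := fun p => `|f p|)).
  apply: (base_dom base_ucontP (L := 1) cf cf) => p q _ _.
  by rewrite mul1r; apply: le_trans (ler_dist_dist _ _) _; rewrite lerDl.
by move=> p /disk_cdisk; exact: fB.
Qed.

(** If h does not vanish at a point of the open disk, then h^2 stays above half its value there on a
    small square inside the disk, which has positive measure. The circle follows by density. *)
Lemma dint_sqr_eq0 (h : R * R -> R) : ucont h -> dint (fun p => h p ^+ 2) = 0 ->
  forall p, cdisk p -> h p = 0.
Proof.
move=> ch h0; have c0 : ucont (fun=> 0 : R) by case: (grad_cst (0 : R)).
apply: (ucont_eq_disk ch c0) => p dp; apply/eqP; apply: contraTT isT => hp.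
have ch2 : ucont (fun p => h p ^+ 2).
  by apply: ucont_ext (ucontM ch ch) => q _; rewrite expr2.
pose c := h p ^+ 2 / 2.
have hp0 : 0 < h p ^+ 2 by rewrite exprn_even_gt0.
have c_gt0 : 0 < c by rewrite divr_gt0.
have [d1 d10 H1] := ch2 c c_gt0.
have /nbhs_edist[d2 d20 H2] := disk_open dp.
pose d := Num.min d1 d2 / 4.
have d0 : 0 < d by rewrite divr_gt0// lt_min d10.
have dd1 : 4 * d <= d1 by rewrite mulrC divfK// ge_min lexx.
have dd2 : 4 * d <= d2 by rewrite mulrC divfK// ge_min lexx orbT.
pose I (x : R) : set (measurableTypeR R) := `[x - d, x + d]%classic.
have muI x : mu (I x) = (2 * d)%:E.
  rewrite /I lebesgue_measure_itv /= lte_fin ltrD2l gtrN// -EFinD; congr EFin; ring.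
pose box : set plane := I p.1 `*` I p.2.
have boxd q : box q -> edist p q < 4 * d.
  rewrite /box /I /= !in_itv /= => -[b1 b2].
  have : `|p.1 - q.1| <= d by rewrite ler_norml; lra.
  have : `|p.2 - q.2| <= d by rewrite ler_norml; lra.
  by have := edist_le_sum p q; lra.
have boxD : box `<=` (disk : set plane).
  by move=> q /boxd pq; apply: H2; lra.
have mbox : measurable box by apply: measurableX; exact: measurable_itv.
have E : (\int[mu2]_(q in disk) (h q ^+ 2)%:E = 0)%E.
  have := integrable_fin_num measurable_disk (integrable_ucont ch2).
  move=> /fineK <-; congr EFin; exact: h0.
have : (\int[mu2]_(q in box) c%:E <= \int[mu2]_(q in disk) (h q ^+ 2)%:E)%E.
  apply: (@le_trans _ _ (\int[mu2]_(q in box) (h q ^+ 2)%:E)%E).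
    apply: ge0_le_integral => //.
    - by move=> q _; rewrite lee_fin ltW.
    - apply: (measurable_funS measurable_disk boxD).
      by apply/measurable_EFinP; exact: measurable_ucont.
    - move=> q bq; rewrite lee_fin.
      have := H1 p q (disk_cdisk dp) (disk_cdisk (boxD q bq)) (lt_le_trans (boxd q bq) dd1).
      rewrite ler_norml /c; lra.
  apply: ge0_subset_integral => //; first exact: measurable_disk.
    by apply/measurable_EFinP; exact: measurable_ucont.
  by move=> q _; rewrite lee_fin sqr_ge0.
rewrite E integral_cst// => hle.
have : (mu2 box = (2 * d)%:E * (2 * d)%:E)%E.
  rewrite -{1}(muI p.1) -(muI p.2); apply: product_measure1E; exact: measurable_itv.
move=> eb; move: hle; rewrite [X in (_ * X)%E]eb -!EFinM lee_fin.
have cd0 : 0 < c * (2 * d * (2 * d)) by have d0' : 0 < 2 * d by [lra]; exact: mulr_gt0 c_gt0 (mulr_gt0 d0' d0').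
by move=> /(lt_le_trans cd0); rewrite ltxx.
Qed.

(** For a polynomial q close to h, orthogonality gives that the integral of h^2 is that of h (h -
    q), which is arbitrarily small. *)
Lemma weak_unique (h : R * R -> R) : ucont h ->
  (forall q : R * R -> R, harm q -> dint (fun p => h p * q p) = 0) ->
  forall p, cdisk p -> h p = 0.
Proof.
move=> ch H; apply: dint_sqr_eq0 => //.
apply/eqP; rewrite -normr_le0; apply/ler_addgt0Pr => e e0; rewrite add0r.
have [B B0 HB] := cdisk_bounded (proj1 (ucont_within _) ch).
pose V := fine (mu2 (@disk R)).
have V0 : 0 <= V by rewrite fine_ge0.
pose e' := e / ((B + 1) * (V + 1)).
have k0 : 0 < (B + 1) * (V + 1) by rewrite mulr_gt0//; lra.
have e'0 : 0 < e' by rewrite divr_gt0.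
have [q hq Hq] := harm_approx ch e'0.
have cq : ucont q by exact: (reg_harm 0 base_ucontP hq).
have chq : ucont (fun p => h p - q p).
  by have := @regB _ _ base_ucontP 0 h q ch cq.
have -> : dint (fun p => h p ^+ 2) = dint (fun p => h p * (h p - q p)).
  transitivity (dint (fun p => h p * (h p - q p)) + dint (fun p => h p * q p)).
    rewrite -dintD; [|exact: ucontM..].
    by apply: dint_ext => p _; ring.
  by rewrite (H q hq) addr0.
apply: (@le_trans _ _ (B * e' * V)).
  apply: dint_abs; first exact: ucontM.
  move=> p dp; rewrite normrM ler_pM//; first exact: HB.
  by rewrite distrC Hq.
have -> : e = (B + 1) * e' * (V + 1).
  by rewrite /e'; field; rewrite !gt_eqF//; lra.
have h1 : 0 <= e' * B by rewrite mulr_ge0// ltW.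
have h2 : 0 <= e' * V by rewrite mulr_ge0// ltW.
by clearbody e' V; lra.
Qed.

Lemma line_continuous i p (a b : R) g : ucont g ->
  (forall t, a <= t <= b -> cdisk (t *: dir i + p)) ->
  {within `[a, b], continuous (fun t : R => g (t *: dir i + p))}.
Proof.
move=> cg H; apply/subspace_continuousP => t; rewrite /= in_itv /= => th.
apply/cvgrPdist_le => e e0; have [d d0 Hd] := cg e e0.
apply/nbhs_ballP; exists d => //= s ts; rewrite in_itv/= => sh.
by apply: Hd; [exact: H|exact: H|rewrite edist_line].
Qed.

Lemma line_FTC i p (a b : R) F g : ucont F -> ucont g -> pderiv i F g -> a < b ->
  (forall t, a <= t <= b -> cdisk (t *: dir i + p)) ->
  (forall t, a < t < b -> disk (t *: dir i + p)) ->
  (\int[mu]_(t in `[a, b]) (g (t *: dir i + p)%R)%:E = (F (b *: dir i + p)%R)%:E - (F (a *: dir i + p)%R)%:E)%E.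
Proof.
move=> cF cg dF ab Hc Hd.
apply: (continuous_FTC2 (F := fun t => F (t *: dir i + p)) ab).
- exact: line_continuous.
- have /(continuous_within_itvP _ ab) [_ ca cb] := line_continuous cF Hc.
  split => // t; rewrite in_itv /= => th.
  by have [] := proj1 (is_derive_line _ _ _ _ _) (dF _ (Hd t th)).
- move=> t; rewrite in_itv /= => th; rewrite derive1E.
  by have [_ ->] := proj1 (is_derive_line _ _ _ _ _) (dF _ (Hd t th)).
Qed.

Lemma chord_integral i p (s : R) F g : ucont F -> ucont g -> pderiv i F g -> 0 < s ->
  (forall t, -s < t < s <-> disk (t *: dir i + p)) ->
  circle (s *: dir i + p) -> circle (- s *: dir i + p) ->
  (forall q, circle q -> F q = 0) ->
  (\int[mu]_t ((EFin \o g) \_ disk) ((t : R) *: dir i + p)%R = 0)%E.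
Proof.
move=> cF cg dF s0 Hd c1 c2 F0.
have Hc t : -s <= t <= s -> cdisk (t *: dir i + p).
  move=> /andP[]; rewrite le_eqVlt => /orP[/eqP <- _|t1]; first exact: circle_cdisk.
  rewrite le_eqVlt => /orP[/eqP ->|t2]; first exact: circle_cdisk.
  by apply/disk_cdisk/Hd; rewrite t1.
have ss : - s < s by lra.
transitivity (\int[mu]_(t in `](- s)%R, s[) (g (t *: dir i + p)%R)%:E)%E.
  rewrite [RHS]integral_mkcond; apply: eq_integral => t _ /=.
  rewrite /patch; case: ifPn => h.
    by rewrite mem_set //= in_itv /=; apply/Hd/set_mem.
  rewrite memNset //= in_itv /= => /Hd hd.
  by move/negP: h; apply; apply/mem_set.
have ml : measurable_fun (`[-s, s]%classic : set R) (fun t : R => g (t *: dir i + p)).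
  apply: subspace_continuous_measurable_fun; first exact: measurable_itv.
  exact: line_continuous.
rewrite -(integral_itv_bndoo true false); last first.
  apply/measurable_EFinP; apply: measurable_funS ml; first exact: measurable_itv.
  by apply: subset_itvW.
rewrite (line_FTC cF cg dF ss Hc) ?F0 ?subee// => t th.
exact/Hd.
Qed.

(** The divergence theorem for functions vanishing on the circle, where no boundary integral arises:
    Fubini reduces it to chords, and on each chord the fundamental theorem of calculus leaves the
    difference of two boundary values. *)
Lemma dint_dd i F : C 1 F -> (forall q, circle q -> F q = 0) -> dint (dd i F) = 0.
Proof.
move=> rF F0; have [cF cg dF] := C_grad rF.
have mG : mu2.-integrable setT ((EFin \o dd i F) \_ disk).
  by apply: (proj1 (integrable_mkcond _ measurable_disk)); exact: integrable_ucont.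
rewrite /dint /Rintegral integral_mkcond.
(* Here r is the coordinate that is constant along the line. For r^2 >= 1 the line misses the open
   disk; otherwise the chord has half-length sqrt (1 - r^2). *)
have chord (j : 'I_2) p (r : R) : (forall t : R, (t *: dir j + p).1 ^+ 2 + (t *: dir j + p).2 ^+ 2 = t ^+ 2 + r ^+ 2) ->
    i = j -> (\int[mu]_t ((EFin \o dd i F) \_ disk) ((t : R) *: dir j + p)%R = 0)%E.
  move=> E ij; rewrite -ij in E *.
  have [r1|r1] := ltP (r ^+ 2) 1; last first.
    rewrite -[RHS](integral0 mu [set: R]); apply: eq_integral => t _.
    rewrite /patch memNset// /disk /= E; have := sqr_ge0 t; lra.
  pose s := Num.sqrt (1 - r ^+ 2).
  have s2 : s ^+ 2 = 1 - r ^+ 2 by rewrite sqr_sqrtr// subr_ge0 ltW.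
  have s0 : 0 < s by rewrite sqrtr_gt0 subr_gt0.
  have key (t : R) : (`|t| < s) = (t ^+ 2 + r ^+ 2 < 1).
    by rewrite -ltr_sqr ?nnegrE ?(ltW s0)// s2 -normrX ger0_norm ?sqr_ge0// ltrBrDr.
  apply: (chord_integral cF (cg i) (dF i) s0) => //.
  - by move=> t; rewrite /disk /= E -ltr_norml key.
  - by rewrite /circle /= E; lra.
  - by rewrite /circle /= E sqrrN; lra.
case: (ord2P (Q := fun k => i = k -> fine (\int[mu2]_x ((EFin \o dd i F) \_ disk) x)%E = 0) _ _ i erefl) => // ij.
- rewrite -(integral21_prod_meas1 mG) (_ : (\int[_]_x _ = 0)%E)//.
  rewrite -[RHS](integral0 mu [set: R]); apply: eq_integral => v _; rewrite /fubini_G.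
  rewrite -(chord 0 (0, v) v _ ij); first by apply: eq_integral => t _; rewrite line0E addr0.
  by move=> t; rewrite line0E addr0.
- rewrite -(integral12_prod_meas1 mG) (_ : (\int[_]_x _ = 0)%E)//.
  rewrite -[RHS](integral0 mu [set: R]); apply: eq_integral => u _; rewrite /fubini_F.
  rewrite -(chord 1 (u, 0) u _ ij); first by apply: eq_integral => t _; rewrite line1E addr0.
  by move=> t; rewrite line1E addr0 addrC.
Qed.

End Integration.

(** * Higher regularity *)

Section Green.
Context {R : realType}.
Implicit Types (p q : R * R) (f g F G tau psi : R * R -> R) (i j : 'I_2) (n : nat).

Local Notation C := (reg ucont).

Lemma C_ucont m f : C m f -> ucont f. Proof. exact: (reg_ucont base_ucontP). Qed.

Lemma CM m f g : C m f -> C m g -> C m (fun p => f p * g p).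
Proof. exact: (regM base_ucontP). Qed.

Lemma CB m f g : C m f -> C m g -> C m (fun p => f p - g p).
Proof. exact: (regB base_ucontP). Qed.

Lemma CD m f g : C m f -> C m g -> C m (fun p => f p + g p).
Proof. exact: (regD base_ucontP). Qed.

Lemma C_lap m f : C m.+2 f -> C m (lap f).
Proof. exact: (reg_lap base_ucontP). Qed.

Lemma C_angular m f : C m.+1 f -> C m (angular f).
Proof. exact: (reg_angular base_ucontP). Qed.

Lemma dint_parts i F G : C 1 F -> C 1 G -> (forall q, circle q -> F q * G q = 0) ->
  dint (fun p => dd i F p * G p) = - dint (fun p => F p * dd i G p).
Proof.
move=> cF cG FG0; have := dint_dd i (CM cF cG) FG0.
rewrite (dint_ext (g := fun p => F p * dd i G p + dd i F p * G p)); last first.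
  by move=> p /disk_cdisk dp; rewrite ddM// [G p * _]mulrC.
rewrite dintD; first by move/eqP; rewrite addrC addr_eq0 => /eqP.
- by apply: ucontM; apply: (@C_ucont 0); [exact: C_le cF|exact: C_dd].
- by apply: ucontM; apply: (@C_ucont 0); [exact: C_dd|exact: C_le cG].
Qed.

(** The rotation field is divergence-free: u F_v - v F_u = (u F)_v - (v F)_u. *)
Lemma dint_angular F : C 1 F -> (forall q, circle q -> F q = 0) -> dint (angular F) = 0.
Proof.
move=> cF F0; have cu := @C_u R 1; have cv := @C_v R 1.
have h1 := dint_dd 1 (CM cu cF) (fun q cq => etrans (congr1 _ (F0 q cq)) (mulr0 _)).
have h2 := dint_dd 0 (CM cv cF) (fun q cq => etrans (congr1 _ (F0 q cq)) (mulr0 _)).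
rewrite -[RHS](subrr 0) -{1}h1 -h2 -dintB; last 2 first.
- by apply: (@C_ucont 0); apply: C_dd; exact: CM.
- by apply: (@C_ucont 0); apply: C_dd; exact: CM.
apply: dint_ext => p /disk_cdisk dp.
by rewrite !ddM// dd_u// dd_v// /angular /=; ring.
Qed.

Lemma dint_angular_parts F G : C 1 F -> C 1 G -> (forall q, circle q -> F q * G q = 0) ->
  dint (fun p => angular F p * G p) = - dint (fun p => F p * angular G p).
Proof.
move=> cF cG FG0; have := dint_angular (CM cF cG) FG0.
rewrite (dint_ext (g := fun p => F p * angular G p + angular F p * G p)); last first.
  by move=> p /disk_cdisk dp; rewrite angularM// [G p * _]mulrC.
rewrite dintD; first by move/eqP; rewrite addrC addr_eq0 => /eqP.
- by apply: ucontM; apply: (@C_ucont 0); [exact: C_le cF|exact: C_angular].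
- by apply: ucontM; apply: (@C_ucont 0); [exact: C_angular|exact: C_le cG].
Qed.

(** The boundary condition is that the field tau grad psi - psi grad tau vanishes on the circle. It
    covers the two situations met below: both functions vanish there, or one of them vanishes
    together with its gradient. *)
Lemma green tau psi : C 2 tau -> C 2 psi ->
  (forall i q, circle q -> tau q * dd i psi q - psi q * dd i tau q = 0) ->
  dint (fun p => tau p * lap psi p) = dint (fun p => psi p * lap tau p).
Proof.
move=> ct cp H; have c1t := C_le (leqnSn 1) ct; have c1p := C_le (leqnSn 1) cp.
have cF i : C 1 (fun p => tau p * dd i psi p - psi p * dd i tau p).
  by apply: CB; apply: CM => //; exact: C_dd.
have u f g : C 2 f -> C 2 g -> ucont (fun p => f p * lap g p).
  by move=> cf cg; apply: ucontM; [exact: C_ucont cf|apply: (@C_ucont 0); exact: C_lap].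
apply/eqP; rewrite -subr_eq0 -dintB; [|exact: u..].
apply/eqP; transitivity (dint (dd 0 (fun p => tau p * dd 0 psi p - psi p * dd 0 tau p)) +
  dint (dd 1 (fun p => tau p * dd 1 psi p - psi p * dd 1 tau p))); last first.
  by rewrite !dint_dd ?addr0// => q; exact: H.
rewrite -dintD; [|by apply: (@C_ucont 0); exact: C_dd..].
apply: dint_ext => p /disk_cdisk dp.
have E i : dd i (fun p => tau p * dd i psi p - psi p * dd i tau p) p =
    tau p * dd i (dd i psi) p - psi p * dd i (dd i tau) p.
  rewrite ddB//; [|by apply: CM => //; exact: C_dd..].
  by rewrite !ddM//; [ring|exact: C_dd..].
by rewrite !E /lap; ring.
Qed.

Lemma lap_dd i psi p : C 3 psi -> cdisk p -> dd i (lap psi) p = lap (dd i psi) p.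
Proof.
move=> c3 dp; have c2 k : C 2 (dd k psi) by exact: C_dd.
have c1 k l : C 1 (dd k (dd l psi)) by apply: C_dd; exact: c2.
have sw k l q : cdisk q -> dd k (dd l psi) q = dd l (dd k psi) q.
  have c2p : C 2 psi by exact: C_le c3.
  by move: k l; apply: ord2P; apply: ord2P => // dq; [|symmetry]; exact: (ddC base_ucontP c2p dq).
have sw2 k l f q : C 2 f -> cdisk q -> dd k (dd l f) q = dd l (dd k f) q.
  by move=> c2f; move: k l; apply: ord2P; apply: ord2P => // dq; [|symmetry]; exact: (ddC base_ucontP c2f dq).
have E k : dd i (dd k (dd k psi)) p = dd k (dd k (dd i psi)) p.
  rewrite (sw2 i k (dd k psi) p (c2 k) dp); apply: dd_ext dp; first exact: c1.
  by move=> q dq; exact: sw.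
by rewrite /lap ddD// !E.
Qed.

End Green.

(** * Gain of derivatives up to the circle *)

Section Regularity.
Context {R : realType}.
Implicit Types (p q : R * R) (f g tau psi : R * R -> R) (i j : 'I_2) (n : nat).
Variable C0 : R -> R.
Hypothesis hC : forall alpha : R, 0 < alpha < 1 ->
  forall tau : R * R -> R, holder 2 alpha tau ->
    (forall p, circle p -> tau p = 0) ->
    (holder_norm 2 alpha tau <= (C0 alpha)%:E * holder_norm 0 alpha (laplacian tau))%E.

Local Notation C := (reg ucont).

(* A weak form of "h is harmonic and vanishes on the circle". *)
Lemma weak_dirichlet (h : R * R -> R) : ucont h ->
  (forall psi psi' : R * R -> R, (forall m, C m psi /\ C m psi') ->
     (forall p, circle p -> psi p = 0 /\ psi' p = 0) ->
     (forall p, cdisk p -> angular psi p = psi' p) ->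
     (forall p, cdisk p -> lap psi' p = angular (lap psi) p) ->
     dint (fun p => h p * lap psi p) = 0) ->
  forall p, cdisk p -> h p = 0.
Proof.
move=> ch H; apply: weak_unique => // q hq.
have [psi [psi' [r z l t l']]] := harm_solve hq.
rewrite (dint_ext (g := fun p => h p * lap psi p)); last first.
  by move=> p /disk_cdisk dp; rewrite l.
apply: (H psi psi') => //; first by move=> m; exact: r base_ucontP.
move=> p dp; rewrite l'//; apply: angular_ext => //; first exact: (reg_harm 1 base_ucontP hq).
by move=> x dx; rewrite l.
Qed.

(** The angular derivative of tau is only known to be C^1, so it is tested against Lap psi. Angular
    derivatives can be integrated by parts and keep zero boundary values: both sides become minus
    the integral of psi' f, through tau Lap psi' for the left and psi Lap sigma for the right. *)
Lemma dirichlet_angular f tau sigma : C 1 f -> C 2 tau -> C 2 sigma ->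
  (forall p, circle p -> tau p = 0) -> (forall p, circle p -> sigma p = 0) ->
  (forall p, cdisk p -> lap tau p = f p) ->
  (forall p, cdisk p -> lap sigma p = angular f p) ->
  forall p, cdisk p -> angular tau p = sigma p.
Proof.
move=> cf ct cs zt zs lt ls.
have ca : C 1 (angular tau) by exact: C_angular.
suff H p : cdisk p -> angular tau p - sigma p = 0.
  by move=> p /H /eqP; rewrite subr_eq0 => /eqP.
move: p; apply: weak_dirichlet.
  by apply: (C_ucont (m := 1)); apply: CB => //; exact: C_le cs.
move=> psi psi' r z tp lp.
have cp m : C m psi by case: (r m). have cp' m : C m psi' by case: (r m).
have zp q : circle q -> psi q = 0 by case/z.
have zp' q : circle q -> psi' q = 0 by case/z.
have c1t := C_le (leqnSn 1) ct; have c1s := C_le (leqnSn 1) cs.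
rewrite (dint_ext (g := fun p => angular tau p * lap psi p - sigma p * lap psi p)); last first.
  by move=> p _; rewrite mulrBl.
have ul : ucont (lap psi) by apply: (C_ucont (m := 0)); exact: C_lap.
rewrite dintB; last 2 first.
- by apply: ucontM => //; exact: C_ucont ca.
- by apply: ucontM => //; exact: C_ucont cs.
rewrite dint_angular_parts//; [|exact: C_lap|by move=> q cq; rewrite zt// mul0r].
rewrite (dint_ext (f := fun p => tau p * angular (lap psi) p) (g := fun p => tau p * lap psi' p)); last first.
  by move=> p /disk_cdisk dp; rewrite lp.
rewrite green//; last by move=> i q cq; rewrite zt// zp'// !mul0r subr0.
rewrite (green cs (cp 2)); last by move=> i q cq; rewrite zs// zp// !mul0r subr0.
rewrite (dint_ext (f := fun p => psi p * lap sigma p) (g := fun p => psi p * angular f p)); last first.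
  by move=> p /disk_cdisk dp; rewrite ls.
rewrite -[X in _ - X]opprK -dint_angular_parts//; last by move=> q cq; rewrite zp// mul0r.
rewrite opprK addrC (dint_ext (f := fun p => angular psi p * f p) (g := fun p => psi' p * lap tau p)) ?subrr//.
by move=> p /disk_cdisk dp; rewrite lt// tp.
Qed.

(** The same duality with a Cartesian derivative, which does not keep the zero boundary values of
    psi. The loss is made up for by w, which vanishes to first order on the circle, so that Green's
    formula holds for w and the derivative of psi. *)
Lemma dirichlet_cutoff i g w sigma : C 1 g -> C 2 w -> C 2 sigma ->
  (forall p, circle p -> w p = 0) -> (forall j p, circle p -> dd j w p = 0) ->
  (forall p, circle p -> sigma p = 0) ->
  (forall p, cdisk p -> lap w p = g p) ->
  (forall p, cdisk p -> lap sigma p = dd i g p) ->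
  forall p, cdisk p -> dd i w p = sigma p.
Proof.
move=> cg cw cs zw zdw zs lw ls.
have ca : C 1 (dd i w) by exact: C_dd.
suff H p : cdisk p -> dd i w p - sigma p = 0.
  by move=> p /H /eqP; rewrite subr_eq0 => /eqP.
move: p; apply: weak_dirichlet.
  by apply: (C_ucont (m := 1)); apply: CB => //; exact: C_le cs.
move=> psi psi' r z _ _.
have cp m : C m psi by case: (r m).
have zp q : circle q -> psi q = 0 by case/z.
have c1w := C_le (leqnSn 1) cw; have c1s := C_le (leqnSn 1) cs.
rewrite (dint_ext (g := fun p => dd i w p * lap psi p - sigma p * lap psi p)); last first.
  by move=> p _; rewrite mulrBl.
have ul : ucont (lap psi) by apply: (C_ucont (m := 0)); exact: C_lap.
rewrite dintB; last 2 first.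
- by apply: ucontM => //; exact: C_ucont ca.
- by apply: ucontM => //; exact: C_ucont cs.
rewrite dint_parts//; [|exact: C_lap|by move=> q cq; rewrite zw// mul0r].
rewrite (dint_ext (f := fun p => w p * dd i (lap psi) p) (g := fun p => w p * lap (dd i psi) p)); last first.
  by move=> p /disk_cdisk dp; rewrite lap_dd.
rewrite green//; [|exact: C_dd|by move=> j q cq; rewrite zw// zdw// mul0r mulr0 subr0].
rewrite (green cs (cp 2)); last by move=> j q cq; rewrite zs// zp// !mul0r subr0.
rewrite (dint_ext (f := fun p => psi p * lap sigma p) (g := fun p => psi p * dd i g p)); last first.
  by move=> p /disk_cdisk dp; rewrite ls.
rewrite -[X in _ - X]opprK -dint_parts//; last by move=> q cq; rewrite zp// mul0r.
rewrite opprK addrC (dint_ext (f := fun p => dd i psi p * g p) (g := fun p => dd i psi p * lap w p)) ?subrr//.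
by move=> p /disk_cdisk dp; rewrite lw.
Qed.

Lemma reg_of_dd P m f : base P -> C 1 f -> (forall i, reg P m (dd i f)) -> reg P m.+1 f.
Proof. by move=> bP cf H; exists (fun i => dd i f) => //; exact: C_grad. Qed.

(* The angular derivative of tau and the first derivatives of (1 - r^2) tau
   vanish on the circle and solve Dirichlet problems, hence gain regularity; the
   former and f control r^2 D^2 tau, the latter control (1 - r^2) D^2 tau. *)
Lemma dirichlet_reg (alpha : R) m f : 0 < alpha < 1 -> reg (hol alpha) m f -> exists tau,
  [/\ reg (hol alpha) m.+2 tau, forall p, circle p -> tau p = 0
    & forall p, cdisk p -> lap tau p = f p].
Proof.
move=> a01; have bh := base_hol a01.
elim: m f => [|m IH] f rf; first exact: (dirichlet_hol hC).
have toC k g : reg (hol alpha) k g -> C k g by exact: reg_ucontW.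
have [tau [rt zt lt]] := IH f (regW bh rf).
have c2t : C 2 tau by apply: (C_le (m := m.+2)); [|exact: toC].
have c1t := C_le (leqnSn 1) c2t.
have c1d i : C 1 (dd i tau) by exact: C_dd.
have c1f : C 1 f by apply: (C_le (m := m.+1)); [|exact: toC].
have rd i : reg (hol alpha) m.+1 (dd i tau) by exact: reg_dd.
have [sigma [rs zs ls]] := IH (angular f) (reg_angular bh rf).
have c2s : C 2 sigma by apply: (C_le (m := m.+2)); [|exact: toC].
have ta := dirichlet_angular c1f c2t c2s zt zs lt ls.
pose chi p : R := 1 - rho2 p.
have rchi P k : base P -> reg P k chi.
  by move=> bP; apply: regB => //; [exact: reg_cst|exact: reg_rho2].
have cchi k : C k chi by exact: rchi base_ucontP.
have dchi i p : cdisk p -> dd i chi p = - (2 * (if i == 0 then p.1 else p.2)).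
  move=> dp; rewrite ddB//; [|exact: (reg_cst base_ucontP)|exact: C_rho2].
  by rewrite dd_cst// dd_rho2// sub0r.
have lchi p : cdisk p -> lap chi p = - 4.
  move=> dp; rewrite lapB//; [|exact: (reg_cst base_ucontP)|exact: C_rho2].
  rewrite lap_rho2// /lap (dd_ext2 0 0 (f := fun=> 1) (f' := fun=> 1))//; last exact: (reg_cst base_ucontP).
  have E i : dd i (dd i (fun=> 1 : R)) p = 0.
    rewrite -[RHS](dd_cst i (0 : R) dp); apply: dd_ext dp.
      by apply: C_dd; exact: (reg_cst base_ucontP).
    by move=> q dq; rewrite dd_cst.
  by rewrite !E; ring.
pose w p := chi p * tau p.
(* The Laplacian of [w] by the product rule, with Lap chi = -4 and grad chi = -2 (u, v). It contains
   only first derivatives of tau, hence is as regular as f. *)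
pose g p := chi p * f p + tau p * -4 + 2 * (- (2 * p.1) * dd 0 tau p + - (2 * p.2) * dd 1 tau p).
have chi0 p : circle p -> chi p = 0 by rewrite /circle /= /chi /rho2 => ->; rewrite subrr.
have rw : reg (hol alpha) m.+2 w by apply: regM => //; exact: rchi.
have c2w : C 2 w by apply: CM.
have dw i p : cdisk p -> dd i w p = chi p * dd i tau p + tau p * dd i chi p.
  by move=> dp; rewrite ddM.
have lw p : cdisk p -> lap w p = g p.
  by move=> dp; rewrite lapM// lt// lchi// !dchi.
have rg : reg (hol alpha) m.+1 g.
  apply: regD => //; [apply: regD => //; apply: regM => //|apply: regZ => //; apply: regD => //; apply: regM => //].
  - exact: rchi.
  - exact: (reg_le bh (m := m.+2)).
  - exact: reg_cst.
  - by apply: regN => //; apply: regZ => //; exact: reg_u.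
  - by apply: regN => //; apply: regZ => //; exact: reg_v.
have c1g : C 1 g by apply: (C_le (m := m.+1)); [|exact: toC].
have rdw i : reg (hol alpha) m.+2 (dd i w).
  have [si [rsi zsi lsi]] := IH (dd i g) (reg_dd i bh rg).
  have c2si : C 2 si by apply: (C_le (m := m.+2)); [|exact: toC].
  apply: (reg_ext bh _ rsi) => p dp; symmetry.
  apply: (dirichlet_cutoff c1g c2w c2si _ _ zsi lw lsi dp).
    by move=> q cq; rewrite /w chi0// mul0r.
  by move=> j q cq; rewrite dw ?chi0 ?zt ?mul0r ?addr0//; exact: circle_cdisk.
have rang : reg (hol alpha) m.+2 (angular tau).
  by apply: (reg_ext bh _ rs) => p dp; rewrite ta.
(* The gradient of the angular derivative, freed of first-order terms and with tau_vv eliminated by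
   the equation: A = u tau_uv - v tau_uu and B = u tau_uu + v tau_uv. This linear system in tau_uu,
   tau_uv has determinant r^2 up to sign. *)
pose A p := dd 0 (angular tau) p - dd 1 tau p.
pose B p := p.1 * f p - (dd 1 (angular tau) p + dd 0 tau p).
have rA : reg (hol alpha) m.+1 A by apply: regB => //; exact: reg_dd.
have rB : reg (hol alpha) m.+1 B.
  by apply: regB => //; [apply: regM => //; exact: reg_u|apply: regD => //; exact: reg_dd].
have cu := @C_u R 1; have cv := @C_v R 1.
have dang i p : cdisk p -> dd i (angular tau) p =
    p.1 * dd i (dd 1 tau) p + dd 1 tau p * (i == 0)%:R - (p.2 * dd i (dd 0 tau) p + dd 0 tau p * (i == 1)%:R).
  by move=> dp; rewrite ddB ?ddM ?dd_u ?dd_v//; exact: CM.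
have sw p : cdisk p -> dd 0 (dd 1 tau) p = dd 1 (dd 0 tau) p by exact: (ddC base_ucontP c2t).
have AE p : cdisk p -> A p = p.1 * dd 1 (dd 0 tau) p - p.2 * dd 0 (dd 0 tau) p.
  by move=> dp; rewrite /A dang// sw//=; ring.
have BE p : cdisk p -> B p = p.1 * dd 0 (dd 0 tau) p + p.2 * dd 1 (dd 0 tau) p.
  by move=> dp; rewrite /B dang// -lt// /lap /=; ring.
have rr i j : reg (hol alpha) m.+1 (fun p => rho2 p * dd i (dd j tau) p).
  have r00 : reg (hol alpha) m.+1 (fun p => rho2 p * dd 0 (dd 0 tau) p).
    apply: (reg_ext bh (f := fun p => p.1 * B p - p.2 * A p)).
      by move=> p dp; rewrite AE// BE// /rho2; ring.
    by apply: regB => //; apply: regM => //; [exact: reg_u|exact: reg_v].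
  have r10 : reg (hol alpha) m.+1 (fun p => rho2 p * dd 1 (dd 0 tau) p).
    apply: (reg_ext bh (f := fun p => p.1 * A p + p.2 * B p)).
      by move=> p dp; rewrite AE// BE// /rho2; ring.
    by apply: regD => //; apply: regM => //; [exact: reg_u|exact: reg_v].
  move: i j; apply: ord2P; apply: ord2P => //.
    by apply: (reg_ext bh _ r10) => p dp; rewrite sw.
  apply: (reg_ext bh (f := fun p => rho2 p * f p - rho2 p * dd 0 (dd 0 tau) p)).
    by move=> p dp; rewrite -lt// /lap; ring.
  by apply: regB => //; apply: regM => //; exact: reg_rho2.
have rc i j : reg (hol alpha) m.+1 (fun p => chi p * dd i (dd j tau) p).
  apply: (reg_ext bh (f := fun p => dd i (dd j w) p - dd j tau p * dd i chi p -
      (tau p * dd i (dd j chi) p + dd j chi p * dd i tau p))).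
    move=> p dp.
    have -> : dd i (dd j w) p = chi p * dd i (dd j tau) p + dd j tau p * dd i chi p +
        (tau p * dd i (dd j chi) p + dd j chi p * dd i tau p).
      rewrite (dd_ext i (f := dd j w) (f' := fun p => chi p * dd j tau p + tau p * dd j chi p))//; last first.
      - by move=> q dq; rewrite dw.
      - exact: C_dd.
      rewrite ddD ?ddM//; [exact: C_dd|exact: CM|apply: CM => //; exact: C_dd].
    ring.
  have rdc k : reg (hol alpha) m.+2 (dd k chi) by apply: reg_dd => //; exact: rchi.
  have rdcc k l : reg (hol alpha) m.+1 (dd k (dd l chi)) by exact: reg_dd.
  have rt1 : reg (hol alpha) m.+1 tau by exact: regW.
  have rdc1 k : reg (hol alpha) m.+1 (dd k chi) by exact: regW.
  by do ?[apply: regB => //|apply: regD => //|apply: regM => //]; exact: reg_dd.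
exists tau; split => //.
apply: reg_of_dd => // j; apply: reg_of_dd => // i.
(* The weights sum to 1: [rho2] is harmless near the circle, [chi] near the centre. *)
apply: (reg_ext bh (f := fun p => chi p * dd i (dd j tau) p + rho2 p * dd i (dd j tau) p)).
  by move=> p _; rewrite /chi; ring.
exact: regD.
Qed.

End Regularity.

(** * Curl-free fields *)

Section Poincare.
Context {R : realType}.
Implicit Types (p q : R * R) (f g : R * R -> R) (i j : 'I_2).

Local Notation mu := (@lebesgue_measure R).
Local Notation C := (reg ucont).

(** Continuous partial derivatives give directional ones: the step h v is split into a vertical and
    a horizontal move, each estimated by the mean value theorem. *)
Lemma is_derive_dir f q (v : R * R) : C 1 f -> disk q ->
  is_derive q v f (v.1 * dd 0 f q + v.2 * dd 1 f q).
Proof.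
move=> cf dq; have [uf ug df] := C_grad cf.
apply: is_derive_eps => e e0.
pose k := `|v.1| + `|v.2| + 1.
have k0 : 0 < k by rewrite ltr_wpDl ?addr_ge0.
have e1 : 0 < e / k by rewrite divr_gt0.
have [d0 d00 H0] := ug 0 _ e1; have [d1 d10 H1] := ug 1 _ e1.
have /nbhs_edist[d2 d20 H2] := disk_open dq.
pose d := Num.min d0 (Num.min d1 d2).
have dp : 0 < d by rewrite !lt_min d00 d10.
have ld0 : d <= d0 by rewrite ge_min lexx.
have ld1 : d <= d1 by rewrite !ge_min lexx orbT.
have ld2 : d <= d2 by rewrite !ge_min lexx !orbT.
exists (d / k); first by rewrite divr_gt0.
move=> h; rewrite ltr_pdivlMr// => hk.
have near (a b : R) : `|a| <= `|h| * `|v.1| -> `|b| <= `|h| * `|v.2| ->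
    edist q (a *: dir 0 + (b *: dir 1 + q)) < d.
  move=> ha hb; apply: le_lt_trans (edist_triangle _ (b *: dir 1 + q) _) _.
  rewrite !edist_line0; apply: le_lt_trans hk; rewrite /k; have := normr_ge0 h; lra.
have z0 (x : R) : `|0 : R| <= `|h| * `|x| by rewrite normr0 mulr_ge0.
have in_disk (a b : R) : `|a| <= `|h| * `|v.1| -> `|b| <= `|h| * `|v.2| ->
    disk (a *: dir 0 + (b *: dir 1 + q)).
  by move=> ha hb; apply: H2; apply: lt_le_trans (near _ _ ha hb) ld2.
pose x := (h * v.2) *: dir 1 + q.
have dx : disk x.
  by have := in_disk 0 (h * v.2) (z0 _); rewrite normrM lexx scale0r add0r; apply.
have -> : h *: v + q = (h * v.1) *: dir 0 + x.
  rewrite /x; case: (v) (q) => a b [c d']; rewrite line1E line0E.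
  by rewrite /= /GRing.scale.
have B0 : `|f ((h * v.1) *: dir 0 + x) - f x - h * v.1 * dd 0 f q| <= e / k * `|h * v.1|.
  apply: (line_bound uf (df 0) dx) => t; rewrite normrM => ht.
    by apply: in_disk => //; rewrite normrM.
  have b2 : `|h * v.2| <= `|h| * `|v.2| by rewrite normrM.
  rewrite distrC; apply: H0; [exact: disk_cdisk|exact/disk_cdisk/in_disk|].
  exact: lt_le_trans (near _ _ ht b2) ld0.
have B1 : `|f x - f q - h * v.2 * dd 1 f q| <= e / k * `|h * v.2|.
  apply: (line_bound uf (df 1) dq) => t; rewrite normrM => ht.
    by have := in_disk 0 t (z0 _) ht; rewrite scale0r add0r.
  have := near 0 t (z0 _) ht; have := in_disk 0 t (z0 _) ht; rewrite scale0r add0r => b1 b2.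
  rewrite distrC; apply: H1; [exact: disk_cdisk|exact/disk_cdisk|].
  exact: lt_le_trans b2 ld1.
have -> : f ((h * v.1) *: dir 0 + x) - f q - h * (v.1 * dd 0 f q + v.2 * dd 1 f q) =
  (f ((h * v.1) *: dir 0 + x) - f x - h * v.1 * dd 0 f q) + (f x - f q - h * v.2 * dd 1 f q) by ring.
apply: le_trans (ler_normD _ _) _; apply: le_trans (lerD B0 B1) _.
rewrite !normrM.
have -> : e * `|h| = e / k * (`|h| * `|v.1|) + e / k * (`|h| * `|v.2|) + e / k * `|h|.
  have -> : e / k * (`|h| * `|v.1|) + e / k * (`|h| * `|v.2|) + e / k * `|h| = e / k * `|h| * k.
    by transitivity (e / k * `|h| * (`|v.1| + `|v.2| + 1)); [ring|].
  by field; rewrite gt_eqF.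
by rewrite lerDl mulr_ge0// ltW.
Qed.

Local Notation int01 f := (Rintegral mu `[0, 1]%classic f).

Lemma integrable01 (f : R -> R) : {within `[0, 1], continuous f} ->
  mu.-integrable `[0, 1]%classic (EFin \o f).
Proof.
by move=> cf; apply: continuous_compact_integrable => //; exact: segment_compact.
Qed.

Lemma int01_cst (c : R) : int01 (fun=> c) = c.
Proof.
rewrite Rintegral_cst//.
rewrite [X in fine X](_ : _ = 1%E) ?mulr1//.
by rewrite [LHS]lebesgue_measure_itv /= lte_fin ltr01 oppr0 adde0.
Qed.

Lemma int01_close (f g : R -> R) (e : R) : {within `[0, 1], continuous f} -> {within `[0, 1], continuous g} ->
  (forall s, 0 <= s <= 1 -> `|f s - g s| <= e) -> `|int01 f - int01 g| <= e.
Proof.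
move=> cf cg H; rewrite -RintegralB//; [|exact: integrable01..].
have cfg : {within `[0, 1], continuous (fun s => f s - g s)}.
  by move=> x; apply: continuousB; [exact: cf|exact: cg].
apply: le_trans (le_normr_Rintegral _ (integrable01 cfg)) _ => //.
rewrite -[leRHS]int01_cst; apply: le_Rintegral => //.
- by apply: integrable_norm; exact: integrable01.
- by apply: integrable01; apply: continuous_subspaceT => x; exact: cvg_cst.
Qed.

Lemma ray_continuous f p : ucont f -> cdisk p ->
  {within `[0, 1], continuous (fun s : R => f (s *: p))}.
Proof.
move=> cf dp; apply/subspace_continuousP => t; rewrite /= in_itv /= => th.
apply/cvgrPdist_le => e e0; have [d d0 Hd] := cf e e0.
apply/nbhs_ballP; exists d => //= s ts; rewrite in_itv/= => sh.
apply: Hd; [exact: cdisk_dil|exact: cdisk_dil|].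
have -> : edist (t *: p) (s *: p) = `|t - s| * edist p 0.
  case: (p) => a b; rewrite /edist /= /GRing.scale /= !subr0 -!mulrBl !exprMn -mulrDr.
  by rewrite sqrtrM ?sqr_ge0// sqrtr_sqr.
by move/cdisk_edist0 : dp => dp; apply: le_lt_trans ts; rewrite ler_piMr.
Qed.

(** The potential is the integral of the field along the ray from the centre, f(p) = int_0^1 p . F(s
    p) ds. It is differentiated under the integral sign. *)
Lemma poincare (F : 'I_2 -> R * R -> R) : (forall i, C 1 (F i)) ->
  (forall p, cdisk p -> dd 1 (F 0) p = dd 0 (F 1) p) -> exists f, grad f F.
Proof.
move=> cF curl.
pose Phi (s : R) p := p.1 * F 0 (s *: p) + p.2 * F 1 (s *: p).
have cFs i s : 0 <= s <= 1 -> C 1 (fun p => F i (s *: p)).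
  by move=> s01; exact: (reg_dil base_ucontP s01 (cF i)).
have cu := @C_u R 1; have cv := @C_v R 1.
have cPhi s : 0 <= s <= 1 -> C 1 (Phi s).
  by move=> s01; apply: CD; apply: CM => //; exact: cFs.
have cray p : cdisk p -> {within `[0, 1], continuous (Phi^~ p)}.
  move=> dp; apply/subspace_continuousP => t ht.
  have c i := proj1 (subspace_continuousP _ _) (ray_continuous (C_ucont (cF i)) dp) t ht.
  by apply: cvgD; apply: cvgM (c _); exact: cvg_cst.
have unit1 p : cdisk p -> `|p.1| <= 1 /\ `|p.2| <= 1.
  move=> dp; have := edist1 p 0; have := edist2 p 0; rewrite /= !subr0.
  by move/cdisk_edist0 : dp; lra.
have [B B0 HB] : exists2 B : R, 0 <= B & forall p, cdisk p ->
    [/\ forall i, `|F i p| <= B & forall i j, `|dd i (F j) p| <= B].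
  have bd g : ucont g -> exists2 M : R, 0 <= M & forall p, cdisk p -> `|g p| <= M.
    by move=> /ucont_within; exact: cdisk_bounded.
  have ud i j : ucont (dd i (F j)) by apply: (C_ucont (m := 0)); exact: C_dd.
  have [a a0 ha] := bd _ (C_ucont (cF 0)); have [b b0 hb] := bd _ (C_ucont (cF 1)).
  have [c c0 hc] := bd _ (ud 0 0); have [d d0 hd] := bd _ (ud 0 1).
  have [e e0 he] := bd _ (ud 1 0); have [k k0 hk] := bd _ (ud 1 1).
  exists (a + b + (c + d) + (e + k)); first by rewrite !addr_ge0.
  move=> p dp; have := ha p dp; have := hb p dp; have := hc p dp; have := hd p dp.
  have := he p dp; have := hk p dp => *.
  split; first by apply: ord2P; lra.
  by apply: ord2P; apply: ord2P; lra.
have ddPhi i s p : 0 <= s <= 1 -> cdisk p -> dd i (Phi s) p =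
    p.1 * (s * dd i (F 0) (s *: p)) + F 0 (s *: p) * (i == 0)%:R +
    (p.2 * (s * dd i (F 1) (s *: p)) + F 1 (s *: p) * (i == 1)%:R).
  move=> s01 dp; have cs j := cFs j s s01.
  rewrite ddD ?ddM ?dd_u ?dd_v//; try exact: CM.
  by rewrite (dd_grad i (grad_dil s01 (C_grad (cF 0))) dp) (dd_grad i (grad_dil s01 (C_grad (cF 1))) dp).
pose f p := int01 (Phi^~ p).
exists f; split; last 2 first.
- by move=> i; exact: C_ucont (cF i).
- move=> i p dp; apply: (proj2 (is_derive_line0 _ _ _ _)).
  have /nbhs_edist[d d0 Hd] := disk_open dp.
  have Hx (x : R) : `]-d, d[%classic x -> disk (x *: dir i + p).
    by rewrite /= in_itv /= -ltr_norml => xd; apply: Hd; rewrite edist_line0.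
  have I0 : `]-d, d[%classic (0 : R) by rewrite /= in_itv /= oppr_lt0 d0.
  pose g (x s : R) := Phi s (x *: dir i + p).
  have dg (x s : R) : `]-d, d[%classic x -> `[0, 1]%classic s ->
      is_derive x 1 (g^~ s) (dd i (Phi s) (x *: dir i + p)).
    move=> /Hx dx; rewrite /= in_itv /= => s01; have [_ _ dP] := C_grad (cPhi s s01).
    exact: (proj1 (is_derive_line _ _ _ _ _) (dP i _ dx)).
  have pg (x s : R) : `]-d, d[%classic x -> `[0, 1]%classic s ->
      partial1of2 g x s = dd i (Phi s) (x *: dir i + p).
    by move=> hx hs; rewrite partial1of2E; case: (dg x s hx hs).
  have K : h^-1 *: (int01 (g (h + 0)) - int01 (g 0)) @[h --> 0^'] --> int01 (partial1of2 g 0).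
    (* The derivative of the integrand has four terms, each of them a value or derivative of F times
       factors of absolute value at most 1. *)
    apply: (@cvg_differentiation_under_integral R _ _ mu g `[0, 1]%classic (measurable_itv _) 0 (- d) d I0 _ _ (fun=> 4 * B)).
    + by move=> x /Hx /disk_cdisk dx; apply: integrable01; exact: cray.
    + by move=> x s hx hs; case: (dg x s hx hs).
    + by move=> _; rewrite mulr_ge0.
    + by apply: integrable01; apply: continuous_subspaceT => x; exact: cvg_cst.
    + move=> x s hx hs; rewrite pg//; move/Hx/disk_cdisk : hx => dx.
      move: hs; rewrite /= in_itv /= => s01; rewrite ddPhi//.
      have [b1 b2] := HB _ (cdisk_dil s01 dx); have [u1 v1] := unit1 _ dx.
      have m (a b : R) : `|a| <= 1 -> `|b| <= B -> `|a * b| <= B.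
        by move=> ha hb; rewrite normrM; apply: le_trans (ler_pM _ _ ha hb) _; rewrite ?mul1r.
      have s1 : `|s| <= 1 by rewrite ger0_norm; lra.
      have k1 (b : bool) : `|b%:R : R| <= 1 by case: b; rewrite ?normr0 ?normr1.
      apply: le_trans (ler_normD _ _) _; apply: le_trans (lerD (ler_normD _ _) (ler_normD _ _)) _.
      have := m _ _ u1 (m _ _ s1 (b2 i 0)); have := m _ _ v1 (m _ _ s1 (b2 i 1)).
      have := m _ _ (k1 (i == 0)) (b1 0); have := m _ _ (k1 (i == 1)) (b1 1).
      rewrite ![_%:R * _]mulrC; lra.
  have E : int01 (partial1of2 g 0) = F i p.
    have cdp := disk_cdisk dp.
    (* The curl condition turns the differentiated integrand into k(s), the derivative of s F_i(s
       p), whose integral over [0, 1] is F_i(p). *)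
    pose k (s : R) := s * (p.1 * dd 0 (F i) (s *: p) + p.2 * dd 1 (F i) (s *: p)) + F i (s *: p).
    transitivity (int01 k).
      apply: eq_Rintegral => s /set_mem hs.
      transitivity (partial1of2 g 0 s) => //; rewrite pg// scale0r add0r.
      move: hs; rewrite /= in_itv /= => s01; rewrite ddPhi//.
      have c := curl _ (cdisk_dil s01 cdp); rewrite /k.
      by move: (i); apply: ord2P; rewrite /= ?c; ring.
    have ck : {within `[0, 1], continuous k}.
      apply/subspace_continuousP => t ht.
      have c h (ch : ucont h) := proj1 (subspace_continuousP _ _) (ray_continuous ch cdp) t ht.
      have ud j : ucont (dd j (F i)) by apply: (C_ucont (m := 0)); exact: C_dd.
      apply: cvgD; last exact: c (C_ucont (cF i)).
      apply: cvgM; first by apply: cvg_within.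
      by apply: cvgD; apply: cvgM; [exact: cvg_cst|exact: c|exact: cvg_cst|exact: c].
    have dk (s : R) : 0 <= s <= 1 -> is_derive s 1 (fun t : R => t * F i (t *: p)) (k s).
      move=> s01; have h1 := is_derive_dir p (cF i) (disk_dil s01 dp).
      have := is_derive_line (F i) 0 p s; move=> /(_ (p.1 * dd 0 (F i) (s *: p) + p.2 * dd 1 (F i) (s *: p))) [h2 _].
      rewrite addr0 in h2; have := is_deriveM (is_derive_id s (1 : R)) (h2 h1).
      rewrite addr0 /k; congr is_derive; first by apply/funext => t; rewrite /= -[t *: p]addr0.
      by rewrite [F i _ *: _]mulr1.
    have /(continuous_within_itvP _ ltr01)[_ cr cl] : {within `[0, 1], continuous (fun t : R => t * F i (t *: p))}.
      apply/subspace_continuousP => t ht; apply: cvgM; first exact: cvg_within.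
      exact: (proj1 (subspace_continuousP _ _) (ray_continuous (C_ucont (cF i)) cdp) t ht).
    rewrite /Rintegral (continuous_FTC2 (F := fun t : R => t * F i (t *: p)) ltr01 ck) /=.
    - by rewrite scale1r mul1r mul0r subr0.
    - split.
      + move=> t; rewrite in_itv /= => t01; have t01' : 0 <= t <= 1 by lra.
        by case: (dk t t01').
      + exact: cr.
      + exact: cl.
    - move=> t; rewrite in_itv /= => t01; have t01' : 0 <= t <= 1 by lra.
      by rewrite derive1E; case: (dk t t01').
  rewrite -E.
  have K' : h^-1 *: (((fun s : R => f (s *: dir i + p)) \o shift 0) (h *: 1) - f (0 *: dir i + p)) @[h --> 0^'] --> int01 (partial1of2 g 0).
    apply: cvg_trans K; apply: near_eq_cvg; near=> h => /=.
    by rewrite [h%:A]mulr1.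
  split; first by apply/cvg_ex; eexists; exact: K'.
  by apply: cvg_lim K'; exact: norm_hausdorff.
- move=> e e0.
  have e4 : 0 < e / 4 by rewrite divr_gt0.
  have uF i : ucont (F i) := C_ucont (cF i).
  have [d0 d00 H0] := uF 0 _ e4; have [d1 d10 H1] := uF 1 _ e4.
  (* The difference of the integrands splits into four products, each at most e / 4: two by the
     continuity of F, two by |F| <= B and [edist p q] < b. *)
  pose b := e / 4 / (B + 1).
  have B1 : 0 < B + 1 by lra.
  have b0 : 0 < b by rewrite !divr_gt0.
  exists (Num.min b (Num.min d0 d1)); first by rewrite !lt_min b0 d00.
  move=> p q dp dq; rewrite !lt_min => /and3P[pqb pq0 pq1].
  apply: int01_close; [exact: cray|exact: cray|] => s s01.
  have [u1 v1] := unit1 p dp.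
  have [bq _] := HB _ (cdisk_dil s01 dq).
  have spq : edist (s *: p) (s *: q) <= edist p q.
    by case/andP: (s01) => s0 s1; rewrite edist_dil// ler_piMl// edist_ge0.
  have k0 := H0 _ _ (cdisk_dil s01 dp) (cdisk_dil s01 dq) (le_lt_trans spq pq0).
  have k1 := H1 _ _ (cdisk_dil s01 dp) (cdisk_dil s01 dq) (le_lt_trans spq pq1).
  have -> : Phi s p - Phi s q = (p.1 * (F 0 (s *: p) - F 0 (s *: q)) + (p.1 - q.1) * F 0 (s *: q)) +
    (p.2 * (F 1 (s *: p) - F 1 (s *: q)) + (p.2 - q.2) * F 1 (s *: q)) by rewrite /Phi; ring.
  apply: le_trans (ler_normD _ _) _; apply: le_trans (lerD (ler_normD _ _) (ler_normD _ _)) _.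
  have m1 (a c : R) : `|a| <= 1 -> `|c| <= e / 4 -> `|a * c| <= e / 4.
    by move=> ha hc; rewrite normrM; apply: le_trans (ler_pM _ _ ha hc) _; rewrite ?mul1r.
  have m2 (a c : R) : `|a| <= edist p q -> `|c| <= B -> `|a * c| <= e / 4.
    move=> ha hc; rewrite normrM; apply: (@le_trans _ _ (b * (B + 1))); last by rewrite divfK// gt_eqF.
    by apply: ler_pM => //; lra.
  have := m1 _ _ u1 k0; have := m1 _ _ v1 k1.
  have := m2 _ _ (edist1 p q) (bq 0); have := m2 _ _ (edist2 p q) (bq 1); lra.
Unshelve. all: by end_near. Qed.

End Poincare.

(** * Frames and torsion *)

Section VectorFields.
Context {R : realType}.
Implicit Types (p q : R * R) (f g : R * R -> R) (i : 'I_2) (j : 'I_4).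
Implicit Types (X Y Z V : R * R -> 'rV[R]_4) (x y z : 'rV[R]_4).

Local Notation C := (reg ucont).

Definition vreg (P : (R * R -> R) -> Prop) m X := forall j, reg P m (fun p => X p 0 j).

Definition vdd i X p : 'rV[R]_4 := \row_j dd i (fun q => X q 0 j) p.

Lemma vpdE : @vpd R = vdd.
Proof. by rewrite /vdd ddE. Qed.

Lemma vholderP m beta X : 0 < beta < 1 -> vholder m beta X <-> vreg (hol beta) m X.
Proof. by move=> b01; split=> H j; apply/holderP => //; exact: H. Qed.

Section Closure.
Variables (P : (R * R -> R) -> Prop) (bP : base P).

Lemma reg_dot m X Y : vreg P m X -> vreg P m Y -> reg P m (fun p => dot (X p) (Y p)).
Proof. by move=> rX rY; apply: reg_sum => // j; apply: regM => //. Qed.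

Lemma vregD m X Y : vreg P m X -> vreg P m Y -> vreg P m (fun p => X p + Y p).
Proof.
move=> rX rY j; apply: (reg_ext bP (f := fun p => X p 0 j + Y p 0 j)).
  by move=> p _; rewrite mxE.
by apply: regD => //.
Qed.

Lemma vregZ m f X : reg P m f -> vreg P m X -> vreg P m (fun p => f p *: X p).
Proof.
move=> rf rX j; apply: (reg_ext bP (f := fun p => f p * X p 0 j)).
  by move=> p _; rewrite mxE.
exact: regM.
Qed.

Lemma vreg_cst m x : vreg P m (fun=> x).
Proof. by move=> j; exact: reg_cst. Qed.

Lemma vreg_dd m i X : vreg P m.+1 X -> vreg P m (vdd i X).
Proof.
move=> rX j; apply: (reg_ext bP (f := dd i (fun p => X p 0 j))).
  by move=> p _; rewrite mxE.
exact: reg_dd.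
Qed.

Lemma vreg_dil m s X : 0 <= s <= 1 -> vreg P m X -> vreg P m (fun p => X (s *: p)).
Proof. by move=> s01 rX j; exact: (reg_dil bP s01 (rX j)). Qed.

Lemma vreg_le m n X : (n <= m)%N -> vreg P m X -> vreg P n X.
Proof. by move=> nm rX j; exact: (reg_le bP nm (rX j)). Qed.

Lemma reg_prod m (I : Type) (r : seq I) (F : I -> R * R -> R) :
  (forall k, reg P m (F k)) -> reg P m (fun p => \prod_(k <- r) F k p).
Proof.
move=> H; elim: r => [|k r IH].
  by apply: (reg_ext bP (f := fun=> 1)); [move=> p _; rewrite big_nil|exact: reg_cst].
apply: (reg_ext bP (f := fun p => F k p * \prod_(l <- r) F l p)).
  by move=> p _; rewrite big_cons.
exact: regM.
Qed.

Lemma reg_det m n (M : R * R -> 'M[R]_n) : (forall k l, reg P m (fun p => M p k l)) ->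
  reg P m (fun p => \det (M p)).
Proof.
move=> H; apply: reg_sum => // s; apply: regM => //; first exact: reg_cst.
exact: reg_prod.
Qed.

End Closure.

Lemma vreg_C P m X : base P -> vreg P m X -> vreg ucont m X.
Proof. by move=> bP rX j; exact: (reg_ucontW bP (rX j)). Qed.

Lemma dotC x y : dot x y = dot y x.
Proof. by apply: eq_bigr => j _; rewrite mulrC. Qed.

Lemma dotDl x y z : dot (x + y) z = dot x z + dot y z.
Proof. by rewrite /dot -big_split; apply: eq_bigr => j _; rewrite mxE mulrDl. Qed.

Lemma dotDr x y z : dot z (x + y) = dot z x + dot z y.
Proof. by rewrite dotC dotDl !(dotC z). Qed.

Lemma dotZl (c : R) x y : dot (c *: x) y = c * dot x y.
Proof. by rewrite /dot mulr_sumr; apply: eq_bigr => j _; rewrite mxE mulrA. Qed.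

Lemma dotZr (c : R) x y : dot x (c *: y) = c * dot x y.
Proof. by rewrite dotC dotZl dotC. Qed.

Lemma dot_ge0 x : 0 <= dot x x.
Proof. by apply: sumr_ge0 => j _; rewrite -expr2 sqr_ge0. Qed.

Lemma dot_eq0 x : dot x x = 0 -> x = 0.
Proof.
move=> /eqP; rewrite psumr_eq0; last by move=> j _; rewrite -expr2 sqr_ge0.
move=> /allP H; apply/rowP => j; rewrite mxE.
have := H j (mem_index_enum j); by rewrite -expr2 sqrf_eq0 => /eqP.
Qed.

Lemma coord_le x j : x 0 j ^+ 2 <= dot x x.
Proof.
rewrite /dot (bigD1 j)//= -expr2 lerDl; apply: sumr_ge0 => k _.
by rewrite -expr2 sqr_ge0.
Qed.

Lemma dd_sum i (I : Type) (r : seq I) (F : I -> R * R -> R) p : cdisk p ->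
  (forall k, C 1 (F k)) -> dd i (fun p => \sum_(k <- r) F k p) p = \sum_(k <- r) dd i (F k) p.
Proof.
move=> dp cF; elim: r => [|k r IH].
  rewrite big_nil -[RHS](dd_cst i 0 dp); apply: dd_ext dp => [|q _]; last by rewrite big_nil.
  by apply: (reg_ext base_ucontP (f := fun=> 0)); [move=> q _; rewrite big_nil|exact: (reg_cst base_ucontP)].
rewrite big_cons -IH -ddD//; last exact: (reg_sum base_ucontP).
apply: dd_ext dp => [|q _]; last by rewrite big_cons.
exact: (reg_sum base_ucontP).
Qed.

Lemma dd_dot i X Y p : vreg ucont 1 X -> vreg ucont 1 Y -> cdisk p ->
  dd i (fun p => dot (X p) (Y p)) p = dot (X p) (vdd i Y p) + dot (Y p) (vdd i X p).
Proof.
move=> rX rY dp; rewrite dd_sum//; last by move=> j; apply: CM; [exact: rX|exact: rY].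
rewrite /dot -big_split; apply: eq_bigr => j _.
by rewrite !mxE ddM//.
Qed.

Lemma vddD i X Y p : vreg ucont 1 X -> vreg ucont 1 Y -> cdisk p ->
  vdd i (fun p => X p + Y p) p = vdd i X p + vdd i Y p.
Proof.
move=> rX rY dp; apply/rowP => j; rewrite !mxE.
rewrite -ddD//.
apply: dd_ext dp => [|q _]; last by rewrite mxE.
exact: (vregD base_ucontP rX rY).
Qed.

Lemma vddZ i f X p : C 1 f -> vreg ucont 1 X -> cdisk p ->
  vdd i (fun p => f p *: X p) p = f p *: vdd i X p + dd i f p *: X p.
Proof.
move=> cf rX dp; apply/rowP => j; rewrite !mxE.
rewrite [dd i f p * _]mulrC -ddM//.
apply: dd_ext dp => [|q _]; last by rewrite mxE.
exact: (vregZ base_ucontP cf rX).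
Qed.

Lemma vdd_ext i X Y p : vreg ucont 1 X -> (forall p, cdisk p -> X p = Y p) -> cdisk p ->
  vdd i X p = vdd i Y p.
Proof.
move=> rX XY dp; apply/rowP => j; rewrite !mxE; apply: dd_ext dp; first exact: rX.
by move=> q dq; rewrite XY.
Qed.

Definition frame_mx x y z (t : 'rV[R]_4) : 'M[R]_4 :=
  \matrix_(j < 4) tnth [tuple x; y; z; t] j.

Lemma ord4P (Q : 'I_4 -> Prop) : Q 0 -> Q 1 -> Q 2 -> Q 3 -> forall j, Q j.
Proof.
move=> q0 q1 q2 q3 [[|[|[|[|//]]]] hj].
- by have -> : Ordinal hj = 0 by exact/val_inj.
- by have -> : Ordinal hj = 1 by exact/val_inj.
- by have -> : Ordinal hj = 2 by exact/val_inj.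
- by have -> : Ordinal hj = 3 by exact/val_inj.
Qed.

Lemma row_frame_mx a b c d (k : 'I_4) : row k (frame_mx a b c d) = tnth [tuple a; b; c; d] k.
Proof. by rewrite rowK. Qed.

Lemma frame_gram a b c d (k l : 'I_4) : (frame_mx a b c d *m (frame_mx a b c d)^T) k l =
  dot (tnth [tuple a; b; c; d] k) (tnth [tuple a; b; c; d] l).
Proof.
by rewrite mxE; apply: eq_bigr => j _; rewrite !mxE.
Qed.

Lemma det_frame_alt x y z : \det (frame_mx x y z z) = 0.
Proof.
apply: (determinant_alternate (i1 := 2) (i2 := 3)) => // j.
by rewrite !mxE.
Qed.

Lemma det_frame_lin3 (a b : R) x y z z' t :
  \det (frame_mx x y (a *: z + b *: z') t) = a * \det (frame_mx x y z t) + b * \det (frame_mx x y z' t).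
Proof.
apply: (determinant_multilinear (i0 := 2)).
- by rewrite !row_frame_mx.
- by apply/matrixP => -[[|[|[|//]]] hk] j; rewrite !mxE.
- by apply/matrixP => -[[|[|[|//]]] hk] j; rewrite !mxE.
Qed.

Lemma det_frame_lin4 (a b : R) x y z t t' :
  \det (frame_mx x y z (a *: t + b *: t')) = a * \det (frame_mx x y z t) + b * \det (frame_mx x y z t').
Proof.
apply: (determinant_multilinear (i0 := 3)).
- by rewrite !row_frame_mx.
- by apply/matrixP => -[[|[|[|//]]] hk] j; rewrite !mxE.
- by apply/matrixP => -[[|[|[|//]]] hk] j; rewrite !mxE.
Qed.

Lemma det_frame_scale (a b : R) x y z t :
  \det (frame_mx (a *: x) (b *: y) z t) = a * b * \det (frame_mx x y z t).
Proof.
have h1 (c : R) u v : \det (frame_mx (c *: u) v z t) = c * \det (frame_mx u v z t).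
  rewrite (@determinant_multilinear _ _ _ (frame_mx u v z t) (frame_mx u v z t) 0 c 0) ?mul0r ?addr0//.
  - by rewrite !row_frame_mx /= scale0r addr0.
  - by apply/matrixP => -[[|[|[|//]]] hk] j; rewrite !mxE.
  - by apply/matrixP => -[[|[|[|//]]] hk] j; rewrite !mxE.
have h2 (c : R) u v : \det (frame_mx u (c *: v) z t) = c * \det (frame_mx u v z t).
  rewrite (@determinant_multilinear _ _ _ (frame_mx u v z t) (frame_mx u v z t) 1 c 0) ?mul0r ?addr0//.
  - by rewrite !row_frame_mx /= scale0r addr0.
  - by apply/matrixP => -[[|[|[|//]]] hk] j; rewrite !mxE.
  - by apply/matrixP => -[[|[|[|//]]] hk] j; rewrite !mxE.
by rewrite h1 h2 mulrA.
Qed.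

Lemma det_frame_swap x y z t : \det (frame_mx x y t z) = - \det (frame_mx x y z t).
Proof.
have := det_frame_alt x y (1 *: z + 1 *: t).
rewrite det_frame_lin3 !det_frame_lin4 !det_frame_alt !mul1r add0r addr0.
by move/eqP; rewrite addrC addr_eq0 => /eqP.
Qed.

Lemma det_frame_rotate (a b : R) x y z t : a ^+ 2 + b ^+ 2 = 1 ->
  \det (frame_mx x y (a *: z + b *: t) (- b *: z + a *: t)) = \det (frame_mx x y z t).
Proof.
move=> ab; rewrite det_frame_lin3 !det_frame_lin4 !det_frame_alt (det_frame_swap x y z t).
rewrite -[RHS]mul1r -ab; ring.
Qed.

(** The triple cross product of R^4. The last row does not enter these cofactors, so 0 is a mere
    placeholder. *)
Definition cross x y z : 'rV[R]_4 := \row_j cofactor (frame_mx x y z 0) 3 j.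

Lemma dot_cross x y z t : dot t (cross x y z) = \det (frame_mx x y z t).
Proof.
rewrite (expand_det_row _ 3); apply: eq_bigr => j _; rewrite !mxE; congr (_ * (_ * \det _)).
by apply/matrixP => -[[|[|[|//]]] hk] l; rewrite !mxE.
Qed.

(** Three linear equations in four unknowns have a nonzero solution, which is then normalized. *)
Lemma exists_unit_normal x y z : exists2 t, dot t t = 1 & [/\ dot t x = 0, dot t y = 0 & dot t z = 0].
Proof.
pose A : 'M[R]_(4, 3) := \matrix_(j, k) tnth [tuple x; y; z] k 0 j.
have kn0 : kermx A != 0.
  rewrite kermx_eq0 /row_free; apply/eqP => e4.
  by have := rank_leq_col A; rewrite e4.
have /rowV0Pn [t tk t0] := kn0.
have tA : t *m A = 0 by apply/sub_kermxP.
have dt k : dot t (tnth [tuple x; y; z] k) = 0.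
  transitivity ((t *m A) 0 k); last by rewrite tA mxE.
  by rewrite mxE; apply: eq_bigr => j _; rewrite mxE.
have tt : 0 < dot t t.
  rewrite lt_neqAle dot_ge0 andbT eq_sym; apply: contraNneq t0 => h.
  by rewrite (dot_eq0 h).
exists ((Num.sqrt (dot t t))^-1 *: t).
  rewrite dotZl dotZr mulrA -invfM -expr2 sqr_sqrtr ?dot_ge0//.
  by rewrite mulVf// gt_eqF.
split; rewrite dotZl; first by rewrite (dt 0) mulr0.
  by rewrite (dt 1) mulr0.
by rewrite (dt 2) mulr0.
Qed.

Definition onb (a b c d : 'rV[R]_4) := forall k l : 'I_4,
  dot (tnth [tuple a; b; c; d] k) (tnth [tuple a; b; c; d] l) = (k == l)%:R.

Lemma onb_mx a b c d : onb a b c d -> frame_mx a b c d *m (frame_mx a b c d)^T = 1%:M.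
Proof. by move=> H; apply/matrixP => k l; rewrite frame_gram H mxE. Qed.

Lemma onb_det a b c d : onb a b c d -> \det (frame_mx a b c d) ^+ 2 = 1.
Proof.
by move=> /onb_mx H; rewrite expr2 -{2}(det_tr (frame_mx a b c d)) -det_mulmx H det1.
Qed.

Lemma onb_expand a b c d x : onb a b c d ->
  x = dot x a *: a + dot x b *: b + dot x c *: c + dot x d *: d.
Proof.
move=> /onb_mx /mulmx1C H; rewrite -{1}[x]mulmx1 -H mulmxA.
apply/rowP => j; rewrite mxE !big_ord_recl big_ord0 addr0 !mxE !addrA.
have E (k : 'I_4) : \sum_l x 0 l * (frame_mx a b c d)^T l k = dot x (tnth [tuple a; b; c; d] k).
  by apply: eq_bigr => l _; rewrite !mxE.
by rewrite !E.
Qed.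

Lemma onbI a b c d : dot a a = 1 -> dot b b = 1 -> dot c c = 1 -> dot d d = 1 ->
  dot a b = 0 -> dot a c = 0 -> dot a d = 0 -> dot b c = 0 -> dot b d = 0 -> dot c d = 0 ->
  onb a b c d.
Proof.
move=> aa bb cc dd ab ac ad bc bd cd; apply: ord4P; apply: ord4P => //=;
  by rewrite dotC.
Qed.

(** Some unit vector t completes a, b, c to an orthonormal basis. The cross product is orthogonal to
    a, b, c, hence a multiple of t; the factor is the determinant of that basis, which is 1 or -1.
    So it has length 1, and its squared length is the determinant in question. *)
Lemma cross_onb a b c : dot a a = 1 -> dot b b = 1 -> dot c c = 1 ->
  dot a b = 0 -> dot a c = 0 -> dot b c = 0 ->
  onb a b c (cross a b c) /\ \det (frame_mx a b c (cross a b c)) = 1.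
Proof.
move=> aa bb cc ab ac bc.
have [t tt [ta tb tc]] := exists_unit_normal a b c.
have ot : onb a b c t by apply: onbI => //; rewrite dotC.
have da : dot a (cross a b c) = 0.
  rewrite dot_cross; apply: (determinant_alternate (i1 := 0) (i2 := 3)) => // j.
  by rewrite !mxE.
have db : dot b (cross a b c) = 0.
  rewrite dot_cross; apply: (determinant_alternate (i1 := 1) (i2 := 3)) => // j.
  by rewrite !mxE.
have dc : dot c (cross a b c) = 0 by rewrite dot_cross det_frame_alt.
have E : cross a b c = dot (cross a b c) t *: t.
  rewrite {1}(onb_expand (cross a b c) ot) !(dotC (cross a b c)) da db dc.
  by rewrite !scale0r !add0r.
have D : dot (cross a b c) t ^+ 2 = 1 by rewrite dotC dot_cross onb_det.
have nn : dot (cross a b c) (cross a b c) = 1.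
  by move: (dot _ t) E D => l -> D; rewrite dotZl dotZr tt mulr1 -expr2 D.
split; first exact: onbI.
by rewrite -dot_cross.
Qed.

End VectorFields.

(** * Unit normal fields along two orthonormal fields *)

Section NormalFrame.
Context {R : realType}.
Implicit Types (p q : R * R) (f g : R * R -> R) (i : 'I_2) (j : 'I_4).
Implicit Types (X Y Z V A B : R * R -> 'rV[R]_4) (x y z : 'rV[R]_4).

Local Notation C := (reg ucont).

Lemma powR_invsqrt (x : R) : 0 < x -> (x `^ (- 2^-1)) ^+ 2 * x = 1.
Proof.
move=> x0; rewrite -powR_mulrn ?powR_ge0// -powRrM mulNr mulVf// powRN powRr1 ?ltW//.
by rewrite mulVf// gt_eqF.
Qed.

(** Consecutive dilations l / (n + 1) move a point of the closed disk by at most 1 / (n + 1), and f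
    is Lipschitz. *)
Lemma dilation_close f (e : R) : C 1 f -> 0 < e -> exists n0 : nat, forall n : nat, (n0 <= n)%N ->
  forall (l : nat) p, (l < n.+1)%N -> cdisk p ->
  `|f ((l.+1%:R / n.+1%:R) *: p) - f ((l%:R / n.+1%:R) *: p)| <= e.
Proof.
move=> cf e0; have [cf0 cg pf] := C_grad cf.
have bd i : exists2 M : R, 0 <= M & forall p, cdisk p -> `|dd i f p| <= M.
  by apply: cdisk_bounded; apply/ucont_within; exact: (C_ucont (C_dd i cf)).
have [M0 M00 h0] := bd 0; have [M1 M10 h1] := bd 1.
have lipf := grad_lip (addr_ge0 M00 M10) cf0 pf.
have {}lipf p q : cdisk p -> cdisk q -> `|f p - f q| <= (M0 + M1) * 2 * edist p q.
  apply: lipf => i p' /disk_cdisk dp'; move: i; apply: ord2P.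
    by apply: (le_trans (h0 _ dp')); rewrite lerDl.
  by apply: (le_trans (h1 _ dp')); rewrite lerDr.
exists (Num.truncn ((M0 + M1) * 2 / e)) => n nn l p ln dp.
have n0 : 0 < n.+1%:R :> R by [].
have dl (k : nat) : (k <= n.+1)%N -> 0 <= (k%:R / n.+1%:R : R) <= 1.
  by move=> kn; rewrite divr_ge0//= ler_pdivrMr// mul1r ler_nat.
apply: (le_trans (lipf _ _ (cdisk_dil (dl _ ln) dp) (cdisk_dil (dl _ (ltnW ln)) dp))).
have -> : edist ((l.+1%:R / n.+1%:R) *: p) ((l%:R / n.+1%:R) *: p) = edist p 0 / n.+1%:R.
  case: p dp => a b _; rewrite /edist /= /GRing.scale /=.
  have E (c : R) : l.+1%:R / n.+1%:R * c - l%:R / n.+1%:R * c = n.+1%:R^-1 * (c - 0).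
    by rewrite -mulrBl -mulrBl -natr1 addrAC subrr add0r mul1r subr0.
  by rewrite !E !exprMn -mulrDr sqrtrM ?sqr_ge0// sqrtr_sqr ger0_norm ?invr_ge0 ?ltW// mulrC.
have ed : edist p 0 <= 1 by rewrite -cdisk_edist0.
rewrite mulrA ler_pdivrMr//; apply: le_trans (_ : (M0 + M1) * 2 * 1 <= _).
  by apply: ler_wpM2l => //; rewrite mulr_ge0// addr_ge0.
rewrite mulr1 [e * _]mulrC -ler_pdivrMr//; apply: ltW; apply: lt_le_trans (truncnS_gt _) _.
by rewrite ler_nat.
Qed.

Lemma dot_close (v x y : 'rV[R]_4) : dot v v = 1 -> dot v y = 0 ->
  (forall j, `|x 0 j - y 0 j| <= 1 / 16) -> `|dot v x| <= 1 / 4.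
Proof.
move=> vv vy xy.
have -> : dot v x = \sum_j v 0 j * (x 0 j - y 0 j).
  rewrite -[LHS]subr0 -[X in _ - X]vy /dot -sumrB; apply: eq_bigr => j _.
  by rewrite mulrBr.
apply: le_trans (ler_norm_sum _ _ _) _.
apply: le_trans (_ : \sum_(j < 4) (1 / 16 : R) <= _).
  apply: ler_sum => j _; rewrite normrM -[X in _ <= X]mul1r; apply: ler_pM => //.
  by rewrite -(@ler_sqr R) ?nnegrE// real_normK ?num_real// expr1n -vv coord_le.
by rewrite sumr_const card_ord; lra.
Qed.

Definition unit_normal A B V :=
  forall p, cdisk p -> [/\ dot (V p) (V p) = 1, dot (V p) (A p) = 0 & dot (V p) (B p) = 0].

Definition orthonormal2 A B :=
  forall p, cdisk p -> [/\ dot (A p) (A p) = 1, dot (B p) (B p) = 1 & dot (A p) (B p) = 0].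

(** Four coordinate errors of 1 / 16 make the products of V with A and B at most 1 / 4 in absolute
    value. The component of V normal to A and B thus has squared length at least 1 - 2 / 16 and can
    be normalized without loss of regularity. *)
Lemma unit_normal_step (P : (R * R -> R) -> Prop) (m : nat) A B A' B' V : base P ->
  vreg P m A -> vreg P m B -> vreg P m V -> orthonormal2 A B -> unit_normal A' B' V ->
  (forall p j, cdisk p -> `|A p 0 j - A' p 0 j| <= 1 / 16 /\ `|B p 0 j - B' p 0 j| <= 1 / 16) ->
  exists2 V', vreg P m V' & unit_normal A B V'.
Proof.
move=> bP rA rB rV oAB uV cl.
pose w p := V p + ((- dot (V p) (A p)) *: A p + (- dot (V p) (B p)) *: B p).
have rw : vreg P m w.
  by apply: vregD => //; apply: vregD => //; apply: vregZ => //; apply: regN => //; exact: reg_dot.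
have w0 p : cdisk p -> 0 < dot (w p) (w p).
  move=> dp; have [vv va vb] := uV _ dp; have [aa bb ab] := oAB _ dp.
  have h1 : `|dot (V p) (A p)| <= 1 / 4 by apply: (dot_close vv va) => j; case: (cl p j dp).
  have h2 : `|dot (V p) (B p)| <= 1 / 4 by apply: (dot_close vv vb) => j; case: (cl p j dp).
  rewrite /w !(dotDl, dotDr, dotZl, dotZr) vv aa bb ab (dotC (B p) (A p)) ab.
  rewrite (dotC (A p) (V p)) (dotC (B p) (V p)).
  move: h1 h2; rewrite !ler_norml => /andP[h1 h1'] /andP[h2 h2'].
  by move: (dot _ _) (dot _ _) h1 h1' h2 h2' => a b; nra.
exists (fun p => dot (w p) (w p) `^ (- 2^-1) *: w p).
  by apply: vregZ => //; apply: reg_powR => //; exact: reg_dot.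
move=> p dp; have [aa bb ab] := oAB _ dp; rewrite !(dotZl, dotZr); split.
- by rewrite mulrA -expr2 powR_invsqrt// w0.
- suff -> : dot (w p) (A p) = 0 by rewrite mulr0.
  by rewrite !(dotDl, dotZl) aa (dotC (B p)) ab mulr0 addr0 mulr1 subrr.
- suff -> : dot (w p) (B p) = 0 by rewrite mulr0.
  by rewrite !(dotDl, dotZl) bb ab mulr0 add0r mulr1 subrr.
Qed.

(** The dilation by 0 makes A and B constant, so a constant field starts the transport. Order at
    least 1 supplies the Lipschitz bounds that fix the number of steps for all coordinates at
    once. *)
Lemma exists_unit_normal_field (P : (R * R -> R) -> Prop) (m : nat) A B : base P ->
  vreg P m.+1 A -> vreg P m.+1 B -> orthonormal2 A B ->
  exists2 V, vreg P m.+1 V & unit_normal A B V.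
Proof.
move=> bP rA rB oAB.
have e0 : 0 < 1 / 16 :> R by [].
have cX Y j : vreg P m.+1 Y -> C 1 (fun p => Y p 0 j).
  by move=> rY; apply: (C_le (m := m.+1)) => //; exact: (vreg_C bP rY).
have [nA hA] := choice (fun j => dilation_close (cX A j rA) e0).
have [nB hB] := choice (fun j => dilation_close (cX B j rB) e0).
pose n := (\max_(j < 4) nA j + \max_(j < 4) nB j)%N.
have nAn j : (nA j <= n)%N by apply: leq_trans (leq_addr _ _); exact: leq_bigmax.
have nBn j : (nB j <= n)%N by apply: leq_trans (leq_addl _ _); exact: leq_bigmax.
have dl (k : nat) : (k <= n.+1)%N -> 0 <= (k%:R / n.+1%:R : R) <= 1.
  by move=> kn; rewrite divr_ge0//= ler_pdivrMr// mul1r ler_nat.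
have H (l : nat) : (l <= n.+1)%N -> exists2 V, vreg P m.+1 V &
  unit_normal (fun p => A ((l%:R / n.+1%:R) *: p)) (fun p => B ((l%:R / n.+1%:R) *: p)) V.
  elim: l => [_|l IH ln].
    have [t tt [ta tb _]] := exists_unit_normal (A 0) (B 0) 0.
    exists (fun=> t); first exact: vreg_cst.
    by move=> p _; rewrite !mul0r !scale0r.
  have [V rV uV] := IH (ltnW ln).
  apply: (unit_normal_step bP _ _ rV _ uV); [exact: vreg_dil (dl _ ln) _|exact: vreg_dil (dl _ ln) _| |].
    by move=> p dp; apply: oAB; exact: (cdisk_dil (dl _ ln)).
  by move=> p j dp; split; [exact: hA|exact: hB].
have [V rV uV] := H n.+1 (leqnn _); exists V => // p dp.
by have := uV p dp; rewrite divff// scale1r.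
Qed.

End NormalFrame.

(** * Torsion coefficients under a change of frame *)

Section Torsion.
Context {R : realType}.
Implicit Types (p q : R * R) (f g phi : R * R -> R) (i s t : 'I_2).
Implicit Types (X Y Z V : R * R -> 'rV[R]_4) (x y z : 'rV[R]_4).
Implicit Types (N M : 'I_2 -> R * R -> 'rV[R]_4).

Local Notation C := (reg ucont).

Lemma dd_sin i phi p : C 1 phi -> cdisk p -> dd i (fun q => sin (phi q)) p = cos (phi p) * dd i phi p.
Proof.
move=> cphi dp; have [rs rc] := reg_sin_cos base_ucontP (C_le (leq0n _) cphi).
exact: (dd_grad i (grad_comp (C_grad cphi) rs rc (fun q _ => is_derive_sin _)) dp).
Qed.

Lemma dd_cos i phi p : C 1 phi -> cdisk p -> dd i (fun q => cos (phi q)) p = - sin (phi p) * dd i phi p.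
Proof.
move=> cphi dp; have [rs rc] := reg_sin_cos base_ucontP (C_le (leq0n _) cphi).
have rs' : C 0 (fun q => - sin (phi q)) by exact: (regN base_ucontP rs).
exact: (dd_grad i (grad_comp (dphi := fun a => - sin a) (C_grad cphi) rc rs' (fun q _ => is_derive_cos _)) dp).
Qed.

Definition vC1 N := forall s, vreg ucont 1 (N s).

Definition orthonormal N := forall p, cdisk p -> forall s t, dot (N s p) (N t p) = (s == t)%:R.

Lemma torsionE N s t i p : torsion N s t i p = dot (vdd i (N s) p) (N t p).
Proof. by rewrite /torsion vpdE. Qed.

Lemma torsion_skew N s t i p : vC1 N -> orthonormal N -> cdisk p ->
  torsion N s t i p = - torsion N t s i p.
Proof.
move=> cN oN dp; apply/eqP; rewrite -addr_eq0 !torsionE.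
have := dd_dot i (cN s) (cN t) dp.
rewrite (dotC (N s p)) (dotC (N t p)) addrC => <-.
by rewrite (dd_ext i (reg_dot base_ucontP (cN s) (cN t)) (fun q dq => oN q dq s t) dp) dd_cst.
Qed.

Lemma torsion_diag N s i p : vC1 N -> orthonormal N -> cdisk p -> torsion N s s i p = 0.
Proof. by move=> cN oN dp; have := torsion_skew s s i cN oN dp; lra. Qed.

(** Skew symmetry removes the diagonal coefficients, and what remains is weighted by cos^2 + sin^2 =
    1. *)
Lemma torsion_rotate phi N i p : C 1 phi -> vC1 N -> orthonormal N -> cdisk p ->
  torsion (rotate phi N) 0 1 i p = torsion N 0 1 i p + dd i phi p.
Proof.
move=> cphi cN oN dp; have [rs rc] := reg_sin_cos base_ucontP cphi.
have T00 := torsion_diag 0 i cN oN dp; have T11 := torsion_diag 1 i cN oN dp.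
have T10 := torsion_skew 1 0 i cN oN dp.
rewrite !torsionE in T00 T11 T10 *; rewrite /rotate /=.
rewrite vddD ?vddZ//; [|exact: (vregZ base_ucontP)..].
rewrite !(dotDl, dotDr, dotZl, dotZr) T00 T11 T10 !oN//= dd_sin// dd_cos//.
have := cos2Dsin2 (phi p).
move: (cos _) (sin _) => c s /= cs.
rewrite !(mulr1n, mulr0n) -[RHS]mul1r -[X in _ = X * _]cs; ring.
Qed.

(* The second vector of [M] is determined by the first up to a sign, which
   does not affect the squares. *)
Lemma torsion_change (E0 E1 : R * R -> 'rV[R]_4) N M :
  (forall s, vreg ucont 2 (N s)) -> (forall s, vreg ucont 2 (M s)) ->
  (forall p, cdisk p -> onb (E0 p) (E1 p) (N 0 p) (N 1 p)) ->
  (forall p, cdisk p -> onb (E0 p) (E1 p) (M 0 p) (M 1 p)) ->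
  exists F : 'I_2 -> R * R -> R, [/\ forall i, C 1 (F i),
    forall p, cdisk p -> dd 1 (F 0) p = dd 0 (F 1) p
  & forall i p, cdisk p -> torsion M 0 1 i p ^+ 2 = (torsion N 0 1 i p + F i p) ^+ 2].
Proof.
move=> rN rM oN oM.
have cN : vC1 N by move=> s; exact: (vreg_le base_ucontP (leqnSn 1) (rN s)).
pose a p := dot (M 0 p) (N 0 p); pose b p := dot (M 0 p) (N 1 p).
have ra : C 2 a by exact: (reg_dot base_ucontP).
have rb : C 2 b by exact: (reg_dot base_ucontP).
have ca := C_le (leqnSn 1) ra; have cb := C_le (leqnSn 1) rb.
have oN2 : orthonormal N.
  move=> p dp; have H := oN p dp.
  by apply: ord2P; apply: ord2P; [exact: (H 2 2)|exact: (H 2 3)|exact: (H 3 2)|exact: (H 3 3)].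
have M0 p : cdisk p -> M 0 p = a p *: N 0 p + b p *: N 1 p.
  move=> dp; have H := oM p dp; rewrite {1}(onb_expand (M 0 p) (oN p dp)).
  by rewrite (H 2 0) (H 2 1) /= !scale0r !add0r.
have ab p : cdisk p -> a p ^+ 2 + b p ^+ 2 = 1.
  move=> dp; have := oM p dp 2 2; rewrite /= !M0// !(dotDl, dotDr, dotZl, dotZr).
  by rewrite !oN2//= !(mulr1n, mulr0n); lra.
have dab i p : cdisk p -> a p * dd i a p + b p * dd i b p = 0.
  move=> dp; have c1 : C 1 (fun p => a p * a p + b p * b p) by apply: CD; exact: CM.
  have := dd_ext i c1 (f' := fun=> 1) (fun q dq => etrans (congr2 +%R (esym (expr2 _)) (esym (expr2 _))) (ab q dq)) dp.
  by rewrite ddD ?ddM//; [rewrite dd_cst//; lra|exact: CM..].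
(* For (a, b) = (cos theta, sin theta) this is the gradient of theta, written without choosing a
   continuous angle. *)
exists (fun i p => a p * dd i b p - b p * dd i a p); split.
- move=> i; apply: CB; apply: CM => //; exact: C_dd.
- move=> p dp.
  have c1 i : C 1 (dd i a) by exact: C_dd.
  have c2 i : C 1 (dd i b) by exact: C_dd.
  rewrite !ddB ?ddM//; [|exact: CM..].
  rewrite (ddC base_ucontP ra dp) (ddC base_ucontP rb dp).
  have h0 := dab 0 p dp; have h1 := dab 1 p dp; have h := ab p dp.
  move: (dd 1 (dd 0 a) p) (dd 1 (dd 0 b) p) => A B.
  move: (a p) (b p) (dd 0 a p) (dd 1 a p) (dd 0 b p) (dd 1 b p) h h0 h1 => x y x0 x1 y0 y1 h h0 h1.
  (* Both derivatives of (a, b) are orthogonal to the unit vector (a, b) of the plane, hence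
     parallel to each other; the curl is twice this determinant up to sign. *)
  have D : x1 * y0 - x0 * y1 = 0.
    rewrite -[LHS]mul1r -h.
    have -> : (x ^+ 2 + y ^+ 2) * (x1 * y0 - x0 * y1) =
      x * ((x * x1 + y * y1) * y0 - (x * x0 + y * y0) * y1)
      + y * ((x * x0 + y * y0) * x1 - (x * x1 + y * y1) * x0) by ring.
    by rewrite h0 h1; ring.
  lra.
- move=> i p dp; have H := oM p dp.
  have dM : vdd i (M 0) p = a p *: vdd i (N 0) p + dd i a p *: N 0 p + (b p *: vdd i (N 1) p + dd i b p *: N 1 p).
    rewrite -!vddZ// -vddD//; [|exact: (vregZ base_ucontP)..].
    by apply: vdd_ext dp; [exact: (vreg_le base_ucontP (leqnSn 1) (rM 0))|exact: M0].
  have M1 : M 1 p = dot (M 1 p) (N 0 p) *: N 0 p + dot (M 1 p) (N 1 p) *: N 1 p.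
    rewrite {1}(onb_expand (M 1 p) (oN p dp)).
    by rewrite (H 3 0) (H 3 1) /= !scale0r !add0r.
  have T00 := torsion_diag 0 i cN oN2 dp; have T11 := torsion_diag 1 i cN oN2 dp.
  have T10 := torsion_skew 1 0 i cN oN2 dp.
  have := H 2 3; have := H 3 3; rewrite /= M0// M1.
  rewrite !torsionE in T00 T11 T10 *; rewrite dM M1.
  rewrite !(dotDl, dotDr, dotZl, dotZr) T00 T11 T10 !oN2//=.
  move: (ab p dp) (dab i p dp).
  move: (a p) (b p) (dd i a p) (dd i b p) (dot (M 1 p) (N 0 p)) (dot (M 1 p) (N 1 p)) (dot (vdd i (N 0) p) (N 1 p)).
  move=> x y x' y' c d T h h' h1 h2.
  have k1 : x * c + y * d = 0 by lra.
  have k2 : c ^+ 2 + d ^+ 2 = 1 by lra.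
  (* The sign relating the orientations of the two frames: (c, d) = l (- y, x) with l^2 = 1. *)
  pose l := x * d - y * c.
  have ec : c = - l * y.
    rewrite /l -[LHS]mul1r -h.
    have -> : (x ^+ 2 + y ^+ 2) * c = x * (x * c + y * d) - (x * d - y * c) * y by ring.
    by rewrite k1; ring.
  have ed : d = l * x.
    rewrite /l -[LHS]mul1r -h.
    have -> : (x ^+ 2 + y ^+ 2) * d = y * (x * c + y * d) + (x * d - y * c) * x by ring.
    by rewrite k1; ring.
  have l2 : l ^+ 2 = 1.
    rewrite -k2 -[LHS]mulr1 -h {1}ec {1}ed; ring.
  clearbody l; rewrite ec ed -[RHS]mul1r -[X in _ = X * _]l2.
  rewrite -exprMn; congr (_ ^+ 2); rewrite !(mulr1n, mulr0n) -[T in RHS]mul1r -[X in l * (X * _ + _)]h; ring.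
Qed.

End Torsion.

(** * Normal frames of a conformal immersion *)

Section NormalFrames.
Context {R : realType}.
Variables (beta : R) (m : nat) (X : R * R -> 'rV[R]_4) (W : R * R -> R).
Hypotheses (b01 : 0 < beta < 1) (hX : immersion m.+3 beta X) (hW : conformal X W).
Implicit Types (p q : R * R) (f g phi : R * R -> R) (i s t : 'I_2).
Implicit Types (N M : 'I_2 -> R * R -> 'rV[R]_4).

Local Notation C := (reg ucont).
Let bh : base (hol beta) := base_hol b01.

Let hW' p : cdisk p -> [/\ dot (vdd 0 X p) (vdd 0 X p) = W p,
  dot (vdd 1 X p) (vdd 1 X p) = W p & dot (vdd 0 X p) (vdd 1 X p) = 0].
Proof. by rewrite -vpdE; exact: hW. Qed.

(** If W vanished at p, so would both tangent vectors, against the rank condition. *)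
Lemma conformal_gt0 p : cdisk p -> 0 < W p.
Proof.
move=> dp; have [w0 w1 _] := hW' dp; rewrite lt_neqAle -{2}w0 dot_ge0 andbT.
apply/negP => /eqP W0; have := hX.2 p dp.
have z i : vdd i X p = 0 by move: i; apply: ord2P; apply: dot_eq0; rewrite ?w0 ?w1.
rewrite (_ : Defs.jacobian X p = 0) ?mxrank0//.
by apply/matrixP => j i; rewrite mxE vpdE z !mxE.
Qed.

(** The tangent vectors divided by sqrt W. The scalar product stands for W so that the regularity
    can be read off from X. *)
Definition tangent i p := dot (vdd 0 X p) (vdd 0 X p) `^ (- 2^-1) *: vdd i X p.

Let rX : vreg (hol beta) m.+3 X.
Proof. by apply/vholderP => //; case: hX. Qed.

Lemma vreg_tangent i : vreg (hol beta) m.+2 (tangent i).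
Proof.
apply: vregZ => //; last exact: vreg_dd.
apply: reg_powR => // [p dp|]; last by apply: reg_dot => //; exact: vreg_dd.
by have [-> _ _] := hW' dp; exact: conformal_gt0.
Qed.

Lemma tangent_orthonormal : orthonormal2 (tangent 0) (tangent 1).
Proof.
move=> p dp; rewrite /tangent; have [w0 w1 w01] := hW' dp.
have h := powR_invsqrt (conformal_gt0 dp).
by rewrite !(dotZl, dotZr) !(w0, w1, w01) !mulr0 mulrA -expr2 h.
Qed.

(** The normalized tangent vectors are X_u and X_v divided by sqrt W, so completing them and V by
    the cross product gives det (X_u, X_v, N_1, N_2) = W > 0. *)
Lemma exists_normal_frame : exists N, normal_frame m.+3 beta X N.
Proof.
have [V rV uV] := exists_unit_normal_field bh (vreg_tangent 0) (vreg_tangent 1) tangent_orthonormal.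
pose N (s : 'I_2) := if s == 0 then V else fun p => cross (tangent 0 p) (tangent 1 p) (V p).
exists N; split.
  apply: ord2P; apply/vholderP => //= j.
  apply: (reg_ext bh (f := fun p => cofactor (frame_mx (tangent 0 p) (tangent 1 p) (V p) 0) 3 j)).
    by move=> p _; rewrite mxE.
  apply: regM => //; first exact: reg_cst.
  apply: reg_det => // k l.
  apply: (reg_ext bh (f := fun p => frame_mx (tangent 0 p) (tangent 1 p) (V p) 0 (lift 3 k) (lift j l))).
    by move=> p _; rewrite !mxE.
  move: (lift 3 k) (lift j l) => {}k {}l.
  have H Y : (forall p, cdisk p -> tnth [tuple tangent 0 p; tangent 1 p; V p; 0] k = Y p) ->
      vreg (hol beta) m.+2 Y -> reg (hol beta) m.+2 (fun p => frame_mx (tangent 0 p) (tangent 1 p) (V p) 0 k l).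
    by move=> YE rY; apply: (reg_ext bh _ (rY l)) => p dp; rewrite mxE YE.
  move: k H; apply: ord4P => H; [apply: (H (tangent 0))|apply: (H (tangent 1))|apply: (H V)|apply: (H (fun=> 0))] => //.
  - exact: vreg_tangent.
  - exact: vreg_tangent.
  - exact: vreg_cst.
move=> p dp; have [v v0 v1] := uV _ dp; have [e0 e1 e01] := tangent_orthonormal dp.
rewrite dotC in v0; rewrite dotC in v1.
have [ob db] := cross_onb e0 e1 v e01 v0 v1.
have W0 := conformal_gt0 dp.
have c0 : 0 < W p `^ (- 2^-1) by exact: powR_gt0.
have tE i : tangent i p = W p `^ (- 2^-1) *: vdd i X p.
  by rewrite /tangent; have [-> _ _] := hW' dp.
split.
- by apply: ord2P; apply: ord2P; [exact: (ob 2 2)|exact: (ob 2 3)|exact: (ob 3 2)|exact: (ob 3 3)].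
- move=> s i; apply: (mulfI (lt0r_neq0 c0)); rewrite mulr0 -dotZr vpdE -tE.
  move: s i; apply: ord2P; apply: ord2P; [exact: (ob 2 0)|exact: (ob 2 1)|exact: (ob 3 0)|exact: (ob 3 1)].
- rewrite vpdE -/(frame_mx _ _ _ _) -[X in X < _](mulr0 (W p `^ (- 2^-1) ^+ 2)^-1).
  rewrite -(ltr_pM2l (exprn_gt0 2 c0)) mulr0 expr2 -det_frame_scale -!tE /N/= db//.
Qed.

Section Frame.
Variables (N : 'I_2 -> R * R -> 'rV[R]_4).
Hypothesis hN : normal_frame m.+3 beta X N.

Lemma normal_frame_vreg s : vreg (hol beta) m.+2 (N s).
Proof. by apply/vholderP => //; exact: hN.1. Qed.

Lemma normal_frame_C s : vreg ucont 2 (N s).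
Proof. exact: vreg_C bh (vreg_le bh _ (normal_frame_vreg s)). Qed.

Lemma normal_frame_orthonormal : orthonormal N.
Proof. by move=> p dp; case: (hN.2 p dp). Qed.

Lemma normal_frame_onb p : cdisk p -> onb (tangent 0 p) (tangent 1 p) (N 0 p) (N 1 p).
Proof.
move=> dp; have [nn nx _] := hN.2 p dp; have [e0 e1 e01] := tangent_orthonormal dp.
have nt s i : dot (tangent i p) (N s p) = 0 by rewrite dotZl dotC -vpdE nx mulr0.
by apply: onbI => //; rewrite nn.
Qed.

Lemma rotate_normal_frame phi : reg (hol beta) m.+2 phi -> normal_frame m.+3 beta X (rotate phi N).
Proof.
move=> rphi; have [rs rc] := reg_sin_cos bh rphi.
split.
  move=> s; apply/vholderP => //; move: s; apply: ord2P; apply: vregD => //; apply: vregZ => //;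
    try exact: normal_frame_vreg.
  exact: regN.
move=> p dp; have [nn nx nd] := hN.2 p dp; have cs := cos2Dsin2 (phi p).
rewrite /rotate; split.
- by apply: ord2P; apply: ord2P => /=; rewrite !(dotDl, dotDr, dotZl, dotZr) !nn/= !(mulr1n, mulr0n); lra.
- by apply: ord2P => i /=; rewrite !(dotDl, dotZl) !nx !mulr0 addr0.
- by rewrite /= -/(frame_mx _ _ _ _) det_frame_rotate.
Qed.

Lemma reg_torsion s t i : reg (hol beta) m.+1 (torsion N s t i).
Proof.
apply: (reg_ext bh (f := fun p => dot (vdd i (N s) p) (N t p))).
  by move=> p _; rewrite torsionE.
apply: reg_dot => //; first by apply: vreg_dd => //; exact: normal_frame_vreg.
exact: (vreg_le bh (leqnSn _) (normal_frame_vreg t)).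
Qed.

End Frame.

End NormalFrames.

(** * Total torsion and estimates *)

Section Energy.
Context {R : realType}.
Implicit Types (p q : R * R) (f g phi psi : R * R -> R) (i s t : 'I_2).
Implicit Types (N M : 'I_2 -> R * R -> 'rV[R]_4) (F : 'I_2 -> R * R -> R).

Local Notation C := (reg ucont).

Lemma curl_free_orthogonal f F : C 1 f -> (forall p, circle p -> f p = 0) -> (forall i, C 1 (F i)) ->
  (forall p, cdisk p -> dd 1 (F 0) p = dd 0 (F 1) p) ->
  dint (fun p => dd 1 f p * F 0 p - dd 0 f p * F 1 p) = 0.
Proof.
move=> cf f0 cF curl; have cdf i : C 0 (dd i f) by exact: C_dd.
have cF0 i : C 0 (F i) by exact: C_le (leq0n _) (cF i).
have h i j : dint (fun p => dd i f p * F j p) = - dint (fun p => f p * dd i (F j) p).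
  by apply: dint_parts => // q cq; rewrite f0 ?mul0r.
rewrite dintB; [|exact: (CM (m := 0))..].
rewrite !h -opprD (_ : dint _ = dint (fun p => f p * dd 0 (F 1) p)) ?subrr ?oppr0//.
by apply: dint_ext => p /disk_cdisk dp; rewrite curl.
Qed.

Lemma energy_split f F : C 1 f -> (forall p, circle p -> f p = 0) -> (forall i, C 1 (F i)) ->
  (forall p, cdisk p -> dd 1 (F 0) p = dd 0 (F 1) p) ->
  dint (fun p => (dd 1 f p + F 0 p) ^+ 2 + (- dd 0 f p + F 1 p) ^+ 2) =
  dint (fun p => dd 1 f p ^+ 2 + (- dd 0 f p) ^+ 2) + dint (fun p => F 0 p ^+ 2 + F 1 p ^+ 2).
Proof.
move=> cf f0 cF curl; have cdf i : C 0 (dd i f) by exact: C_dd.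
have cF0 i : C 0 (F i) by exact: C_le (leq0n _) (cF i).
have c2 f1 f2 : C 0 f1 -> C 0 f2 -> C 0 (fun p => f1 p ^+ 2 + f2 p ^+ 2).
  by move=> c1 c2; apply: CD; exact: CM.
have c1 : C 0 (fun p => dd 1 f p ^+ 2 + (- dd 0 f p) ^+ 2) by apply: c2 => //; exact: (regN base_ucontP (cdf 0)).
have c3 : C 0 (fun p => F 0 p ^+ 2 + F 1 p ^+ 2) by exact: c2.
have c4 : C 0 (fun p => dd 1 f p * F 0 p - dd 0 f p * F 1 p) by apply: CB; exact: CM.
rewrite -[RHS]addr0 -[X in _ = _ + X](mulr0 (2 : R)) -[X in _ = _ + _ * X](curl_free_orthogonal cf f0 cF curl).
rewrite -dintZ// -!dintD//.
- by apply: dint_ext => p _; ring.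
- exact: (CD c1 c3).
- exact: (regZ base_ucontP 2 c4).
Qed.

Variables (N : 'I_2 -> R * R -> 'rV[R]_4) (tau : R * R -> R).
Hypotheses (cN : vC1 N) (oN : orthonormal N) (ctau : C 1 tau).
Hypothesis tau0 : forall p, circle p -> tau p = 0.
Hypothesis T0 : forall p, cdisk p -> torsion N 0 1 0 p = dd 1 tau p.
Hypothesis T1 : forall p, cdisk p -> torsion N 0 1 1 p = - dd 0 tau p.

(** Pythagoras, the mixed term being zero by orthogonality. The torsion of M enters only through
    squares, since a competing frame determines it up to sign. Both the minimality and the
    criticality of N are read off from this identity. *)
Lemma total_torsion_split M F : (forall i, C 1 (F i)) ->
  (forall p, cdisk p -> dd 1 (F 0) p = dd 0 (F 1) p) ->
  (forall i p, cdisk p -> torsion M 0 1 i p ^+ 2 = (torsion N 0 1 i p + F i p) ^+ 2) ->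
  total_torsion M = total_torsion N + 2 * dint (fun p => F 0 p ^+ 2 + F 1 p ^+ 2).
Proof.
move=> cF curl MF; rewrite /total_torsion -!/(dint _) -mulrDr; congr (_ * _).
rewrite [X in _ = X + _](dint_ext (g := fun p => dd 1 tau p ^+ 2 + (- dd 0 tau p) ^+ 2)); last first.
  by move=> p /disk_cdisk dp; rewrite T0// T1.
rewrite -energy_split//; apply: dint_ext => p /disk_cdisk dp.
by have := congr2 +%R (MF 0 p dp) (MF 1 p dp); rewrite (T0 dp) (T1 dp).
Qed.

(** A rotation by eps psi adds the curl-free field eps grad psi, so the total torsion is exactly a
    quadratic polynomial in eps without linear term. *)
Lemma total_torsion_rotate psi : C 2 psi ->
  is_derive (0 : R) (1 : R) (fun eps : R => total_torsion (rotate (fun p => eps * psi p) N)) 0.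
Proof.
move=> cpsi; have c1 := C_le (leqnSn 1) cpsi.
have cdp i : C 1 (dd i psi) by exact: C_dd.
rewrite (_ : (fun eps => _) = fun eps : R => total_torsion N +
    (2 * dint (fun p => dd 0 psi p ^+ 2 + dd 1 psi p ^+ 2)) * eps ^+ 2).
  set A := total_torsion N; set B := 2 * _.
  have h : is_derive (0 : R) (1 : R) (fun x : R => x ^+ 2) 0.
    have := is_deriveX 2 (is_derive_id (0 : R) (1 : R)).
    by congr is_derive; rewrite /GRing.scale /= expr1 mulr0 mul0r.
  have := is_deriveD (is_derive_cst A (0 : R) 1) (is_deriveZ B h).
  by congr is_derive; rewrite /GRing.scale /= mulr0 addr0.
apply/funext => eps.
have ce : C 1 (fun p => eps * psi p) by exact: (regZ base_ucontP eps c1).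
rewrite (@total_torsion_split _ (fun i p => eps * dd i psi p)).
- rewrite -mulrA [_ * eps ^+ 2]mulrC -(dintZ (eps ^+ 2)); last first.
    have c0 i : C 0 (dd i psi) by exact: C_dd.
    by apply: (CD (m := 0)); exact: (CM (c0 _) (c0 _)).
  by congr (_ + 2 * _); apply: dint_ext => p _; ring.
- by move=> i; exact: (regZ base_ucontP eps (cdp i)).
- by move=> p dp; rewrite !ddZ// (ddC base_ucontP cpsi dp).
- by move=> i p dp; rewrite torsion_rotate// ddZ.
Qed.

End Energy.

(** * The Schauder estimate for first derivatives, with an arbitrary exponent *)

Section Estimate.
Context {R : realType}.
Implicit Types (p q : R * R) (f g h tau : R * R -> R) (i j : 'I_2) (alpha beta : R).

Local Notation C := (reg ucont).

Lemma sup_norm_le f h : (forall p, cdisk p -> `|f p| <= `|h p|) -> (sup_norm f <= sup_norm h)%E.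
Proof.
move=> fh; apply: ge_ereal_sup => _ [p dp <-].
by apply: (@le_trans _ _ `|h p|%:E); [rewrite lee_fin fh|apply: ereal_sup_ubound; exists p].
Qed.

Lemma seminorm_le alpha f h : (forall p q, cdisk p -> cdisk q -> `|f p - f q| <= `|h p - h q|) ->
  (holder_seminorm alpha f <= holder_seminorm alpha h)%E.
Proof.
move=> fh; apply: ge_ereal_sup => _ [p [q [dp dq pq ->]]].
apply: (@le_trans _ _ (`|h p - h q| / edist p q `^ alpha)%:E).
  by rewrite lee_fin ler_wpM2r ?invr_ge0 ?powR_ge0// fh.
by apply: ereal_sup_ubound; exists p, q.
Qed.

Lemma holder_norm0_ext alpha f h : (forall p, cdisk p -> f p = h p) ->
  holder_norm 0 alpha f = holder_norm 0 alpha h.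
Proof.
move=> fh; rewrite !holder_norm0; apply/eqP; rewrite eq_le; apply/andP; split; apply: leeD;
  by [apply: sup_norm_le => p dp; rewrite fh|apply: seminorm_le => p q dp dq; rewrite !fh].
Qed.

Lemma big_ord2 (F : nat -> \bar R) : (\sum_(a < 2) F a = F 0%N + F 1%N)%E.
Proof. by rewrite !big_ord_recl big_ord0 adde0. Qed.

Lemma big_ord3 (F : nat -> \bar R) : (\sum_(a < 3) F a = F 0%N + (F 1%N + F 2%N))%E.
Proof. by rewrite !big_ord_recl big_ord0 adde0. Qed.

Lemma sum_multi1 (S : nat -> nat -> \bar R) :
  (\sum_(s < 2) \sum_(a < s.+1) S a (s - a)%N = S 0%N 0%N + (S 0%N 1%N + S 1%N 0%N))%E.
Proof. by rewrite !big_ord_recl !big_ord0 !adde0. Qed.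

Lemma sum_multi2 (S : nat -> nat -> \bar R) :
  (\sum_(s < 3) \sum_(a < s.+1) S a (s - a)%N =
   S 0%N 0%N + ((S 0%N 1%N + S 1%N 0%N) + (S 0%N 2%N + (S 1%N 1%N + S 2%N 0%N))))%E.
Proof. by rewrite !big_ord_recl !big_ord0 !adde0. Qed.

(** The norms are sums over derivatives, and the terms belonging to g are dominated by distinct
    terms belonging to tau. Hence the constant of the estimate carries over to the torsion without
    an extra factor. *)
Lemma holder_norm1_le alpha (c : R) i tau g : `|c| <= 1 -> C 2 tau ->
  (forall p, cdisk p -> g p = c * dd i tau p) -> (holder_norm 1 alpha g <= holder_norm 2 alpha tau)%E.
Proof.
move=> c1 ctau gE; have cdt : C 1 (dd i tau) by exact: C_dd.
have dg j p : cdisk p -> dd j g p = c * dd j (dd i tau) p.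
  move=> dp; rewrite -ddZ//; apply/esym; apply: dd_ext dp.
    exact: (regZ base_ucontP c cdt).
  by move=> q dq; rewrite gE.
have le f h : (forall p, cdisk p -> f p = c * h p) ->
    (sup_norm f <= sup_norm h)%E /\ (holder_seminorm alpha f <= holder_seminorm alpha h)%E.
  move=> fh; split; [apply: sup_norm_le => p dp|apply: seminorm_le => p q dp dq].
    by rewrite fh// normrM ler_piMl.
  by rewrite !fh// -mulrBr normrM ler_piMl.
have tC p : cdisk p -> dd 1 (dd 0 tau) p = dd 0 (dd 1 tau) p.
  by move=> dp; rewrite (ddC base_ucontP ctau dp).
rewrite /holder_norm (sum_multi1 (fun a b => sup_norm (pdn a b g))).
rewrite (sum_multi2 (fun a b => sup_norm (pdn a b tau))).
rewrite (big_ord2 (fun a => holder_seminorm alpha (pdn a (1 - a) g))).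
rewrite (big_ord3 (fun a => holder_seminorm alpha (pdn a (2 - a) tau))).
rewrite /pdn /= -ddE.
have s0 := @sup_norm_ge0 R; have q0 := @seminorm_ge0 R alpha.
have [h1 _] := le _ _ gE; have [h2 h3] := le _ _ (dg 1); have [h4 h5] := le _ _ (dg 0).
move: i {cdt} gE dg h1 h2 h3 h4 h5; apply: ord2P => gE dg h1 h2 h3 h4 h5.
  have [] := le (dd 1 g) (dd 0 (dd 1 tau)); first by move=> p dp; rewrite dg// tC.
  move=> k2 k3; apply: leeD; last by apply: lee_paddl => //; exact: leeD.
  apply: lee_paddl => //; apply: leeD; first by apply: lee_paddl.
  by apply: lee_paddl => //; exact: leeD.
apply: leeD; last by rewrite addeA; apply: lee_paddr => //; exact: leeD.
apply: lee_paddl => //; apply: leeD; first by apply: lee_paddr.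
by rewrite addeA; apply: lee_paddr => //; exact: leeD.
Qed.

(** Distances are at most 2, so passing to the smaller exponent costs the factor 2^(alpha -
    beta). *)
Lemma hol_mono alpha beta f : 0 < beta -> beta <= alpha -> hol alpha f -> hol beta f.
Proof.
move=> b0 ba [M H]; exists (`|M| * 2 `^ (alpha - beta)) => p q dp dq.
apply: le_trans (H _ _ dp dq) _.
have [d0 d2] := (edist_ge0 p q, edist_cdisk_le2 dp dq).
apply: le_trans (_ : `|M| * edist p q `^ alpha <= _).
  by rewrite ler_wpM2r ?ler_norm// powR_ge0.
rewrite -mulrA ler_wpM2l//; move: (edist p q) d0 d2 => d d0 d2.
have [->|dn0] := eqVneq d 0; first by rewrite !powR0 ?mulr0// gt_eqF// (lt_le_trans b0).
rewrite -{1}(subrK beta alpha) (powRD (x := d)) ?dn0 ?implybT//.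
by rewrite ler_wpM2r ?powR_ge0// powR_mono// subr_ge0.
Qed.

Variable K : R -> R.
Hypothesis hC : forall alpha : R, 0 < alpha < 1 ->
  forall tau : R * R -> R, holder 2 alpha tau ->
    (forall p, circle p -> tau p = 0) ->
    (holder_norm 2 alpha tau <= (K alpha)%:E * holder_norm 0 alpha (laplacian tau))%E.

(** The function 1 - r^2 vanishes on the circle and is 1 at the centre, so the estimate for it fails
    with a nonpositive constant. *)
Lemma schauder_constant_gt0 alpha : 0 < alpha < 1 -> 0 < K alpha.
Proof.
move=> a01; have bh := base_hol a01; rewrite ltNge; apply/negP => K0.
pose tau p := 1 - rho2 p.
have rt : reg (hol alpha) 2 tau.
  by apply: regB => //; [exact: reg_cst|exact: reg_rho2].
have t0 p : circle p -> tau p = 0 by rewrite /tau /rho2 => ->; rewrite subrr.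
have ht : holder 2 alpha tau by apply/holderP.
have H : (sup_norm tau <= 0%:E)%E.
  apply: (le_trans (sup_norm_le_holder (m := 2) (a := 0) (b := 0) alpha tau _)) => //.
  apply: (le_trans (hC a01 ht t0)).
  by apply: mule_le0_ge0; [rewrite lee_fin|exact: holder_norm_ge0].
have := proj1 (sup_norm_leP _ _) H 0 cdisk0.
by rewrite /tau /rho2 /= expr0n /= addr0 subr0 normr1; lra.
Qed.

(** Here tau is known to be of class C^(2+beta) only, while the estimate requires the exponent
    alpha. If the norm of f is infinite, so is the right-hand side, by positivity of the constant.
    Otherwise f has a solution of class C^(2+alpha), which coincides with tau. *)
Lemma dirichlet_gradient_estimate alpha beta (c : R) i f tau g : 0 < alpha < 1 -> 0 < beta < 1 ->
  reg (hol beta) 2 tau -> (forall p, circle p -> tau p = 0) ->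
  (forall p, cdisk p -> lap tau p = f p) ->
  `|c| <= 1 -> (forall p, cdisk p -> g p = c * dd i tau p) ->
  (holder_norm 1 alpha g <= (K alpha)%:E * holder_norm 0 alpha f)%E.
Proof.
move=> a01 b01 rt t0 lt c1 gE; have K0 := schauder_constant_gt0 a01.
have ct : C 2 tau by exact: (reg_ucontW (base_hol b01) rt).
have [Noo|] := boolP (holder_norm 0 alpha f == +oo%E).
  by rewrite (eqP Noo) gt0_muley ?lte_fin// leey.
rewrite -ltey => /(holP f a01) hf.
have [tau' [rt' t0' lt']] := dirichlet_hol hC a01 hf.
(* The smaller exponent is one at which both solutions are regular, so that uniqueness applies to
   them. *)
have c01 : 0 < Num.min alpha beta < 1.
  by move: a01 b01 => /andP[a0 a1] /andP[b0 b1]; rewrite lt_min a0 b0 gt_min a1.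
have m0 : 0 < Num.min alpha beta by case/andP: c01.
have E p : cdisk p -> tau' p = tau p.
  apply: (dirichlet_unique hC c01).
  - by apply: reg_mono rt' => h; apply: hol_mono => //; rewrite ge_min lexx.
  - by apply: reg_mono rt => h; apply: hol_mono => //; rewrite ge_min lexx orbT.
  - by move=> q cq; rewrite t0// t0'.
  - by move=> q dq; rewrite lt// lt'.
have ht : holder 2 alpha tau by apply/holderP => //; exact: (reg_ext (base_hol a01) E rt').
apply: (le_trans (holder_norm1_le alpha c1 ct gE)).
apply: (le_trans (hC a01 ht t0)).
by rewrite laplacianE (holder_norm0_ext alpha lt).
Qed.

End Estimate.

Theorem theorem4 (R : realType) (C : R -> R)
  (hC : forall alpha : R, 0 < alpha < 1 ->
     forall tau : R * R -> R, holder 2 alpha tau ->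
       (forall p, circle p -> tau p = 0) ->
       (holder_norm 2 alpha tau
          <= (C alpha)%:E * holder_norm 0 alpha (laplacian tau))%E)
  (k : nat) (hk : (3 <= k)%N) (beta : R) (hbeta : 0 < beta < 1)
  (X : R * R -> 'rV[R]_4) (W : R * R -> R)
  (hX : immersion k beta X) (hW : conformal X W) :
  exists N : 'I_2 -> R * R -> 'rV[R]_4,
    [/\ normal_coulomb_frame k beta X N,
        minimizes_total_torsion k beta X N
      & forall (alpha : R), 0 < alpha < 1 -> forall s t i : 'I_2,
          (holder_norm 1 alpha (torsion N s t i)
             <= (C alpha)%:E *
                holder_norm 0 alpha (fun p => normal_curvature W N p * W p)%R)%E].
Proof.
case: k hk hX => [|[|[|m]]] // _ {}hX; have bh := base_hol hbeta.
have [N0 hN0] := exists_normal_frame hbeta hX hW.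
have [T TE] : {T | T = torsion N0 0 1} by exists (torsion N0 0 1).
have rT i : reg (hol beta) m.+1 (T i) by rewrite TE; exact: (reg_torsion hbeta hN0).
have cT i : reg ucont 1 (T i) by apply: C_le (reg_ucontW bh (rT i)).
have [tau [rtau tau0 ltau]] : exists tau, [/\ reg (hol beta) m.+2 tau,
    forall p, circle p -> tau p = 0 & forall p, cdisk p -> lap tau p = dd 1 (T 0) p - dd 0 (T 1) p].
  by apply: (dirichlet_reg hC) => //; apply: regB => //; exact: reg_dd.
have ctau : reg ucont 2 tau by apply: C_le (reg_ucontW bh rtau).
have ctau1 : reg ucont 1 tau by exact: C_le ctau.
have cdt i : reg ucont 1 (dd i tau) by exact: C_dd.
pose U (i : 'I_2) p := if i == 0 then dd 1 tau p else - dd 0 tau p.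
pose G (i : 'I_2) p := U i p - T i p.
have rU i : reg (hol beta) m.+1 (U i).
  by move: i; apply: ord2P; [exact: reg_dd|apply: regN => //; exact: reg_dd].
have rG i : reg (hol beta) m.+1 (G i) by exact: regB.
have cG i : reg ucont 1 (G i) by apply: C_le (reg_ucontW bh (rG i)).
have curlG p : cdisk p -> dd 1 (G 0) p = dd 0 (G 1) p.
  move=> dp; have := ltau p dp; rewrite lapE /G /U /= !ddB// ?ddN//; first lra.
  exact: (regN base_ucontP (cdt 0)).
have [phi gphi] := poincare cG curlG.
(* The order is k - 1 for k = m.+3, the class required of a normal frame. It comes from the gradient
   [G], hence from tau being of class m.+2 although its right-hand side is only of class m. *)
have rphi : reg (hol beta) m.+2 phi by exists G.
have cphi : reg ucont 1 phi by apply: C_le (reg_ucontW bh rphi).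
have cN0 : vC1 N0 by move=> s; exact: (vreg_le base_ucontP (leqnSn 1) (normal_frame_C hbeta hN0 s)).
have oN0 := normal_frame_orthonormal hN0.
pose N := rotate phi N0.
have hN : normal_frame m.+3 beta X N by exact: (rotate_normal_frame hbeta hN0).
have cN2 := normal_frame_C hbeta hN.
have cN : vC1 N by move=> s; exact: (vreg_le base_ucontP (leqnSn 1) (cN2 s)).
have oN := normal_frame_orthonormal hN.
have TN i p : cdisk p -> torsion N 0 1 i p = U i p.
  move=> dp; rewrite torsion_rotate// (dd_grad i gphi dp) /G TE; ring.
have TN0 p : cdisk p -> torsion N 0 1 0 p = dd 1 tau p by exact: TN.
have TN1 p : cdisk p -> torsion N 0 1 1 p = - dd 0 tau p by exact: TN.
exists N; split.
- split=> // psi spsi; apply: (total_torsion_rotate cN oN ctau1 tau0 TN0 TN1).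
  exact/Cdisk_reg.
- move=> M hM; have [F [cF curlF MF]] := torsion_change cN2 (normal_frame_C hbeta hM)
    (normal_frame_onb hX hW hN) (normal_frame_onb hX hW hM).
  rewrite (total_torsion_split ctau1 tau0 TN0 TN1 cF curlF MF) lerDl.
  by rewrite mulr_ge0// dint_ge0// => p _; rewrite addr_ge0// sqr_ge0.
- move=> alpha a01 s t i.
  have rtau2 : reg (hol beta) 2 tau by exact: (reg_le bh _ rtau).
  have lN p : cdisk p -> lap tau p = normal_curvature W N p * W p.
    move=> dp; rewrite /normal_curvature -ddE mulrC mulrA divff ?mul1r; last first.
      by rewrite gt_eqF// (conformal_gt0 hX hW).
    rewrite lapE -(dd_ext 1 (cdt 1) (fun q dq => esym (TN0 q dq)) dp).
    rewrite -(dd_ext 0 (regN base_ucontP (cdt 0)) (fun q dq => esym (TN1 q dq)) dp).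
    by rewrite ddN// opprK addrC.
  (* Every torsion coefficient is c times a first derivative of tau with c one of 0, 1, -1; the
     value 0 serves for equal upper and lower index. *)
  have H c j := @dirichlet_gradient_estimate R C hC alpha beta c j _ tau (torsion N s t i) a01 hbeta rtau2 tau0 lN.
  have TS p : cdisk p -> torsion N 1 0 i p = - U i p.
    by move=> dp; rewrite torsion_skew// TN.
  move: s t i H TS; apply: ord2P; apply: ord2P => i H TS.
  + by apply: (H 0 0) => [|p dp]; rewrite ?normr0// torsion_diag// mul0r.
  + move: i {TS} H; apply: ord2P => H.
      by apply: (H 1 1) => [|p dp]; rewrite ?normr1// TN// mul1r.
    by apply: (H (-1) 0) => [|p dp]; rewrite ?normrN1// TN// mulN1r.
  + move: i TS H; apply: ord2P => TS H.
      by apply: (H (-1) 1) => [|p dp]; rewrite ?normrN1// TS// mulN1r.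
    by apply: (H 1 0) => [|p dp]; rewrite ?normr1// TS// mul1r /U opprK.
  + by apply: (H 0 0) => [|p dp]; rewrite ?normr0// torsion_diag// mul0r.
Qed.
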